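(* Let $n\ge 1$, $p\in(1,\infty)$, $s\in(0,1)$, $0<\lambda\le\Lambda<\infty$, and let $\Omega\subset\mathbb{R}^n$ be a bounded domain with Lipschitz boundary. For any sequence $\{a_k\}_{k=1}^\infty\subset\mathcal{A}_{\lambda,\Lambda}$ there exist a subsequence $\{a_{k'}\}$ and a function $a\in\mathcal{A}_{\lambda,\Lambda}$ (with the same constants $\lambda,\Lambda$) such that $\mathcal{L}_{a_{k'}}$ $H$-converges to $\mathcal{L}_a$.
   Context: Let $p'=p/(p-1)$. The class of admissible coefficients is $$\mathcal{A}_{\lambda,\Lambda}=\{a\in L^\infty(\mathbb{R}^n\times\mathbb{R}^n): a(x,y)=a(y,x),\ \lambda\le a(x,y)\le\Lambda \text{ for a.e. } (x,y)\in\mathbb{R}^n\times\mathbb{R}^n\}.$$ The $(s,p)$-nonlocal gradient of $u$ is $D_{s,p}u(x,y)=\dfrac{u(x)-u(y)}{|x-y|^{n/p+s}}$. The fractional Sobolev space is $W^{s,p}(\mathbb{R}^n)=\{u\in L^p(\mathbb{R}^n): D_{s,p}u\in L^p(\mathbb{R}^n\times\mathbb{R}^n)\}$ with norm $(\|u\|_{L^p(\mathbb{R}^n)}^p+\|D_{s,p}u\|_{L^p(\mathbb{R}^n\times\mathbb{R}^n)}^p)^{1/p}$, and $W_0^{s,p}(\Omega)=\{u\in W^{s,p}(\mathbb{R}^n): u=0 \text{ a.e. in }\mathbb{R}^n\setminus\Omega\}$, whose dual space is denoted $W^{-s,p'}(\Omega)$. For $a\in\mathcal{A}_{\lambda,\Lambda}$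 the nonlocal operator is $$\mathcal{L}_a u(x)=\mathrm{p.v.}\int_{\mathbb{R}^n}a(x,y)\frac{|u(x)-u(y)|^{p-2}(u(x)-u(y))}{|x-y|^{n+sp}}\,dy.$$ For $f\in W^{-s,p'}(\Omega)$, the problem $\mathcal{L}_a u=f$ in $\Omega$, $u=0$ in $\mathbb{R}^n\setminus\Omega$, is understood weakly: $u\in W_0^{s,p}(\Omega)$ and $$\frac12\iint_{\mathbb{R}^n\times\mathbb{R}^n}a(x,y)\frac{|u(x)-u(y)|^{p-2}(u(x)-u(y))(v(x)-v(y))}{|x-y|^{n+sp}}\,dx\,dy=\langle f,v\rangle\quad\text{for all } v\in C_c^\infty(\Omega).$$ This problem has a unique solution $u\in W_0^{s,p}(\Omega)$. One writes $(u,q)=\mathcal{S}_a f$, where $u$ is this solution and $q=a|D_{s,p}u|^{p-2}D_{s,p}u$ is the associated nonlocal flux. Definition ($H$-convergence). $\mathcal{L}_{a_k}$ $H$-converges to $\mathcal{L}_a$ if for every $f\in W^{-s,p'}(\Omega)$, with $(u_k,q_k)=\mathcal{S}_{a_k}f$ and $(u,q)=\mathcal{S}_a f$, one has: (1) $u_k\rightharpoonup u$ weakly in $W_0^{s,p}(\Omega)$; and (2) $q_k\rightharpoonup q$ weakly in $L^{p'}(\Omega\times\Omega)$. *)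

(* Defs.v *)
From HB Require Import structures.
From mathcomp Require Import all_boot all_order all_algebra.
From mathcomp Require Import all_classical all_reals all_analysis.

Set Implicit Arguments.
Unset Strict Implicit.
Unset Printing Implicit Defensive.

Import Order.TTheory GRing.Theory Num.Def Num.Theory.
Import numFieldNormedType.Exports.

Local Open Scope classical_set_scope.
Local Open Scope ring_scope.

(** Points of R^n are row vectors ['rV[R]_n], with the topology of the library
    (sup norm).  The library has no sigma-algebra on them and no n-dimensional
    Lebesgue measure: we use the sigma-algebra generated by the coordinates
    (the Borel one) and iterate the product with [lebesgue_measure]. *)

Definition rV_display : measure_display. Proof. exact: default_measure_display. Qed.

Section measurable_rV.
Context {R : realType} {n : nat}.

Definition rV_coord (i : 'I_n) (x : 'rV[R]_n) : measurableTypeR R := x 0 i.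

Let rV_set0 : g_sigma_preimage rV_coord set0.
Proof. exact: sigma_algebra0. Qed.

Let rV_setC A : g_sigma_preimage rV_coord A -> g_sigma_preimage rV_coord (~` A).
Proof. exact: sigma_algebraC. Qed.

Let rV_bigcup (F : (set 'rV[R]_n)^nat) :
  (forall i, g_sigma_preimage rV_coord (F i)) ->
  g_sigma_preimage rV_coord (\bigcup_i (F i)).
Proof. exact: sigma_algebra_bigcup. Qed.

HB.instance Definition _ := @isMeasurable.Build rV_display 'rV[R]_n
  (g_sigma_preimage rV_coord) rV_set0 rV_setC rV_bigcup.

Lemma measurable_rV_coord (i : 'I_n) :
  measurable_fun [set: 'rV[R]_n] (rV_coord i).
Proof.
move=> _ Y mY; rewrite setTI; apply: sub_sigma_algebra => /=.
rewrite -bigcup_seq/=; exists i => /=; first by rewrite mem_index_enum.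
by exists Y => //; rewrite setTI.
Qed.

Lemma measurable_fun_rVP d (T : measurableType d) (f : T -> 'rV[R]_n) :
  (forall i, measurable_fun [set: T] (rV_coord i \o f)) ->
  measurable_fun [set: T] f.
Proof.
move=> mf _ A mA; rewrite setTI.
have : g_sigma_preimage rV_coord `<=` [set B | measurable (f @^-1` B)].
  apply: smallest_sub.
    split => //=.
    - by rewrite preimage_set0.
    - by move=> B mB; rewrite setTD preimage_setC; exact: measurableC.
    - by move=> F mF; rewrite preimage_bigcup; exact: bigcupT_measurable.
  rewrite -bigcup_seq/= => B [i _ [C mC <-]] /=.
  by rewrite setTI -comp_preimage -[X in measurable X]setTI; exact: mf.
exact.
Qed.

End measurable_rV.

Section lebesgue_rV.
Context {R : realType}.

Definition rV_cons {n} (z : measurableTypeR R * 'rV[R]_n) : 'rV[R]_n.+1 :=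
  row_mx (const_mx z.1 : 'rV_1) z.2.

Definition rV_uncons {n} (x : 'rV[R]_n.+1) : measurableTypeR R * 'rV[R]_n :=
  (x 0 ord0, rsubmx (x : 'rV_(1 + n))).

Lemma rV_cons0 {n} z : @rV_cons n z 0 ord0 = z.1.
Proof.
have -> : ord0 = lshift n (0 : 'I_1) by apply: ord_inj.
by rewrite (row_mxEl (const_mx z.1 : 'rV_1)) mxE.
Qed.

Lemma rV_consS {n} z i : @rV_cons n z 0 (lift ord0 i) = z.2 0 i.
Proof.
have -> : lift ord0 i = rshift 1 i by apply: ord_inj.
by rewrite (row_mxEr (const_mx z.1 : 'rV_1)).
Qed.

Lemma rV_consK {n} : cancel (@rV_cons n) rV_uncons.
Proof.
by move=> [a v]; rewrite /rV_uncons rV_cons0 row_mxKr.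
Qed.

Lemma measurable_rV_cons {n} : measurable_fun setT (@rV_cons n).
Proof.
apply: measurable_fun_rVP => i.
case: (unliftP ord0 i) => [j ->|->].
  rewrite (_ : _ \o _ = rV_coord j \o snd).
    by apply: measurableT_comp => //; exact: measurable_rV_coord.
  by apply/funext => z; exact: rV_consS.
rewrite (_ : _ \o _ = fst)//.
by apply/funext => z; exact: rV_cons0.
Qed.

Lemma measurable_rV_uncons {n} : measurable_fun setT (@rV_uncons n).
Proof.
apply: measurable_fun_pair; first exact: measurable_rV_coord.
apply: measurable_fun_rVP => i.
rewrite (_ : _ \o _ = rV_coord (rshift 1 i)); first exact: measurable_rV_coord.
by apply/funext => x /=; rewrite /rV_coord mxE.
Qed.

Section step.
Context {n : nat} (mu : {sigma_finite_measure set 'rV[R]_n -> \bar R}).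

Local Open Scope ereal_scope.

Definition lebesgue_rV_step : set 'rV[R]_n.+1 -> \bar R :=
  pushforward (lebesgue_measure \x mu) rV_cons.

Let step_measure : {measure set 'rV[R]_n.+1 -> \bar R} :=
  measure_function_pushforward__canonical__measure_function_Measure
    (lebesgue_measure \x mu) (@measurable_rV_cons n).

HB.instance Definition _ := isMeasure.Build _ _ _ lebesgue_rV_step
  (measure0 step_measure) (measure_ge0 step_measure)
  (@measure_semi_sigma_additive _ _ _ step_measure).

Let step_sigma_finite : sigma_finite setT lebesgue_rV_step.
Proof.
have /sigma_finiteP[F [TF ndF Foo]] := sigma_finiteT (@lebesgue_measure R).
have /sigma_finiteP[G [TG ndG Goo]] := sigma_finiteT mu.
exists (fun k => rV_uncons @^-1` (F k `*` G k)).
  apply/esym; rewrite -subTset => x _.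
  have [k _ Fk] : (\bigcup_k F k) (rV_uncons x).1 by rewrite -TF.
  have [l _ Gl] : (\bigcup_k G k) (rV_uncons x).2 by rewrite -TG.
  exists (maxn k l) => //; split.
  - by move: Fk; exact/subsetPset/ndF/leq_maxl.
  - by move: Gl; exact/subsetPset/ndG/leq_maxr.
move=> k; have [mF Flty] := Foo k; have [mG Glty] := Goo k; split.
  by rewrite -[X in measurable X]setTI; apply: measurable_rV_uncons => //;
    exact: measurableX.
rewrite /lebesgue_rV_step /pushforward -comp_preimage.
rewrite (_ : _ \o _ = id); last by apply/funext => z; exact: rV_consK.
by rewrite preimage_id product_measure1E// lte_mul_pinfty// ge0_fin_numE.
Qed.

HB.instance Definition _ := @Measure_isSigmaFinite.Build _ _ _ lebesgue_rV_step
  step_sigma_finite.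

End step.

Fixpoint lebesgue_rV (n : nat) : {sigma_finite_measure set 'rV[R]_n -> \bar R} :=
  match n with
  | 0 => dirac (0 : 'rV[R]_0)
  | m.+1 => lebesgue_rV_step (lebesgue_rV m)
  end.

Lemma measurable_rV_box n (A : 'I_n -> set (measurableTypeR R)) :
  (forall i, measurable (A i)) ->
  measurable [set x : 'rV[R]_n | forall i, A i (x 0%R i)].
Proof.
move=> mA; rewrite (_ : mkset _ = \bigcap_i (rV_coord i @^-1` A i)).
  apply: fin_bigcap_measurable => // i _.
  by rewrite -[X in measurable X]setTI; exact: measurable_rV_coord.
by apply/seteqP; split => x /= Ax i; [move=> _; exact: Ax|exact: (Ax i)].
Qed.

Lemma lebesgue_rV_box n (A : 'I_n -> set (measurableTypeR R)) :
  (forall i, measurable (A i)) ->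
  (lebesgue_rV n [set x | forall i, A i (x 0%R i)] =
   \prod_(i < n) lebesgue_measure (A i))%E.
Proof.
elim: n A => [|n IH] A mA; first by rewrite big_ord0 /= diracE mem_set// => -[].
rewrite big_ord_recl -IH//= /lebesgue_rV_step -product_measure1E//; last first.
  exact: (measurable_rV_box (fun i => mA (lift ord0 i))).
congr (product_measure1 _ _ _).
apply/seteqP; split => [z Az|z [/= A0 Az] i].
  split=> [|i]; first by rewrite /= -rV_cons0; exact: Az.
  by rewrite -rV_consS; exact: Az.
by case: (unliftP ord0 i) => [j ->|->]; rewrite (rV_cons0, rV_consS).
Qed.

End lebesgue_rV.

(** Lipschitz domains. *)

Section domains.
Context {R : realType} {n : nat}.
Implicit Types (Omega : set 'rV[R]_n).

(* The norm of the library on ['rV[R]_n] is the sup norm. *)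
Definition enorm (x : 'rV[R]_n) : R := Num.sqrt (\sum_(i < n) x 0 i ^+ 2).

Definition boundary Omega : set 'rV[R]_n := closure Omega `\` interior Omega.

(* Near each boundary point, in suitable orthonormal coordinates
   [y = x *m Q], [Omega] is the region above the graph of a Lipschitz function
   of the [n - 1] coordinates of [y] other than the [i]-th one. *)
Definition lipschitz_boundary Omega : Prop :=
  forall x0, boundary Omega x0 ->
  exists (r : R) (Q : 'M[R]_n) (i : 'I_n) (k : R) (gamma : 'rV[R]_n.-1 -> R),
    [/\ 0 < r, Q *m Q^T = 1%:M, k.-lipschitz gamma &
        forall x, enorm (x - x0) < r ->
          (Omega x <-> gamma (col' i (x *m Q)) < (x *m Q) 0 i)].

Definition bounded_lipschitz_domain Omega : Prop :=
  [/\ Omega !=set0, open Omega, connected Omega, bounded_set Omega &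
      lipschitz_boundary Omega].

Fixpoint iter_partial (l : seq 'I_n) (f : 'rV[R]_n -> R) : 'rV[R]_n -> R :=
  if l is i :: l' then fun x => 'D_(delta_mx 0 i) (iter_partial l' f) x else f.

Definition smooth (f : 'rV[R]_n -> R) : Prop :=
  forall l : seq 'I_n, continuous (iter_partial l f) /\
    forall x i, derivable (iter_partial l f) x (delta_mx 0 i).

Definition test_function Omega : set ('rV[R]_n -> R) :=
  [set v | [/\ smooth v, compact (closure [set x | v x != 0]) &
               closure [set x | v x != 0] `<=` Omega]].

End domains.

(** Spaces of functions, not quotiented by a.e. equality, with a seminorm.
    A functional bounded by the seminorm does not separate functions at
    distance 0, so it is a functional on the quotient space. *)

Section weak_convergence.
Context {R : realType} {T : Type}.
Variables (E : set (T -> R)) (N : (T -> R) -> \bar R).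

Definition dual : set ((T -> R) -> R) :=
  [set F | (forall (c : R) u v, E u -> E v ->
              F (fun x => c * u x + v x) = c * F u + F v) /\
           exists C : R, forall u, E u -> (`|F u|%:E <= C%:E * N u)%E].

Definition weak_cvg (u_ : nat -> T -> R) (u : T -> R) : Prop :=
  [/\ forall k, E (u_ k), E u & forall F, dual F -> F (u_ k) @[k --> \oo] --> F u].

End weak_convergence.

Section nonlocal.
Context {R : realType} {n : nat}.
Variables (p s : R).
Local Notation E := 'rV[R]_n.

Local Notation mu := (@lebesgue_rV R n).

Definition lebesgue_rV2 : {measure set (E * E)%type -> \bar R} :=
  (mu \x mu)%E.

Local Notation mu2 := lebesgue_rV2.

Definition admissible (lam Lam : R) : set (E * E -> R) :=
  [set a | a \in Lfun mu2 +oo%E /\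
    {ae mu2, forall z, a z = a (z.2, z.1) /\ lam <= a z <= Lam}].

Definition nonlocal_gradient (u : E -> R) (z : E * E) : R :=
  (u z.1 - u z.2) / enorm (z.1 - z.2) `^ (n%:R / p + s).

Definition Wsp : set (E -> R) :=
  [set u | u \in Lfun mu p%:E /\ nonlocal_gradient u \in Lfun mu2 p%:E].

Definition Wsp_norm (u : E -> R) : \bar R :=
  (('N[mu]_p%:E[EFin \o u] `^ p +
    'N[mu2]_p%:E[EFin \o nonlocal_gradient u] `^ p) `^ p^-1)%E.

Definition W0sp (Omega : set E) : set (E -> R) :=
  [set u | Wsp u /\ {ae mu, forall x, ~ Omega x -> u x = 0}].

Definition dual_W0sp (Omega : set E) : set ((E -> R) -> R) :=
  dual (W0sp Omega) Wsp_norm.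

Definition weak_solution (Omega : set E) (a : E * E -> R) (f : (E -> R) -> R)
    (u : E -> R) : Prop :=
  W0sp Omega u /\
  forall v, test_function Omega v ->
    2^-1 * (\int[mu2]_z
      (a z * (`|u z.1 - u z.2| `^ (p - 2) * (u z.1 - u z.2) * (v z.1 - v z.2)
              / enorm (z.1 - z.2) `^ (n%:R + s * p)))) = f v.

Definition flux (a : E * E -> R) (u : E -> R) (z : E * E) : R :=
  a z * `|nonlocal_gradient u z| `^ (p - 2) * nonlocal_gradient u z.

(* [solution_map Omega a f (u, q)] is the graph of the solution operator,
   [u] being determined by [a] and [f] up to a.e. equality only. *)
Definition solution_map (Omega : set E) (a : E * E -> R) (f : (E -> R) -> R)
    (uq : (E -> R) * (E * E -> R)) : Prop :=
  weak_solution Omega a f uq.1 /\ uq.2 = flux a uq.1.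

Definition LpD (D : set (E * E)) (r : R) : set (E * E -> R) :=
  [set w | w \_ D \in Lfun mu2 r%:E].

Definition LpD_norm (D : set (E * E)) (r : R) (w : E * E -> R) : \bar R :=
  'N[mu2]_r%:E[EFin \o (w \_ D)].

Definition H_converges (Omega : set E) (a_ : nat -> E * E -> R)
    (a : E * E -> R) : Prop :=
  forall f, dual_W0sp Omega f ->
  forall (u_ : nat -> E -> R) (q_ : nat -> E * E -> R) (u : E -> R)
         (q : E * E -> R),
    (forall k, solution_map Omega (a_ k) f (u_ k, q_ k)) ->
    solution_map Omega a f (u, q) ->
    weak_cvg (W0sp Omega) Wsp_norm u_ u /\
    weak_cvg (LpD (Omega `*` Omega) (p / (p - 1)))
             (LpD_norm (Omega `*` Omega) (p / (p - 1))) q_ q.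

End nonlocal.

(* Main.v *)
(** The H-limit [a] is the weak-* limit of a subsequence of the coefficients
    [a_k].  Write [D] for the nonlocal gradient, [J t = |t|^(p-2) t], and let
    [u_k], [u] be the solutions for [a_k], [a].  Test functions are dense in
    the space of finite energy functions vanishing outside [Omega] (cut off,
    translate inwards, mollify), so both equations may be tested with
    [w_k = u_k - u], which yields
    [lam * (J (D u_k) - J (D u), D w_k) <= - ((a_k - a) J (D u), D w_k)].
    The right-hand side tends to 0: away from the diagonal and from infinity
    it only involves the values of [w_k], a sequence compact in L^1, so that
    the weak-* convergence of [a_k] applies.  Coercivity of [J] then
    gives strong convergence of [u_k] in the energy norm and of [J (D u_k)] in
    [L^p'].  The flux splits as
    [a_k (J (D u_k) - J (D u)) + a_k J (D u)], where the first term tends to 0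
    strongly and the second one converges weakly because [a_k] does weakly-*. *)

From HB Require Import structures.
Require Import Defs.
From mathcomp Require Import all_boot all_order all_algebra.
From mathcomp Require Import all_classical all_reals all_analysis.
From mathcomp Require Import measurable_realfun ess_sup_inf.
From mathcomp Require Import ring lra.
Import Order.TTheory GRing.Theory Num.Theory.
Import numFieldNormedType.Exports.
Local Open Scope classical_set_scope.
Local Open Scope ring_scope.

Set Implicit Arguments.
Unset Strict Implicit.
Unset Printing Implicit Defensive.

(** * Monotonicity and coercivity of the power nonlinearity *)

(** In the local theory gradients converge only weakly, and the weak-* limit of the coefficients is
    in general not the H-limit. Here the nonlocal gradient at a pair of distinct points is a fixed
    multiple of a difference of values, so compactness of the functions themselves is enough. The
    subsequence has to serve every datum [f] at once. Compactness therefore enters as total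
    boundedness: on a cube, each function of bounded energy is close in L^1 to a combination of
    finitely many indicators fixed in advance. The pairing then converges along the very subsequence
    selected for the coefficients. The weak equation is given for smooth test functions only,
    whereas the argument tests with [u_k - u]; this extension is where the Lipschitz boundary is
    used. Density is proved in dual form: a linear functional bounded by the energy and zero on test
    functions is zero. The Poincare inequality brings every functional bounded by the full norm into
    that class. *)

Section power_nonlinearity.
Context {R : realType}.
Implicit Types p q x y t d e : R.

Definition Jp p t := `|t| `^ (p - 2) * t.

Lemma Jp0 p : Jp p 0 = 0. Proof. by rewrite /Jp mulr0. Qed.

Lemma JpM p x y : Jp p (x * y) = Jp p x * Jp p y.
Proof. by rewrite /Jp normrM powRM// mulrACA. Qed.

Lemma JpE p t : 0 <= t -> 1 < p -> Jp p t = t `^ (p - 1).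
Proof.
move=> t0 p1; rewrite /Jp ger0_norm//.
have [->|tN] := eqVneq t 0; first by rewrite mulr0 powR0//; apply: lt0r_neq0; lra.
rewrite -[X in _ * X]powRr1// -powRD; last by rewrite tN implybT.
by congr (_ `^ _); ring.
Qed.

Lemma JpN p t : Jp p (- t) = - Jp p t.
Proof. by rewrite /Jp normrN mulrN. Qed.

Lemma norm_Jp p t : 1 < p -> `|Jp p t| = `|t| `^ (p - 1).
Proof.
move=> p1; rewrite -JpE// {1}/Jp normrM ger0_norm ?powR_ge0//.
by rewrite /Jp normr_id.
Qed.

Lemma Jp_mulr p t : 1 < p -> Jp p t * t = `|t| `^ p.
Proof.
move=> p1; have -> : Jp p t * t = `|t| * `|t| `^ (p - 1).
  rewrite -JpE// /Jp normr_id -mulrA -expr2 -real_normK ?num_real// expr2.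
  by rewrite mulrCA.
by rewrite mulr_powRB1//; lra.
Qed.

Lemma conj_exp p : 1 < p -> 1 < p / (p - 1).
Proof. by move=> p1; rewrite ltr_pdivlMr ?mul1r; lra. Qed.

Lemma conj_exp_inv p : 1 < p -> p^-1 + (p / (p - 1))^-1 = 1.
Proof. by move=> p1; field; apply/andP; split; apply: lt0r_neq0; lra. Qed.

Lemma norm_Jp_conj p t : 1 < p -> `|Jp p t| `^ (p / (p - 1)) = `|t| `^ p.
Proof.
move=> p1; rewrite norm_Jp// -powRrM; congr (_ `^ _).
by field; apply: lt0r_neq0; lra.
Qed.

(** The exponents [p - 1] and [p' - 1], with p' = [p / (p - 1)], are inverse to each other, and so
    are the two nonlinearities. Substituting [Jp p x] and [Jp p y] in the coercivity estimate for p'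
    thus yields the dual estimate [Jp_coercive_dual]. *)
Lemma Jp_conjK p t : 1 < p -> Jp (p / (p - 1)) (Jp p t) = t.
Proof.
move=> p1; have [->|t0] := eqVneq t 0; first by rewrite !Jp0.
rewrite /Jp normrM ger0_norm ?powR_ge0// powRM ?powR_ge0// -powRrM.
have nt0 : `|t| != 0 by rewrite normr_eq0.
rewrite mulrA -powRD; last by rewrite nt0 implybT.
rewrite -powRD; last by rewrite nt0 implybT.
rewrite [X in _ `^ X](_ : _ = 0) ?powRr0 ?mul1r//.
by field; apply: lt0r_neq0; lra.
Qed.

Lemma ltr_Jp p x y : 1 < p -> x < y -> Jp p x < Jp p y.
Proof.
move=> p1; have p10 : 0 < p - 1 by lra.
have pos u v : 0 <= u -> u < v -> Jp p u < Jp p v.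
  move=> u0 uv; rewrite !JpE//; last by lra.
  by apply: gt0_ltr_powR => //; rewrite nnegrE; lra.
have Jge0 u : 0 <= u -> 0 <= Jp p u by move=> u0; rewrite JpE ?powR_ge0.
move=> xy; have [x0|x0] := leP 0 x; first exact: pos.
have [y0|y0] := leP y 0.
  by rewrite -ltrN2 -!JpN; apply: pos; lra.
have : Jp p 0 < Jp p (- x) by apply: pos; lra.
have : Jp p 0 < Jp p y by apply: pos; lra.
rewrite JpN !Jp0; lra.
Qed.

Lemma ler_Jp p x y : 1 < p -> x <= y -> Jp p x <= Jp p y.
Proof.
by move=> p1; rewrite le_eqVlt => /predU1P[->//|xy]; apply/ltW/ltr_Jp.
Qed.

Lemma Jp_monotone p x y : 1 < p -> 0 <= (Jp p x - Jp p y) * (x - y).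
Proof.
move=> p1; have [xy|xy] := leP y x.
  by rewrite mulr_ge0 ?subr_ge0// ler_Jp.
by rewrite mulr_le0 ?subr_le0// ?ler_Jp// ltW.
Qed.

(** Either [1 - t] is at most [e], the p-th root of [d], and the first term is large enough; or both
    factors of the product are bounded below, by [m] and [e], while the left-hand side never exceeds
    2^p. *)
Lemma Jp_coercive_unit p d : 1 < p -> 0 < d -> exists2 C, 0 <= C &
  forall t, -1 <= t <= 1 -> (1 - t) `^ p <= d + C * ((1 - Jp p t) * (1 - t)).
Proof.
move=> p1 d0; pose e := d `^ p^-1; have e0 : 0 < e by exact: powR_gt0.
have J1 : Jp p 1 = 1 by rewrite JpE// powR1.
have m0 : 0 < 1 - Jp p (1 - e) by rewrite subr_gt0 -[ltRHS]J1 ltr_Jp//; lra.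
set m := 1 - _ in m0.
exists (2 `^ p / (m * e)) => [|t /andP[t1 t2]].
  by rewrite divr_ge0 ?powR_ge0// ltW// mulr_gt0.
have Jt1 : 0 <= 1 - Jp p t by rewrite subr_ge0 -[leRHS]J1 ler_Jp.
have [te|te] := leP (1 - t) e.
  rewrite -[leLHS]addr0 lerD//; last first.
    apply: mulr_ge0; last by apply: mulr_ge0; lra.
    by apply: divr_ge0; [exact: powR_ge0|rewrite ltW// mulr_gt0].
  have -> : d = e `^ p by rewrite -powRrM mulVf ?powRr1// ?ltW//; apply: lt0r_neq0; lra.
  by apply: ge0_ler_powR; rewrite ?nnegrE; lra.
apply: (@le_trans _ _ (2 `^ p)).
  by apply: ge0_ler_powR; rewrite ?nnegrE; lra.
apply: (@le_trans _ _ (2 `^ p / (m * e) * (m * e))).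
  by rewrite divfK//; apply: lt0r_neq0; rewrite mulr_gt0.
rewrite -[leLHS]add0r lerD//; first exact: ltW.
rewrite ler_wpM2l ?divr_ge0 ?powR_ge0//; first by rewrite ltW// mulr_gt0.
apply: ler_pM; [exact: ltW|exact: ltW| |exact: ltW].
by rewrite lerD2l lerN2 ler_Jp//; lra.
Qed.

(* By homogeneity it suffices to treat [x = 1] and [|y| <= 1]; this avoids the
   usual case distinction [p < 2] / [p >= 2]. *)
Lemma Jp_coercive p d : 1 < p -> 0 < d -> exists2 C, 0 <= C &
  forall x y, `|x - y| `^ p <=
    d * (`|x| `^ p + `|y| `^ p) + C * ((Jp p x - Jp p y) * (x - y)).
Proof.
move=> p1 d0; have [C C0 HC] := Jp_coercive_unit p1 d0.
exists C => //.
suff main x y : `|y| <= `|x| -> `|x - y| `^ p <=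
    d * `|x| `^ p + C * ((Jp p x - Jp p y) * (x - y)).
  move=> x y; have [yx|/ltW xy] := leP `|y| `|x|.
    apply: (le_trans (main _ _ yx)); rewrite lerD2r ler_pM2l// lerDl.
    exact: powR_ge0.
  rewrite distrC; apply: (le_trans (main _ _ xy)).
  rewrite -[leRHS](_ : d * (`|x| `^ p + `|y| `^ p) +
    C * ((Jp p y - Jp p x) * (y - x)) = _); last by ring.
  by rewrite lerD2r ler_pM2l// lerDr powR_ge0.
have [->|x0] := eqVneq x 0.
  rewrite normr0 normr_le0 => /eqP ->.
  rewrite !subrr normr0 powR0 ?mulr0 ?add0r ?mulr0//; apply: lt0r_neq0; lra.
move=> yx; pose t := y / x; have -> : y = x * t by rewrite /t mulrC divfK.
have t1 : -1 <= t <= 1.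
  by rewrite -ler_norml normf_div ler_pdivrMr ?normr_gt0// mul1r.
have := HC t t1; move/(ler_wpM2l (powR_ge0 `|x| p)).
rewrite -powRM//; last by lra.
have -> : `|x - x * t| = `|x| * (1 - t).
  by rewrite -[X in X - _]mulr1 -mulrBr normrM [X in _ * X]ger0_norm//; lra.
move=> /le_trans; apply; rewrite JpM -Jp_mulr//.
by rewrite le_eqVlt; apply/orP; left; apply/eqP; ring.
Qed.

Lemma Jp_coercive_dual p d : 1 < p -> 0 < d -> exists2 C, 0 <= C &
  forall x y, `|Jp p x - Jp p y| `^ (p / (p - 1)) <=
    d * (`|x| `^ p + `|y| `^ p) + C * ((Jp p x - Jp p y) * (x - y)).
Proof.
move=> p1 d0; have [C C0 HC] := Jp_coercive (conj_exp p1) d0; exists C => // x y.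
by have := HC (Jp p x) (Jp p y); rewrite !Jp_conjK// !norm_Jp_conj// [in leRHS](mulrC (x - y)).
Qed.

Lemma young p e : 1 < p -> 0 < e -> exists2 C, 0 <= C &
  forall x y, `|x * y| <= e * `|y| `^ p + C * `|x| `^ (p / (p - 1)).
Proof.
move=> p1 e0; set q := p / (p - 1).
have p0 : 0 < p by lra.
have q0 : 0 < q by have := conj_exp p1; rewrite -/q; lra.
(* [c] solves c^p / p = e, so that Young's inequality for [c * y] and [x / c] has coefficient [e] in
   front of the p-th power of y. *)
pose c := (e * p) `^ p^-1.
have c0 : 0 < c by rewrite powR_gt0// mulr_gt0.
exists (c^-1 `^ q / q) => [|x y]; first by rewrite divr_ge0 ?powR_ge0// ltW.
have -> : x * y = (c * y) * (x / c) by field; exact: lt0r_neq0.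
rewrite normrM; have := @conjugate_powR R `|c * y| `|x / c| p q.
move=> /(_ (normr_ge0 _) (normr_ge0 _) p0 q0 (conj_exp_inv p1)).
move=> /le_trans; apply; rewrite !normrM normfV (gtr0_norm c0) !powRM ?invr_ge0//; last 2 first.
  exact: ltW.
  exact: ltW.
rewrite {1}/c -powRrM mulVf ?powRr1; last 2 first.
  by rewrite ltW// mulr_gt0.
  exact: lt0r_neq0.
rewrite lerD//; last by rewrite -mulrA mulrC.
by rewrite mulrAC mulfK// lt0r_neq0.
Qed.

Lemma powR_normD p x y : 0 < p ->
  `|x + y| `^ p <= 2 `^ p * (`|x| `^ p + `|y| `^ p).
Proof.
move=> p0.
suff main (u v : R) : `|u| <= `|v| -> `|u + v| `^ p <= 2 `^ p * `|v| `^ p.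
  have [xy|/ltW yx] := leP `|x| `|y|.
    apply: (le_trans (main _ _ xy)).
    by rewrite ler_wpM2l ?powR_ge0// lerDr powR_ge0.
  rewrite addrC; apply: (le_trans (main _ _ yx)).
  by rewrite ler_wpM2l ?powR_ge0// lerDl powR_ge0.
move=> uv; rewrite -powRM//; apply: ge0_ler_powR; rewrite ?nnegrE ?mulr_ge0//.
  exact: ltW.
by rewrite (le_trans (ler_normD _ _))// mulrDl mul1r lerD2r.
Qed.

End power_nonlinearity.

(** * Integrable real functions *)

Section real_integral.
Context d (T : measurableType d) (R : realType).
Variable mu : {measure set T -> \bar R}.
Implicit Types f g : T -> R.

Local Notation "'L1 f" := (mu.-integrable [set: T] (EFin \o f)) (at level 10, f at next level).

Lemma L1_measurable f : 'L1 f -> measurable_fun setT f.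
Proof. by move=> /(measurable_int mu)/measurable_EFinP. Qed.

Lemma le_L1 f g : measurable_fun setT f -> (forall x, `|f x| <= g x) ->
  'L1 g -> 'L1 f.
Proof.
move=> mf fg; apply: le_integrable => //; first exact/measurable_EFinP.
by move=> x _ /=; rewrite lee_fin (le_trans (fg x))// ler_norm.
Qed.

Lemma L1D f g : 'L1 f -> 'L1 g -> 'L1 (fun x => f x + g x).
Proof.
by move=> lf lg; rewrite (_ : EFin \o _ = (EFin \o f) \+ (EFin \o g))%E//; exact: integrableD.
Qed.

Lemma L1B f g : 'L1 f -> 'L1 g -> 'L1 (fun x => f x - g x).
Proof.
by move=> lf lg; rewrite (_ : EFin \o _ = (EFin \o f) \- (EFin \o g))%E//; exact: integrableB.
Qed.

Lemma L1Z c f : 'L1 f -> 'L1 (fun x => c * f x).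
Proof.
by move=> lf; rewrite (_ : EFin \o _ = (fun x => c%:E * (EFin \o f) x))%E//; exact: integrableZl.
Qed.

Lemma L1_norm f : 'L1 f -> 'L1 (fun x => `|f x|).
Proof.
move=> lf; apply: (le_integrable measurableT _ _ lf).
  by apply/measurable_EFinP/measurableT_comp => //; exact: L1_measurable.
by move=> x _ /=; rewrite lee_fin normr_id.
Qed.

Lemma L1_0 : 'L1 (fun=> 0).
Proof. exact: integrable0. Qed.

Lemma Rintegral0 : \int[mu]_x (0 : R) = 0.
Proof. by rewrite /Rintegral integral0. Qed.

Lemma L1M_bounded f g M : 'L1 f -> measurable_fun setT g ->
  (forall x, `|g x| <= M) -> 'L1 (fun x => g x * f x).
Proof.
move=> lf mg gM; apply: (@le_L1 _ (fun x => M * `|f x|)).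
- by apply: measurable_funM => //; exact: L1_measurable.
- by move=> x; rewrite normrM ler_wpM2r.
- exact/L1Z/L1_norm.
Qed.

Lemma L1_indic A : measurable A -> (mu A < +oo)%E -> 'L1 (\1_A : T -> R).
Proof.
move=> mA Aoo; apply/integrableP; split; first exact/measurable_EFinP.
rewrite (eq_integral (fun x => (\1_A x)%:E)); last first.
  by move=> t _; rewrite gee0_abs// lee_fin.
by rewrite integral_indic// setIT.
Qed.

Lemma L1_fin_norm f : measurable_fun setT f ->
  (\int[mu]_x `|f x|%:E < +oo)%E -> 'L1 f.
Proof. by move=> mf foo; apply/integrableP; split => //; exact/measurable_EFinP. Qed.

Lemma Rintegral_EFin f : 'L1 f -> (\int[mu]_x f x)%:E = (\int[mu]_x (f x)%:E)%E.
Proof. by move=> lf; rewrite /Rintegral fineK//; exact: integrable_fin_num. Qed.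

Lemma L1_dct (f_ : nat -> T -> R) f g :
  (forall n, measurable_fun setT (f_ n)) ->
  (forall n x, `|f_ n x| <= g x) -> (forall x, f_ ^~ x @ \oo --> f x) ->
  'L1 g -> [/\ 'L1 f, \int[mu]_x f_ n x @[n --> \oo] --> \int[mu]_x f x
     & \int[mu]_x `|f x - f_ n x| @[n --> \oo] --> 0].
Proof.
move=> mf_ f_g f_f lg.
have mf : measurable_fun setT f by apply: measurable_fun_cvg => [n|x _]; [exact: mf_|exact: f_f].
have [] := @dominated_convergence _ _ _ mu _ measurableT
  (fun n => EFin \o f_ n) (EFin \o f) (EFin \o g).
- by move=> n; exact/measurable_EFinP.
- exact/measurable_EFinP.
- by apply: aeW => x _; apply: cvg_EFin; [exact: nearW|exact: f_f].
- exact: lg.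
- by apply: aeW => x n _; rewrite lee_fin.
move=> lf c1 c2; split => //.
  by apply: fine_cvg; rewrite Rintegral_EFin//; exact: c2.
apply: fine_cvg => /=; apply: cvg_trans c1; apply: near_eq_cvg; apply: nearW => n.
by apply: eq_integral => x _; rewrite /= distrC.
Qed.

Lemma Rintegral_le f g : 'L1 f -> 'L1 g -> (forall x, f x <= g x) ->
  \int[mu]_x f x <= \int[mu]_x g x.
Proof. by move=> lf lg fg; apply: le_Rintegral. Qed.

Lemma Rintegral_norm_le f g : 'L1 f -> 'L1 g -> (forall x, `|f x| <= g x) ->
  `|\int[mu]_x f x| <= \int[mu]_x g x.
Proof.
move=> lf lg fg; apply: (le_trans (le_normr_Rintegral _ lf)) => //.
exact: Rintegral_le (L1_norm lf) lg fg.
Qed.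

Lemma Rintegral_ae f g : 'L1 f -> 'L1 g -> {ae mu, forall x, f x = g x} ->
  \int[mu]_x f x = \int[mu]_x g x.
Proof.
move=> /(measurable_int mu) mf /(measurable_int mu) mg fg; congr fine.
by apply: ae_eq_integral => //; apply: filterS fg => x /= ->.
Qed.

Lemma le_L1_ae f g : measurable_fun setT f -> {ae mu, forall x, `|f x| <= g x} ->
  'L1 g -> 'L1 f.
Proof.
move=> mf fg lg; apply: L1_fin_norm => //.
have := integrableP _ _ _ (L1_norm lg) => -[_]; apply: le_lt_trans.
apply: ae_ge0_le_integral => //.
- by apply/measurable_EFinP/measurableT_comp.
- by apply/measurableT_comp => //; apply/measurable_EFinP; exact: (L1_measurable (L1_norm lg)).
- by apply: filterS fg => x fgx _ /=; rewrite lee_fin normr_id (le_trans fgx)// ler_norm.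
Qed.

Lemma Rintegral_le_ae f g : 'L1 f -> 'L1 g -> {ae mu, forall x, f x <= g x} ->
  \int[mu]_x f x <= \int[mu]_x g x.
Proof.
move=> lf lg fg; rewrite -subr_ge0 -RintegralB//.
rewrite (@Rintegral_ae _ (fun x => `|g x - f x|)); first exact: Rintegral_ge0.
- exact: L1B.
- exact/L1_norm/L1B.
- by apply: filterS fg => x fgx; rewrite ger0_norm// subr_ge0.
Qed.

Lemma Rintegral_norm_le_ae f g : 'L1 f -> 'L1 g -> {ae mu, forall x, `|f x| <= g x} ->
  `|\int[mu]_x f x| <= \int[mu]_x g x.
Proof.
move=> lf lg fg; apply: (le_trans (le_normr_Rintegral _ lf)) => //.
exact: Rintegral_le_ae (L1_norm lf) lg fg.
Qed.

Lemma Rintegral_eq0_ae f : 'L1 f -> (forall x, 0 <= f x) ->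
  \int[mu]_x f x = 0 -> {ae mu, forall x, f x = 0}.
Proof.
move=> lf f0 if0; have i0 : (\int[mu]_x (f x)%:E = 0)%E.
  by rewrite -Rintegral_EFin// if0.
have [+ _] := @ae_eq_integral_abs _ _ _ mu _ measurableT (EFin \o f)
  (measurable_int mu lf).
rewrite (eq_integral (fun x => (f x)%:E)).
  by move=> /(_ i0); apply: filterS => x /(_ I) [].
by move=> x _ /=; rewrite ger0_norm.
Qed.

End real_integral.

(** * Density in L^1 of the span of the indicators of a pi-system *)

Section L1_density.
Import HBSimple.
Context d (T : measurableType d) (R : realType).
Variable mu : {measure set T -> \bar R}.
Variables (G : set (set T)) (g : nat -> set T).
Hypotheses (mG : measurable = <<s G >>) (GI : setI_closed G).
Hypotheses (Gg : forall k, G (g k)) (gnd : nondecreasing_seq g).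
Hypotheses (gT : \bigcup_k g k = setT) (Goo : forall A, G A -> (mu A < +oo)%E).

Local Notation "'L1 f" := (mu.-integrable [set: T] (EFin \o f)) (at level 10, f at next level).

Variable V : set (T -> R).
Hypothesis Vlin : forall (c : R) u v, V u -> V v -> V (fun x => c * u x + v x).
Hypothesis Vlim : forall (f_ : nat -> T -> R) f, (forall n, V (f_ n)) ->
  (forall n, 'L1 (f_ n)) -> 'L1 f ->
  \int[mu]_x `|f x - f_ n x| @[n --> \oo] --> 0 -> V f.
Hypothesis VG : forall A, G A -> V (\1_A : T -> R).

Let mg k : measurable (g k).
Proof. by rewrite mG; exact: sub_sigma_algebra. Qed.

Let Vext u v : V u -> u =1 v -> V v.
Proof. by move=> Vu /funext <-. Qed.

Let V0 : V (fun=> 0).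
Proof.
apply: (Vext (Vlin (-1) (VG (Gg 0%N)) (VG (Gg 0%N)))) => x.
by rewrite mulN1r addNr.
Qed.

Let VZ c u : V u -> V (fun x => c * u x).
Proof. by move=> Vu; apply: (Vext (Vlin c Vu V0)) => x; rewrite addr0. Qed.

Let Vsum (I : Type) (r : seq I) (F : I -> T -> R) :
  (forall i, V (F i)) -> V (fun x => \sum_(i <- r) F i x).
Proof.
move=> VF; elim: r => [|i r IH]; first by apply: (Vext V0) => x; rewrite big_nil.
by apply: (Vext (Vlin 1 (VF i) IH)) => x; rewrite big_cons mul1r.
Qed.

(** Intersecting with [g k] keeps all indicators integrable, as [Vlim] requires; the measurable sets
    whose trace on [g k] is good then form a lambda-system containing the pi-system. *)
Let V_indic k A : measurable A -> V (\1_(A `&` g k) : T -> R).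
Proof.
move=> mA; suff : measurable `<=` [set A | measurable A /\ V (\1_(A `&` g k) : T -> R)].
  by move=> /(_ _ mA) [].
rewrite {1}mG; apply: lambda_system_subset => //; last 1 first.
- move=> B GB; split; first by rewrite mG; exact: sub_sigma_algebra.
  by apply: VG; exact: GI.
split => //.
- by split => //; rewrite setTI; exact: VG.
- move=> B C CB [mB VB] [mC VC]; split; first exact: measurableD.
  apply: (Vext (Vlin (-1) VC VB)) => x; rewrite mulN1r !indicE (in_setI x C) (in_setI x (B `\` C)) (in_setI x B) in_setD.
  have [xC|xC] /= := boolP (x \in C); last by rewrite oppr0 add0r andbT.
  have -> : x \in B by rewrite inE; apply: CB; rewrite inE in xC.
  by rewrite addNr.
- move=> F ndF VF; have mF n : measurable (F n) by have [] := VF n.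
  have mU : measurable (\bigcup_n F n) by exact: bigcupT_measurable.
  split => //; apply: (Vlim (f_ := fun n => \1_(F n `&` g k))).
  + by move=> n; have [] := VF n.
  + move=> n; apply: L1_indic; first exact: measurableI.
    apply: (le_lt_trans _ (Goo (Gg k))); apply: le_measure => //; rewrite inE//.
    exact: measurableI.
  + apply: L1_indic; first exact: measurableI.
    apply: (le_lt_trans _ (Goo (Gg k))); apply: le_measure => //; rewrite inE//.
    exact: measurableI.
  + have [] // := @L1_dct _ _ _ mu (fun n => \1_(F n `&` g k))
      (\1_(\bigcup_n F n `&` g k)) (\1_(g k)).
    * by move=> n; apply: measurable_indic; exact: measurableI.
    * by move=> n x; rewrite !indicE in_setI ger0_norm// ler_nat; case: (_ \in _); case: (_ \in _).
    * move=> x; have [[n _ Fnx]|nx] := pselect ((\bigcup_n F n) x); last first.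
        apply: cvg_near_cst; apply: nearW => n; rewrite !indicE !in_setI.
        rewrite (memNset nx) memNset// => Fnx.
        by apply: nx; exists n.
      apply: cvg_near_cst; exists n => // m /= nm; rewrite !indicE !in_setI.
      have Fmx : F m x by have /subsetPset := ndF _ _ nm; exact.
      by rewrite (mem_set Fmx) (@mem_set _ (\bigcup_n F n) x)//; exists m.
    * by apply: L1_indic => //; exact: Goo.
Qed.

(** Dynkin's theorem inside each [g k] gives the indicators, linearity the simple functions, and two
    passages to the limit the rest. The lemma is used to extend weak-* convergence from rational
    boxes to all integrable functions, and to prove that translations are continuous in L^1. *)
Lemma L1_pi_system_dense f : 'L1 f -> V f.
Proof.
move=> lf; have mgk k : measurable_fun setT (\1_(g k) : T -> R) by exact: measurable_indic.
have gle k x : `|\1_(g k) x : R| <= 1.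
  by rewrite indicE ger0_norm// lern1; case: (_ \in _).
suff Vk k : V (fun x => \1_(g k) x * f x).
  have lk k : 'L1 (fun x => \1_(g k) x * f x) by exact: L1M_bounded (gle k).
  apply: (Vlim Vk lk lf).
  have [] // := @L1_dct _ _ _ mu (fun n x => \1_(g n) x * f x) f (fun x => `|f x|).
  - by move=> n; exact: L1_measurable (lk n).
  - by move=> n x; rewrite normrM -[leRHS]mul1r ler_wpM2r.
  - move=> x; have [k _ gkx] : (\bigcup_k g k) x by rewrite gT.
    apply: cvg_near_cst; exists k => // m /= km.
    rewrite indicE mem_set ?mul1r//.
    by move: (x) gkx; exact/subsetPset/gnd.
  - exact: L1_norm.
have [h [lh _ hf]] := approximation_sfun_integrable measurableT lf.
pose F n x : R := \1_(g k) x * h n x; have VF : forall n, V (F n).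
  move=> n; refine (@Vext (fun x => \sum_(y <- finmap.enum_fset (fset_set (range (h n))))
     y * \1_(h n @^-1` [set y] `&` g k) x) (F n) _ _).
    by apply: Vsum => y; apply/VZ/V_indic.
  move=> x; rewrite /F [in RHS](fimfunE (h n)) fsbig_finite//= mulr_sumr.
  by apply: eq_bigr => y _; rewrite indicI /=; ring.
apply: (Vlim VF).
- by move=> n; apply: L1M_bounded (gle k).
- by apply: L1M_bounded (gle k).
apply: (@squeeze_cvgr _ _ _ _ (cst 0) (fun n => \int[mu]_x `|f x - h n x|)).
- apply: nearW => n; rewrite Rintegral_ge0//=; apply: Rintegral_le.
  + by apply/L1_norm/L1B; apply: L1M_bounded (gle k).
  + exact/L1_norm/L1B.
  + by move=> x; rewrite -mulrBr normrM -[leRHS]mul1r ler_wpM2r.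
- exact: cvg_cst.
- exact: (fine_cvg hf).
Qed.

End L1_density.

(** * Representation of functionals and weak-* compactness *)

Section functional_representation.
Import HBNNSimple.
Context d (T : measurableType d) (R : realType).
Variable mu : {sigma_finite_measure set T -> \bar R}.

Local Notation "'L1 f" := (mu.-integrable [set: T] (EFin \o f)) (at level 10, f at next level).

Definition bounded_mfun : set (T -> R) :=
  [set f : T -> R | measurable_fun setT f /\ exists M, forall x, `|f x| <= M].

Lemma bounded_mfun_lin c f g : bounded_mfun f -> bounded_mfun g ->
  bounded_mfun (fun x => c * f x + g x).
Proof.
move=> [mf [M fM]] [mg [N gN]]; split.
  by apply: measurable_funD => //; exact: measurable_funM.
exists (`|c| * M + N) => x; rewrite (le_trans (ler_normD _ _))// lerD//.
by rewrite normrM ler_wpM2l.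
Qed.

Lemma bounded_mfun_indic A : measurable A -> bounded_mfun (\1_A : T -> R).
Proof.
move=> mA; split; first exact: measurable_indic.
by exists 1 => x; rewrite indicE ger0_norm// lern1; case: (_ \in _).
Qed.

Lemma bounded_mfun_cst c : bounded_mfun (fun=> c).
Proof. by split => //; exists `|c|. Qed.

Variables (F : (T -> R) -> R) (r : R) (kappa : T -> R).
Hypothesis r1 : 1 <= r.
Hypothesis Flin : forall c f g, bounded_mfun f -> bounded_mfun g ->
  F (fun x => c * f x + g x) = c * F f + F g.
Hypotheses (Lkappa : 'L1 kappa) (kappa0 : forall x, 0 <= kappa x).
Hypothesis Fbound : forall f, bounded_mfun f ->
  `|F f| `^ r <= \int[mu]_x (`|f x| `^ r * kappa x).

Let r0 : 0 < r. Proof. by rewrite (lt_le_trans _ r1). Qed.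

Let F0 : F (fun=> 0) = 0.
Proof.
transitivity (-1 * F (fun=> 0) + F (fun=> 0)); last by rewrite mulN1r addNr.
rewrite -(Flin (-1) (bounded_mfun_cst 0) (bounded_mfun_cst 0)).
by congr F; apply/funext => x; rewrite mulr0 addr0.
Qed.

Let FZ c f : bounded_mfun f -> F (fun x => c * f x) = c * F f.
Proof.
move=> bf; have := Flin c bf (bounded_mfun_cst 0); rewrite F0 addr0 => <-.
by congr F; apply/funext => x; rewrite addr0.
Qed.

Let FB f g : bounded_mfun f -> bounded_mfun g ->
  F (fun x => f x - g x) = F f - F g.
Proof.
move=> bf bg; have := Flin (-1) bg bf; rewrite mulN1r addrC => <-.
by congr F; apply/funext => x; rewrite mulN1r addrC.
Qed.

Let bounded_mfun_sum (I : Type) (s : seq I) (u : I -> T -> R) :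
  (forall i, bounded_mfun (u i)) -> bounded_mfun (fun x => \sum_(i <- s) u i x).
Proof.
move=> bu; elim: s => [|i s IH].
  by rewrite (_ : (fun _ => _) = fun=> 0); [exact: bounded_mfun_cst|apply/funext => x; rewrite big_nil].
have := bounded_mfun_lin 1 (bu i) IH; congr bounded_mfun.
by apply/funext => x; rewrite big_cons mul1r.
Qed.

Let F_sum (I : Type) (s : seq I) (u : I -> T -> R) :
  (forall i, bounded_mfun (u i)) ->
  F (fun x => \sum_(i <- s) u i x) = \sum_(i <- s) F (u i).
Proof.
move=> bu; elim: s => [|i s IH].
  by rewrite big_nil -F0; congr F; apply/funext => x; rewrite big_nil.
rewrite big_cons -IH -[X in X + _]mul1r -Flin//; last exact: bounded_mfun_sum.
by congr F; apply/funext => x; rewrite big_cons mul1r.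
Qed.

(** Since [kappa] is integrable, [Fbound] and dominated convergence make [F] continuous for bounded
    pointwise convergence. This provides both the sigma-additivity of the charge below and the
    passage from simple to bounded functions. *)
Let F_cvg (f_ : nat -> T -> R) f M : (forall n, measurable_fun setT (f_ n)) ->
  (forall n x, `|f_ n x| <= M) -> (forall x, f_ ^~ x @ \oo --> f x) ->
  F (f_ n) @[n --> \oo] --> F f.
Proof.
move=> mf_ f_M f_f.
have mf : measurable_fun setT f.
  by apply: measurable_fun_cvg => [n|x _]; [exact: mf_|exact: f_f].
have fM x : `|f x| <= M.
  by apply: (cvgr_to_le (cvg_norm (f_f x))); apply: nearW => n; exact: f_M.
have bf_ n : bounded_mfun (f_ n) by split => //; exists M.
have bf : bounded_mfun f by split => //; exists M.
have bfB n : bounded_mfun (fun x => f_ n x - f x).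
  have := bounded_mfun_lin (-1) bf (bf_ n); congr bounded_mfun.
  by apply/funext => x; rewrite mulN1r addrC.
have [| | | |_ + _] := @L1_dct _ _ _ mu (fun n x => `|f_ n x - f x| `^ r * kappa x) (fun=> 0)
  (fun x => (M + M) `^ r * kappa x).
- move=> n; apply: measurable_funM; last exact: L1_measurable Lkappa.
  apply: measurableT_comp (measurable_powR _) _.
  by apply: measurableT_comp => //; exact: measurable_funB.
- move=> n x; rewrite normrM [X in X * _]ger0_norm ?powR_ge0// [X in _ * X]ger0_norm//.
  rewrite ler_wpM2r//; have M0 : 0 <= M by rewrite (le_trans _ (fM x)).
  apply: ge0_ler_powR; rewrite ?nnegrE ?addr_ge0//; first exact: ltW.
  by rewrite (le_trans (ler_normB _ _))// lerD.
- move=> x; rewrite -[X in _ --> X](mul0r (kappa x)); apply: cvgMr_tmp.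
  apply/cvgrPdist_lt => e e0.
  have e'0 : 0 < e `^ r^-1 by exact: powR_gt0.
  have /cvgrPdist_lt /(_ _ e'0) := f_f x; apply: filterS => n fn.
  rewrite sub0r normrN ger0_norm ?powR_ge0// distrC.
  have -> : e = (e `^ r^-1) `^ r by rewrite -powRrM mulVf ?gt_eqF// powRr1// ltW.
  by apply: gt0_ltr_powR; rewrite ?nnegrE//; exact: ltW.
- exact: L1Z.
rewrite Rintegral0 => i0; apply/cvgrPdist_lt => e e0.
have e'0 : 0 < e `^ r by exact: powR_gt0.
have /cvgrPdist_lt /(_ _ e'0) := i0; apply: filterS => n.
rewrite sub0r normrN => /(le_lt_trans (ler_norm _)) /(le_lt_trans (Fbound (bfB n))).
rewrite FB// distrC => h; rewrite ltNge; apply/negP => eF.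
move: h; rewrite ltNge => /negP; apply.
by apply: ge0_ler_powR; rewrite ?nnegrE//; exact: ltW.
Qed.

Definition functional_charge (A : set T) : \bar R := (F (\1_A))%:E.

Let nu0 : functional_charge set0 = 0%E.
Proof. by rewrite /functional_charge indic0 F0. Qed.

Let nufin A : measurable A -> functional_charge A \is a fin_num.
Proof. by []. Qed.

Let nusigma : semi_sigma_additive functional_charge.
Proof.
move=> D mD tD mUD; rewrite /functional_charge.
under eq_fun do rewrite sumEFin.
apply: cvg_EFin; first exact: nearW; rewrite /comp /=.
rewrite (_ : (fun n => _) = (fun n => F (fun x => \sum_(0 <= i < n) \1_(D i) x))); last first.
  by apply/funext => n; rewrite F_sum// => i; exact: bounded_mfun_indic.
apply: (@F_cvg _ _ 1).
- by move=> n; apply: measurable_sum => i; exact: measurable_indic.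
- move=> n x; rewrite ger0_norm; last by apply: sumr_ge0.
  have [[k /= kn Dkx]|nD] := pselect (exists2 k, (k < n)%N & D k x); last first.
    rewrite big_nat big1// => i /andP[_ iin]; rewrite indicE memNset// => Dix.
    by apply: nD; exists i.
  rewrite big_mkord (bigD1 (Ordinal kn))//= big1 ?addr0.
    by rewrite indicE lern1; case: (_ \in _).
  move=> i ik; rewrite indicE memNset// => Dix.
  move/trivIsetP: tD => /(_ i k I I) ; rewrite -(inj_eq val_inj)/= in ik.
  by move=> /(_ ik); apply/eqP/set0P; exists x.
- move=> x; have [[k _ Dkx]|nD] := pselect ((\bigcup_n D n) x); last first.
    rewrite indicE memNset//; apply: cvg_near_cst; apply: nearW => n.
    rewrite big1// => i _; rewrite indicE memNset// => Dix.
    by apply: nD; exists i.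
  rewrite indicE mem_set; last by exists k.
  apply: cvg_near_cst; exists k.+1 => // n /= kn.
  rewrite big_mkord (bigD1 (Ordinal kn))//= big1 ?addr0.
    by rewrite indicE mem_set.
  move=> i ik; rewrite indicE memNset// => Dix.
  move/trivIsetP: tD => /(_ i k I I) ; rewrite -(inj_eq val_inj)/= in ik.
  by move=> /(_ ik); apply/eqP/set0P; exists x.
Qed.

HB.instance Definition _ := isCharge.Build _ _ _ functional_charge nu0 nufin nusigma.

Let dom : functional_charge `<< mu.
Proof.
apply/null_content_dominatesP => A mA A0.
rewrite /functional_charge; congr EFin.
have : `|F \1_A| `^ r <= 0.
  rewrite (le_trans (Fbound (bounded_mfun_indic mA)))//.
  rewrite (@Rintegral_ae _ _ _ _ _ (fun=> 0)) ?Rintegral0//; [|exact: L1_0|].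
    apply: (@L1M_bounded _ _ _ _ _ _ 1) => //.
      apply: measurableT_comp (measurable_powR _) _.
      by apply: measurableT_comp => //; exact: measurable_indic.
    move=> x; rewrite indicE; case: (_ \in _).
      by rewrite normr1 powR1 normr1.
    by rewrite normr0 powR0 ?lt0r_neq0// normr0.
  exists A; split => // x /= /eqP; apply: contraNP => nA.
  by rewrite indicE memNset//= normr0 powR0 ?lt0r_neq0// mul0r.
move=> h; apply/eqP; rewrite -normr_le0 leNgt; apply/negP => /(powR_gt0 r).
by rewrite ltNge h.
Qed.

(** The map sending [A] to [F (\1_A)] is a charge dominated by [mu], and [h] is its Radon-Nikodym
    derivative. The exponent [r] is left free because the lemma serves twice: with r = 1 for the
    weak-* limit of the coefficients, and with r = p' for functionals acting on fluxes. *)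
Lemma functional_representation : exists2 h, 'L1 h &
  forall f, bounded_mfun f -> F f = \int[mu]_x (f x * h x).
Proof.
pose h := fine \o Radon_Nikodym functional_charge mu.
have hE : EFin \o h = Radon_Nikodym functional_charge mu.
  by apply/funext => x; rewrite /h/= fineK// Radon_Nikodym_fin_num.
have Lh : 'L1 h by rewrite hE; exact: Radon_Nikodym_integrable.
exists h => //.
have Fi A : measurable A -> F \1_A = \int[mu]_x (\1_A x * h x).
  move=> mA; apply: EFin_inj; rewrite -[LHS]/(functional_charge A).
  rewrite (Radon_Nikodym_integral dom mA) Rintegral_EFin; last first.
    have [mi [M iM]] := bounded_mfun_indic mA.
    exact: L1M_bounded Lh mi iM.
  rewrite [LHS]integral_mkcond. apply: eq_integral => x _.
  by rewrite patchE -hE /= indicE; case: ifPn => _; rewrite ?mul1r ?mul0r.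
have Fs (g : {nnsfun T >-> R}) : F g = \int[mu]_x (g x * h x).
  have bi y : bounded_mfun (\1_(g @^-1` [set y]) : T -> R) by exact: bounded_mfun_indic.
  pose s := finmap.enum_fset (fset_set (range g)).
  have gE : (g : T -> R) = fun x => \sum_(y <- s) y * \1_(g @^-1` [set y]) x.
    by apply/funext => x; rewrite [LHS](fimfunE g) fsbig_finite.
  rewrite {1}gE F_sum; last first.
    move=> y; have := bounded_mfun_lin y (bi y) (bounded_mfun_cst 0).
    by congr bounded_mfun; apply/funext => x; rewrite addr0.
  rewrite (@eq_Rintegral _ _ _ _ _ (fun x => \sum_(y <- s) y * (\1_(g @^-1` [set y]) x * h x))); last first.
    by move=> x _; rewrite {1}gE mulr_suml; apply: eq_bigr => y _; rewrite mulrA.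
  have Li y : 'L1 (fun x => \1_(g @^-1` [set y]) x * h x).
    by have [mi [M iM]] := bi y; exact: L1M_bounded Lh mi iM.
  elim: s {gE} => [|y s IH].
    rewrite big_nil; under eq_Rintegral do rewrite big_nil.
    by rewrite Rintegral0.
  rewrite big_cons {}IH; under [in RHS]eq_Rintegral do rewrite big_cons.
  have Ls : 'L1 (fun x => \sum_(j <- s) j * (\1_(g @^-1` [set j]) x * h x)).
    elim: s => [|z s IH].
      by under eq_fun do rewrite big_nil; exact: L1_0.
    by under eq_fun do rewrite big_cons; apply: L1D => //; exact: L1Z.
  by rewrite RintegralD//; [rewrite RintegralZl// FZ// Fi|exact: L1Z].
have Fpos f : bounded_mfun f -> (forall x, 0 <= f x) -> F f = \int[mu]_x (f x * h x).
  move=> [mf [M fM]] f0.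
  have mEf : measurable_fun setT (EFin \o f) by exact/measurable_EFinP.
  pose g := nnsfun_approx measurableT mEf.
  have gf n x : g n x <= f x.
    rewrite /g nnsfun_approxE -lee_fin.
    by apply: (@le_approx _ _ _ setT (EFin \o f)) => // y _; rewrite lee_fin.
  have g0 n x : 0 <= g n x by [].
  have gM n x : `|g n x| <= M by rewrite ger0_norm// (le_trans (gf _ _))// (le_trans (ler_norm _)).
  have gcvg x : g ^~ x @ \oo --> f x.
    have f0' y : setT y -> (0 <= (EFin \o f) y)%E by rewrite lee_fin.
    exact: (fine_cvg (@cvg_nnsfun_approx _ _ _ setT measurableT (EFin \o f) mEf f0' x I)).
  have c1 := F_cvg (fun n => measurable_funP (g n)) gM gcvg.
  have [| | | |_ c2 _] := @L1_dct _ _ _ mu (fun n x => g n x * h x) (fun x => f x * h x)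
     (fun x => M * `|h x|).
  - by move=> n; apply: measurable_funM => //; exact: L1_measurable Lh.
  - by move=> n x; rewrite normrM ler_wpM2r.
  - by move=> x; apply: cvgMr_tmp; exact: gcvg.
  - exact/L1Z/L1_norm.
  rewrite (_ : (fun n => F (g n)) = (fun n => \int[mu]_x (g n x * h x))) in c1.
    exact: (cvg_unique _ c1 c2).
  by apply/funext => n; exact: Fs.
move=> f [mf [M fM]].
have bf : bounded_mfun f by split => //; exists M.
have bM := bounded_mfun_cst M.
(* Adding the bound [M] reduces to the nonnegative case; the sum is written as a difference so that
   [FB] applies. *)
have bfM : bounded_mfun (fun x => f x - - M).
  have := bounded_mfun_lin 1 bf bM; congr bounded_mfun.
  by apply/funext => x; rewrite mul1r opprK.
have := Fpos _ bfM; rewrite FB//; last exact: bounded_mfun_cst.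
move=> /(_ _)/wrap[x|].
  by rewrite opprK -lerBlDr sub0r; have := fM x; rewrite ler_norml => /andP[].
have -> : F (fun=> - M) = \int[mu]_x (- M * h x).
  have F1 : F (fun=> 1) = \int[mu]_x h x.
    rewrite (Fpos _ (bounded_mfun_cst 1))//.
    by apply: eq_Rintegral => x _; rewrite mul1r.
  rewrite RintegralZl// -F1 -FZ; last exact: bounded_mfun_cst.
  by congr F; apply/funext => x; rewrite mulr1.
move=> /eqP; rewrite subr_eq => /eqP ->; rewrite -RintegralD.
- by apply: eq_Rintegral => x _; rewrite -mulrDl subrK.
- by [].
- by have [m [N fN]] := bfM; exact: L1M_bounded Lh m fN.
- exact: L1Z.
Qed.

End functional_representation.

(** Multiplication by such a weight maps bounded functions into L^1, and every integrable function
    is a limit of images of bounded ones. This links functionals on L^1 to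
    [functional_representation]. *)
Lemma sigma_finite_L1_gt0 d (T : measurableType d) (R : realType)
    (mu : {sigma_finite_measure set T -> \bar R}) :
  exists w : T -> R, mu.-integrable setT (EFin \o w) /\ forall x, 0 < w x.
Proof.
have /sigma_finiteP[F [TF ndF Foo]] := sigma_finiteT mu.
have mF k : measurable (F k) by have [] := Foo k.
have fF k : mu (F k) \is a fin_num by rewrite ge0_fin_numE//; have [] := Foo k.
(* The denominator exceeds both the measure of [F k] and the value 1 of its indicator. The weighted
   sum is thus at most 1 in integral and also pointwise, hence finite everywhere. *)
pose c k : R := (1 / (2 ^ k.+1)%:R) / (1 + fine (mu (F k))).
have c0 k : 0 < c k by rewrite !divr_gt0// ?ltr0n ?expn_gt0// ltr_wpDr// fine_ge0.
pose u k x : \bar R := (c k * \1_(F k) x)%:E.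
have u0 k x : (0 <= u k x)%E by rewrite lee_fin mulr_ge0// ltW.
have mu_ k : measurable_fun setT (u k).
  by apply/measurable_EFinP; apply: measurable_funM => //; exact: measurable_indic.
pose W x : \bar R := (\sum_(k <oo) u k x)%E.
have iW : (\int[mu]_x W x <= 1)%E.
  rewrite integral_nneseries//.
  apply: le_trans (@epsilon_trick0 R 1 xpredT ler01).
  apply: lee_nneseries => [k _ _|k _]; first by apply: integral_ge0 => x _.
  rewrite /u; under eq_integral do rewrite EFinM.
  rewrite ge0_integralZl//; last by rewrite lee_fin ltW.
  - rewrite integral_indic// setIT.
    apply: (@le_trans _ _ ((c k)%:E * (fine (mu (F k)))%:E)%E); first by rewrite fineK.
    rewrite -EFinM lee_fin /c.
    have d1 : 0 < 1 + fine (mu (F k)) by rewrite ltr_wpDr// fine_ge0.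
    by rewrite mulrAC ler_pdivrMr// ler_wpM2l// lerDr.
  - by apply/measurable_EFinP; exact: measurable_indic.
have W1 x : (W x <= 1)%E.
  apply: le_trans (@epsilon_trick0 R 1 xpredT ler01).
  apply: lee_nneseries => [k _ _|k _]; first exact: u0.
  rewrite lee_fin /c.
  have d1 : 0 < 1 + fine (mu (F k)) by rewrite ltr_wpDr// fine_ge0.
  rewrite mulrAC ler_pdivrMr// ler_wpM2l// indicE.
  by case: (_ \in _); rewrite ?lerDl ?fine_ge0// ltW.
have W0 x : (0 <= W x)%E by apply: nneseries_ge0.
have Wfin x : W x \is a fin_num by rewrite ge0_fin_numE// (le_lt_trans (W1 x))// ltry.
have mW : measurable_fun setT W.
  apply: (@ge0_emeasurable_sum _ _ _ setT u xpredT) => //.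
exists (fine \o W); split.
  have -> : EFin \o (fine \o W) = W by apply/funext => x /=; rewrite fineK.
  apply/integrableP; split => //.
  under eq_integral do rewrite gee0_abs//.
  by rewrite (le_lt_trans iW)// ltry.
move=> x; rewrite fine_gt0//= (le_lt_trans (W1 x)) ?ltry// andbT.
have [k _ Fkx] : (\bigcup_k F k) x by rewrite -TF.
apply: (@lt_le_trans _ _ (u k x)).
  by rewrite lte_fin indicE mem_set// mulr1.
apply: le_trans (@nneseries_lim_ge R (u ^~ x) xpredT 0%N k.+1 _) => [|n _ _]; last exact: u0.
by rewrite big_nat_recr//= leeDr// sume_ge0.
Qed.

(** By compactness the image ultrafilter clusters at some point of the segment, and an ultrafilter
    converges to each of its cluster points. *)
Lemma ultra_bounded_cvg (R : realType) (U : set_system nat) (x : nat -> R) M :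
  UltraFilter U -> (forall k, `|x k| <= M) -> cvg (x k @[k --> U]).
Proof.
move=> UU xM; have UP := @ultra_proper _ _ UU.
have /(_ (x @ U) _) [|l [_ xl]] := @segment_compact R (- M) M.
  rewrite /fmap /=; apply: filterS (@filterT _ U _) => k _ /=.
  by rewrite in_itv/= -ler_norml.
apply/cvg_ex; exists l => B lB.
have [//|UnB] := @in_ultra_setVsetC _ U (x @^-1` B) UU.
by have [z [/(_ _)]] := xl (~` B) B UnB lB.
Qed.

Section weak_star_compactness.
Context d (T : measurableType d) (R : realType).
Variable mu : {sigma_finite_measure set T -> \bar R}.
Variables (G : nat -> set T) (g : nat -> set T).
Hypotheses (mG : measurable = <<s range G >>) (GI : setI_closed (range G)).
Hypotheses (Gg : forall k, range G (g k)) (gnd : nondecreasing_seq g).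
Hypotheses (gT : \bigcup_k g k = setT) (Goo : forall i, (mu (G i) < +oo)%E).

Local Notation "'L1 f" := (mu.-integrable [set: T] (EFin \o f)) (at level 10, f at next level).

Variables (lam Lam : R) (a_ : nat -> T -> R).
Hypotheses (lam0 : 0 <= lam) (lamLam : lam <= Lam).
Hypothesis ma_ : forall k, measurable_fun setT (a_ k).
Hypothesis a_b : forall k x, lam <= a_ k x <= Lam.

Let Lam0 : 0 <= Lam. Proof. exact: le_trans lamLam. Qed.

Let a_norm k x : `|a_ k x| <= Lam.
Proof. by have /andP[h1 h2] := a_b k x; rewrite ger0_norm// (le_trans lam0). Qed.

Let La h k : 'L1 h -> 'L1 (fun x => a_ k x * h x).
Proof. by move=> lh; exact: L1M_bounded lh (ma_ k) (a_norm k). Qed.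

(** Along an ultrafilter the integrals of [a_ k] against all integrable functions converge at once,
    and their limit is a functional [F] on L^1. Composed with the weight [w] it acts on bounded
    functions, where it has a density [h]; the limit coefficient is h / w. *)
Let limit_density (U : set_system nat) : UltraFilter U ->
  exists a : T -> R, [/\ measurable_fun setT a, forall x, lam <= a x <= Lam &
    forall h, 'L1 h ->
      \int[mu]_x (a_ k x * h x) @[k --> U] --> \int[mu]_x (a x * h x)].
Proof.
move=> UU; have UP := @ultra_proper _ _ UU.
pose F h := lim (\int[mu]_x (a_ k x * h x) @[k --> U]).
have Fc h : 'L1 h -> \int[mu]_x (a_ k x * h x) @[k --> U] --> F h.
  move=> lh; apply: (@ultra_bounded_cvg _ _ _ (\int[mu]_x (Lam * `|h x|))) => // k.
  apply: Rintegral_norm_le; [exact: La|exact/L1Z/L1_norm|].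
  by move=> x; rewrite normrM ler_wpM2r.
have Flin c u v : 'L1 u -> 'L1 v -> F (fun x => c * u x + v x) = c * F u + F v.
  move=> lu lv; apply: (cvg_unique _ (Fc _ (L1D (L1Z c lu) lv))) => //.
  rewrite (_ : (fun k => _) = (fun k => c * (\int[mu]_x (a_ k x * u x)) +
      \int[mu]_x (a_ k x * v x))); last first.
    apply/funext => k; rewrite -RintegralZl//; last exact: La.
    rewrite -RintegralD//; [|exact/L1Z/La|exact: La].
    by apply: eq_Rintegral => x _; rewrite mulrDr mulrCA.
  by apply: cvgD; [apply: cvgM; [exact: cvg_cst|exact: Fc]|exact: Fc].
have Fle h : 'L1 h -> (forall x, 0 <= h x) -> F h <= Lam * \int[mu]_x h x.
  move=> lh h0; apply: (cvgr_to_le (Fc _ lh)); apply: nearW => k.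
  rewrite -RintegralZl//; apply: Rintegral_le; [exact: La|exact: L1Z|move=> x].
  by rewrite ler_wpM2r//; have /andP[] := a_b k x.
have Fge h : 'L1 h -> (forall x, 0 <= h x) -> lam * \int[mu]_x h x <= F h.
  move=> lh h0; apply: (cvgr_to_ge (Fc _ lh)); apply: nearW => k.
  rewrite -RintegralZl//; apply: Rintegral_le; [exact: L1Z|exact: La|move=> x].
  by rewrite ler_wpM2r//; have /andP[] := a_b k x.
have Fnorm h : 'L1 h -> `|F h| <= \int[mu]_x (`|h x| * Lam).
  move=> lh; apply: (cvgr_to_le (cvg_norm (Fc _ lh))); apply: nearW => k.
  apply: Rintegral_norm_le; [exact: La| |].
    by under eq_fun do rewrite mulrC; exact/L1Z/L1_norm.
  by move=> x; rewrite normrM mulrC ler_wpM2l.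
have [w [lw w0]] := sigma_finite_L1_gt0 mu.
have Lwf f : bounded_mfun f -> 'L1 (fun x => w x * f x).
  by move=> [mf [M fM]]; under eq_fun do rewrite mulrC; exact: L1M_bounded lw mf fM.
have [||||h lh Fh] := @functional_representation _ _ _ mu
    (fun f => F (fun x => w x * f x)) 1 (fun x => Lam * w x) (lexx 1).
- move=> c u v bu bv; rewrite -Flin; [|exact: Lwf|exact: Lwf].
  by congr F; apply/funext => x; rewrite mulrDr mulrCA.
- exact: L1Z.
- by move=> x; rewrite mulr_ge0// ltW.
- move=> f bf; rewrite powRr1// (le_trans (Fnorm _ (Lwf _ bf)))//.
  rewrite le_eqVlt; apply/orP; left; apply/eqP; apply: eq_Rintegral => x _.
  by rewrite powRr1// normrM (gtr0_norm (w0 x)); ring.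
have mw : measurable_fun setT w := L1_measurable lw.
have mh : measurable_fun setT h := L1_measurable lh.
have ae_le u v : 'L1 u -> 'L1 v ->
    (forall A, measurable A -> \int[mu]_x (\1_A x * u x) <= \int[mu]_x (\1_A x * v x)) ->
    {ae mu, forall x, u x <= v x}.
  move=> lu lv uv; pose A := [set x | v x < u x].
  have mA : measurable A.
    have := measurable_fun_ltr (L1_measurable lv) (L1_measurable lu).
    by move=> /(_ measurableT [set true] I); rewrite setTI; congr measurable; apply/seteqP; split => x.
  have L1A f : 'L1 f -> 'L1 (fun x => \1_A x * f x).
    by move=> lf; have [mi [M iM]] := @bounded_mfun_indic _ _ R _ mA; exact: L1M_bounded lf mi iM.
  have p0 x : 0 <= \1_A x * (u x - v x).
    rewrite indicE; have [|] := boolP (x \in A); last by rewrite mul0r.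
    by rewrite inE /A/= mul1r subr_ge0 => /ltW.
  have := @Rintegral_eq0_ae _ _ _ mu _ (L1A _ (L1B lu lv)) p0.
  move=> /(_ _)/wrap[|].
    apply/eqP; rewrite eq_le Rintegral_ge0// andbT.
    rewrite (@eq_Rintegral _ _ _ _ _ (fun x => \1_A x * u x - \1_A x * v x)).
      rewrite RintegralB//; [|exact: L1A|exact: L1A].
      by rewrite subr_le0 uv.
    by move=> x _; rewrite mulrBr.
  apply: filterS => x; rewrite indicE; have [|] := boolP (x \in A).
    by rewrite mul1r => _ /eqP; rewrite subr_eq0 => /eqP ->.
  by rewrite notin_setE /A /= => /negP; rewrite -leNgt.
have h_ge : {ae mu, forall x, lam * w x <= h x}.
  apply: ae_le => //; first exact: L1Z.
  move=> A mA; have bA := @bounded_mfun_indic _ _ R _ mA.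
  rewrite -Fh//; under eq_Rintegral do rewrite mulrCA [\1_A _ * _]mulrC.
  rewrite RintegralZl//; last exact: Lwf.
  by apply: Fge => [|x]; [exact: Lwf|rewrite mulr_ge0// ltW].
have h_le : {ae mu, forall x, h x <= Lam * w x}.
  apply: ae_le => //; first exact: L1Z.
  move=> A mA; have bA := @bounded_mfun_indic _ _ R _ mA.
  rewrite -Fh//; under [leRHS]eq_Rintegral do rewrite mulrCA [\1_A _ * _]mulrC.
  rewrite RintegralZl//; last exact: Lwf.
  by apply: Fle => [|x]; [exact: Lwf|rewrite mulr_ge0// ltW].
(* By [h_ge] and [h_le] the truncation alters h / w on a null set only; it makes the bounds hold at
   every point. *)
pose a x := Num.max lam (Num.min Lam (h x / w x)).
have ma : measurable_fun setT a.
  apply: measurable_maxr => //; apply: measurable_minr => //.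
  apply: measurable_funM => //.
  rewrite (_ : (fun x => _) = (fun x => w x `^ (-1))); last first.
    by apply/funext => x; rewrite powR_inv1// ltW.
  exact: measurableT_comp (measurable_powR _) mw.
have ab x : lam <= a x <= Lam.
  rewrite /a le_max lexx /= ge_max lamLam /= ge_min lexx; done.
have aw : {ae mu, forall x, h x = a x * w x}.
  apply: filterS2 h_ge h_le => x h1 h2; rewrite /a.
  rewrite min_r; last by rewrite ler_pdivrMr.
  by rewrite max_r ?divfK ?gt_eqF// ler_pdivlMr.
exists a; split => // f lf; suff -> : \int[mu]_x (a x * f x) = F f by exact: Fc.
have anorm x : `|a x| <= Lam.
  by have /andP[h1 h2] := ab x; rewrite ger0_norm// (le_trans lam0).
(* On [A m] the quotient f / w is bounded by [m], so the cut function is [w] times a bounded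
   function, where [F] is represented. These sets exhaust the space because [w] is positive. *)
pose A m := [set x | `|f x| <= m%:R * w x].
have mf : measurable_fun setT f := L1_measurable lf.
have mw' : measurable_fun setT (fun x => (w x)^-1).
  rewrite (_ : (fun x => _) = (fun x => w x `^ (-1))); last first.
    by apply/funext => x; rewrite powR_inv1// ltW.
  exact: measurableT_comp (measurable_powR _) mw.
have mA m : measurable (A m).
  have mfn : measurable_fun setT (fun x => `|f x|) by exact: measurableT_comp.
  have mmw : measurable_fun setT (fun x => m%:R * w x) by exact: measurable_funM.
  have := measurable_fun_ler mfn mmw.
  by move=> /(_ measurableT [set true] I); rewrite setTI; congr measurable; apply/seteqP; split => x.
pose phi m x := \1_(A m) x * (f x / w x).
have bphi m : bounded_mfun (phi m).
  split; first by do 2?apply: measurable_funM => //; exact: measurable_indic.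
  exists m%:R => x; rewrite /phi indicE; have [|] := boolP (x \in A m).
    by rewrite inE mul1r normf_div (gtr0_norm (w0 x)) ler_pdivrMr.
  by rewrite mul0r normr0.
pose f_ m x := \1_(A m) x * f x.
have f_E m : f_ m = (fun x => w x * phi m x).
  by apply/funext => x; rewrite /f_ /phi mulrCA [w x * _]mulrC divfK// gt_eqF.
have Lf_ m : 'L1 (f_ m) by rewrite f_E; exact: Lwf.
have [||||_ _ f_f] := @L1_dct _ _ _ mu f_ f (fun x => `|f x|).
- by move=> m; exact: L1_measurable (Lf_ m).
- move=> m x; rewrite /f_ normrM indicE; case: (_ \in _).
    by rewrite normr1 mul1r.
  by rewrite normr0 mul0r.
- move=> x; have [m fm] : exists m : nat, `|f x| / w x <= m%:R.
    by exists (Num.bound (`|f x| / w x)); exact/ltW/archi_boundP/divr_ge0/ltW.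
  apply: cvg_near_cst; exists m => // m' /= mm'.
  rewrite /f_ indicE mem_set ?mul1r// /A /=.
  by rewrite -ler_pdivrMr// (le_trans fm)// ler_nat.
- exact: L1_norm.
have Laf u : 'L1 u -> 'L1 (fun x => a x * u x) by move=> lu; exact: L1M_bounded lu ma anorm.
have FE m : F (f_ m) = \int[mu]_x (a x * f_ m x).
  rewrite f_E Fh//; have [mphi [N phiN]] := bphi m.
  apply: Rintegral_ae.
  - exact: L1M_bounded lh mphi phiN.
  - by apply: Laf; exact: Lwf.
  - by apply: filterS aw => x ->; ring.
have F_cvg : F (f_ m) @[m --> \oo] --> F f.
  apply/cvgrPdist_le => e e0.
  have e'0 : 0 < e / (Lam + 1) by rewrite divr_gt0// ltr_wpDl.
  have /cvgr0_norm_le /(_ _ e'0) := f_f; apply: filterS => m.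
  rewrite ger0_norm; last exact: Rintegral_ge0.
  have -> : F f - F (f_ m) = F (fun x => f x - f_ m x).
    have := Flin (-1) _ _ (Lf_ m) lf; rewrite mulN1r addrC => <-.
    by congr F; apply/funext => x; rewrite mulN1r addrC.
  rewrite ler_pdivlMr ?ltr_wpDl// => h1.
  rewrite (le_trans (Fnorm _ (L1B lf (Lf_ m))))// (le_trans _ h1)//.
  rewrite RintegralZr//; last exact/L1_norm/L1B.
  by rewrite ler_wpM2l ?lerDl// Rintegral_ge0.
apply: (cvg_unique _ _ F_cvg) => //.
rewrite (_ : (fun m => F (f_ m)) = (fun m => \int[mu]_x (a x * f_ m x))); last exact/funext.
apply/cvgrPdist_le => e e0.
have e'0 : 0 < e / (Lam + 1) by rewrite divr_gt0// ltr_wpDl.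
have /cvgr0_norm_le /(_ _ e'0) := f_f; apply: filterS => m.
rewrite ger0_norm; last exact: Rintegral_ge0.
rewrite ler_pdivlMr ?ltr_wpDl// => h1; rewrite (le_trans _ h1)//.
rewrite -RintegralB//; [|exact: Laf|exact: Laf].
have LB := L1B lf (Lf_ m).
apply: (@le_trans _ _ (\int[mu]_x (Lam * `|f x - f_ m x|))).
  apply: Rintegral_norm_le; [apply: L1B; exact: Laf|exact/L1Z/L1_norm|move=> x].
  by rewrite -mulrBr normrM ler_wpM2r.
rewrite RintegralZl//; last exact: L1_norm.
by rewrite mulrC ler_wpM2l ?lerDl// Rintegral_ge0.
Qed.

(** The ultrafilter yields the limit [a] first; a genuine subsequence is extracted afterwards.
    Countably many test functions, the indicators of the [G i], suffice for the extraction, since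
    [L1_pi_system_dense] reaches all the others. *)
Lemma weak_star_compactness : exists (sigma : nat -> nat) (a : T -> R),
  [/\ forall i j, (i < j)%N -> (sigma i < sigma j)%N, measurable_fun setT a,
      forall x, lam <= a x <= Lam &
      forall h, 'L1 h ->
        \int[mu]_x ((a_ (sigma k) x - a x) * h x) @[k --> \oo] --> 0].
Proof.
have [U [UU ooU]] := @ultraFilterLemma _ \oo%classic _.
have UP := @ultra_proper _ _ UU.
have [a [ma ab ac]] := limit_density UU.
have anorm x : `|a x| <= Lam.
  by have /andP[h1 h2] := ab x; rewrite ger0_norm// (le_trans lam0).
have mGi i : measurable (G i) by rewrite mG; apply: sub_sigma_algebra; exists i.
have LG i : 'L1 (\1_(G i) : T -> R) by apply: L1_indic; [exact: mGi|exact: Goo].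
have Laf u : 'L1 u -> 'L1 (fun x => a x * u x) by move=> lu; exact: L1M_bounded lu ma anorm.
have IB k u : 'L1 u -> \int[mu]_x ((a_ k x - a x) * u x) =
    \int[mu]_x (a_ k x * u x) - \int[mu]_x (a x * u x).
  move=> lu; rewrite -RintegralB//; [|exact: La|exact: Laf].
  by apply: eq_Rintegral => x _; rewrite mulrBl.
(* The j-th index of the subsequence has to be accurate up to 1 / (j + 1) on the sets [G 0], ...,
   [G j]. These are finitely many conditions, so such indices form a member of the ultrafilter, and
   it contains arbitrarily large ones. *)
pose good j k := forall i, (i <= j)%N ->
  `|\int[mu]_x ((a_ k x - a x) * \1_(G i) x)| <= j.+1%:R^-1.
have ex_good j m : exists k, (m < k)%N /\ good j k.
  have Ugood : U (good j).
    have Ui i : U [set k | `|\int[mu]_x ((a_ k x - a x) * \1_(G i) x)| <= j.+1%:R^-1].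
      have /cvgrPdist_le /(_ j.+1%:R^-1) := ac _ (LG i).
      rewrite invr_gt0 ltr0n => /(_ isT); apply: filterS => k /=.
      by rewrite distrC IB.
    suff Un N : U [set k | forall i, (i < N)%N ->
        `|\int[mu]_x ((a_ k x - a x) * \1_(G i) x)| <= j.+1%:R^-1].
      by apply: filterS (Un j.+1) => k /= H i ij; apply: H.
    elim: N => [|N IH]; first by apply: filterS (@filterT _ U _).
    apply: filterS2 IH (Ui N) => k H1 H2 i; rewrite ltnS leq_eqVlt.
    by move=> /orP[/eqP -> //|]; exact: H1.
  have Um : U [set k | (m < k)%N] by apply: ooU; exists m.+1.
  by have [k [k1 k2]] := filter_ex (filterI Um Ugood); exists k.
have /choice[K HK] : forall jm : nat * nat, exists k, (jm.2 < k)%N /\ good jm.1 k.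
  by move=> [j m]; exact: ex_good.
pose sigma := fix s j := if j is j'.+1 then K (j, s j') else K (0%N, 0%N).
have sgood j : good j (sigma j) by case: j => [|j]; [have [] := HK (0%N, 0%N)|have [] := HK (j.+1, sigma j)].
have sinc j : (sigma j < sigma j.+1)%N by have [] := HK (j.+1, sigma j).
exists sigma, a; split => //.
  by move=> i j; elim: j => // j IH; rewrite ltnS leq_eqVlt => /predU1P[->|/IH h];
    [exact: sinc|exact: ltn_trans h (sinc j)].
move=> h lh.
pose V := [set u : T -> R | 'L1 u /\
  \int[mu]_x ((a_ (sigma k) x - a x) * u x) @[k --> \oo] --> 0].
suff : V h by case.
have Ld k u : 'L1 u -> 'L1 (fun x => (a_ k x - a x) * u x).
  by move=> lu; under eq_fun do rewrite mulrBl; apply: L1B; [exact: La|exact: Laf].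
apply: (L1_pi_system_dense mG GI Gg gnd gT _ _ _ _ lh).
- by move=> A [i _ <-]; exact: Goo.
- move=> c u v [lu cu] [lv cv]; split; first exact/L1D/lv/L1Z.
  rewrite -[X in _ --> X](addr0 0) -[X in _ --> X + _](mulr0 c).
  rewrite (_ : (fun k => _) = (fun k => c * (\int[mu]_x ((a_ (sigma k) x - a x) * u x)) +
      \int[mu]_x ((a_ (sigma k) x - a x) * v x))).
    by apply: cvgD => //; apply: cvgM => //; exact: cvg_cst.
  apply/funext => k; rewrite -RintegralZl//; last exact: Ld.
  rewrite -RintegralD//; [|exact/L1Z/Ld|exact: Ld].
  by apply: eq_Rintegral => x _; rewrite mulrDr mulrCA.
- move=> f_ f Vf_ lf_ lf f_f; split => //.
  apply/cvgr0Pnorm_le => e e0.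
  have e'0 : 0 < e / 2 / (Lam + Lam + 1) by rewrite !divr_gt0// ltr_wpDl// addr_ge0.
  have /cvgr0_norm_le /(_ _ e'0) [m _ /(_ _ (leqnn m))] := f_f.
  rewrite ger0_norm; last exact: Rintegral_ge0.
  rewrite ler_pdivlMr ?ltr_wpDl ?addr_ge0// => h1.
  have e20 : 0 < e / 2 by rewrite divr_gt0.
  have [_ /cvgr0_norm_le /(_ _ e20)] := Vf_ m; apply: filterS => k h2.
  have -> : \int[mu]_x ((a_ (sigma k) x - a x) * f x) =
     \int[mu]_x ((a_ (sigma k) x - a x) * (f x - f_ m x)) +
     \int[mu]_x ((a_ (sigma k) x - a x) * f_ m x).
    rewrite -RintegralD//; [|exact/Ld/L1B|exact: Ld].
    by apply: eq_Rintegral => x _; rewrite -mulrDr subrK.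
  rewrite (le_trans (ler_normD _ _))// (splitr e) lerD// (le_trans _ h1)//.
  have LB := L1B lf (lf_ m).
  apply: (@le_trans _ _ (\int[mu]_x ((Lam + Lam) * `|f x - f_ m x|))).
    apply: Rintegral_norm_le; [exact: Ld|exact/L1Z/L1_norm|move=> x].
    by rewrite normrM ler_wpM2r// (le_trans (ler_normB _ _))// lerD.
  rewrite RintegralZl//; last exact: L1_norm.
  by rewrite mulrC ler_wpM2l ?lerDl// Rintegral_ge0.
- move=> A [i _ <-]; split => //; apply/cvgr0Pnorm_le => e e0.
  near=> k; have ik : (i <= k)%N by near: k; exact: nbhs_infty_ge.
  rewrite (le_trans (sgood k i ik))// ltW//; near: k; exact: near_infty_natSinv_lt (PosNum e0).
Unshelve. all: by end_near. Qed.

End weak_star_compactness.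

(** * Lebesgue measure on pairs of points of R^n *)

Section rational_boxes.
Context d (T : measurableType d) (R : realType) (J : finType).
Variable f : J -> T -> R.

(** The coordinates are an arbitrary finite family [f], so that the same boxes serve for points of
    R^n and for pairs of points. *)
Definition rat_box (q : {ffun J -> rat} * {ffun J -> rat}) : set T :=
  [set x | forall j, ratr (q.1 j) < f j x < ratr (q.2 j)].

(** A number that is not a code is sent to a box as well, so the range of the sequence consists
    exactly of the rational boxes. *)
Definition rat_box_seq (k : nat) : set T :=
  rat_box (odflt ([ffun=> 0], [ffun=> 0]) (unpickle k)).

Definition rat_cube (k : nat) : set T :=
  rat_box ([ffun=> - (k%:R : rat)], [ffun=> k%:R]).

Lemma rat_box_seqE q : exists k, rat_box_seq k = rat_box q.
Proof. by exists (pickle q); rewrite /rat_box_seq pickleK. Qed.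

Lemma range_rat_box_seq : range rat_box_seq = range rat_box.
Proof.
apply/seteqP; split => _ [k _ <-]; first by eexists.
by have [i <-] := rat_box_seqE k; exists i.
Qed.

Lemma rat_box_setI : setI_closed (range rat_box_seq).
Proof.
rewrite range_rat_box_seq => _ _ [q _ <-] [r _ <-].
exists ([ffun j => Num.max (q.1 j) (r.1 j)], [ffun j => Num.min (q.2 j) (r.2 j)]) => //.
apply/seteqP; split => x /=.
  move=> H; split => j; have := H j; rewrite !ffunE.
    move=> /andP[h1 h2]; apply/andP; split.
      by apply: le_lt_trans h1; rewrite ler_rat le_max lexx.
    by apply: lt_le_trans h2 _; rewrite ler_rat ge_min lexx.
  move=> /andP[h1 h2]; apply/andP; split.
    by apply: le_lt_trans h1; rewrite ler_rat le_max lexx orbT.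
  by apply: lt_le_trans h2 _; rewrite ler_rat ge_min lexx orbT.
move=> [H1 H2] j; have /andP[h1 h2] := H1 j; have /andP[h3 h4] := H2 j.
rewrite !ffunE; apply/andP; split.
  by case: (leP (q.1 j) (r.1 j)).
by case: (leP (q.2 j) (r.2 j)).
Qed.

Lemma rat_cube_nd : nondecreasing_seq rat_cube.
Proof.
move=> k l kl; apply/subsetPset => x /= H j; have := H j.
rewrite !ffunE !rmorphN /= !ratr_nat => /andP[h1 h2]; apply/andP; split.
  by apply: le_lt_trans h1; rewrite lerN2 ler_nat.
by apply: lt_le_trans h2 _; rewrite ler_nat.
Qed.

Lemma rat_cube_bigcup : \bigcup_k rat_cube k = setT.
Proof.
apply/seteqP; split => // x _.
pose M := \sum_j `|f j x|.
exists (Num.bound M) => // j; rewrite !ffunE rmorphN /= !ratr_nat -ltr_norml.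
apply: le_lt_trans (archi_boundP _); last exact: sumr_ge0.
by rewrite /M (bigD1 j)//= lerDl sumr_ge0.
Qed.

Lemma range_rat_cube k : range rat_box_seq (rat_cube k).
Proof. by rewrite range_rat_box_seq; eexists. Qed.

Hypothesis mf : forall j, measurable_fun setT (f j : T -> measurableTypeR R).
Hypothesis gen_f : forall S : set (set T), sigma_algebra setT S ->
  (forall j (B : set (measurableTypeR R)), measurable B -> S (f j @^-1` B)) -> measurable `<=` S.

Lemma measurable_rat_box q : measurable (rat_box q).
Proof.
rewrite (_ : rat_box q = \bigcap_j (f j @^-1` `]ratr (q.1 j), ratr (q.2 j)[%classic)).
  apply: fin_bigcap_measurable => // j _.
  by rewrite -[X in measurable X]setTI; exact: mf.
apply/seteqP; split => x /= H j; first by move=> _ /=; rewrite in_itv/=; exact: H.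
by have := H j I; rewrite /= in_itv.
Qed.

Lemma measurable_rat_boxes : @measurable _ T = <<s range rat_box_seq >>.
Proof.
rewrite range_rat_box_seq; apply/seteqP; split; last first.
  apply: smallest_sub; first exact: sigma_algebra_measurable.
  by move=> _ [q _ <-]; exact: measurable_rat_box.
have [S0 SC SU] := smallest_sigma_algebra setT (range rat_box).
apply: gen_f; first exact: smallest_sigma_algebra.
move=> j B mB; have {mB} : (@RGenOInfty.G R).-sigma.-measurable B.
  by rewrite -RGenOInfty.measurableE.
suff : <<s (@RGenOInfty.G R) >> `<=` [set B | <<s range rat_box >> (f j @^-1` B)] by exact.
apply: smallest_sub.
  split.
  - by rewrite /= preimage_set0.
  - move=> A /= SA; rewrite setTD preimage_setC -setTD; exact: SC.
  - by move=> F SF /=; rewrite preimage_bigcup; exact: SU.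
move=> _ [r ->] /=.
(* The preimage of a half-line above [r] is the countable union of the rational boxes whose j-th
   lower side is at least [r]. *)
pose F k : set T := if (unpickle k : option ({ffun J -> rat} * {ffun J -> rat})) is Some q then
   (if r <= ratr (q.1 j) then rat_box q else set0) else set0.
rewrite (_ : _ @^-1` _ = \bigcup_k F k).
  apply: SU => k; rewrite /F; case: unpickle => [q|//]; case: ifPn => // _.
  by apply: sub_sigma_algebra; exists q.
apply/seteqP; split => [x /=|x [k _]].
  rewrite in_itv/= andbT => rx.
  have /choice[a Ha] : forall i, exists q : rat, (if i == j then r else f i x - 1) < ratr q < f i x.
    move=> i; have : (if i == j then r else f i x - 1) < f i x.
      by case: eqP => [->//|_]; rewrite ltrBlDr ltrDl.
    by move=> /rat_in_itvoo[q]; rewrite in_itv/= => h; exists q.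
  have /choice[b Hb] : forall i, exists q : rat, f i x < ratr q < f i x + 1.
    move=> i; have : f i x < f i x + 1 by rewrite ltrDl.
    by move=> /rat_in_itvoo[q]; rewrite in_itv/= => h; exists q.
  exists (pickle (finfun a, finfun b)) => //.
  rewrite /F pickleK /= ffunE ifT.
    move=> i /=; rewrite !ffunE.
    by have /andP[_ ->] := Ha i; have /andP[-> _] := Hb i.
  by have := Ha j; rewrite eqxx => /andP[/ltW].
rewrite /F; case: unpickle => // q; case: ifPn => // rq H /=.
by rewrite in_itv/= andbT (le_lt_trans rq)//; have /andP[] := H j.
Qed.

End rational_boxes.

Section measure_preserving.
Context d (T : measurableType d) (R : realType).
Variables (mu : {measure set T -> \bar R}) (phi : T -> T).
Hypothesis mphi : measurable_fun setT phi.
Hypothesis mu_phi : forall A, measurable A -> mu (phi @^-1` A) = mu A.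

Lemma ge0_integral_preserving (f : T -> \bar R) : measurable_fun setT f ->
  (forall x, 0 <= f x)%E -> (\int[mu]_x f (phi x) = \int[mu]_x f x)%E.
Proof.
move=> mf f0; have := ge0_integral_pushforward mphi mu measurableT mf (fun x _ => f0 x).
rewrite preimage_setT => <-.
by apply: eq_measure_integral => /= A mA _; exact: mu_phi.
Qed.

Lemma L1_preserving (f : T -> R) : mu.-integrable setT (EFin \o f) ->
  mu.-integrable setT (EFin \o (f \o phi)).
Proof.
move=> lf; have mf := L1_measurable lf.
apply: L1_fin_norm; first exact: measurableT_comp.
rewrite (@ge0_integral_preserving (fun x => `|f x|%:E))//.
  by have /integrableP[] := lf.
by apply/measurable_EFinP; exact: measurableT_comp.
Qed.

Lemma Rintegral_preserving (f : T -> R) : mu.-integrable setT (EFin \o f) ->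
  \int[mu]_x f (phi x) = \int[mu]_x f x.
Proof.
move=> lf; have mf := measurable_int mu lf.
rewrite /Rintegral; congr fine; rewrite integralE [RHS]integralE.
congr (_ - _)%E.
  have h := ge0_integral_preserving (measurable_funepos mf) (fun x => funepos_ge0 _ x).
  by transitivity (\int[mu]_x (EFin \o f)^\+ (phi x))%E; [by apply: eq_integral => x _; rewrite !(funeposE, funenegE)|exact: h].
have h := ge0_integral_preserving (measurable_funeneg mf) (fun x => funeneg_ge0 _ x).
by transitivity (\int[mu]_x (EFin \o f)^\- (phi x))%E; [by apply: eq_integral => x _; rewrite !(funeposE, funenegE)|exact: h].
Qed.

End measure_preserving.

(** * Invariance of the measures under translation and exchange of variables *)

Section lebesgue_rV_theory.
Context {R : realType} {n : nat}.
Local Notation E := 'rV[R]_n.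
Local Notation mu := (@lebesgue_rV R n).
Local Notation mu2 := (@lebesgue_rV2 R n).

Lemma rV_coord_gen (S : set (set E)) : sigma_algebra setT S ->
  (forall j (B : set (measurableTypeR R)), measurable B -> S (rV_coord j @^-1` B)) ->
  measurable `<=` S.
Proof.
move=> sS HS; apply: smallest_sub => //.
rewrite -bigcup_seq/= => B [i _ [C mC <-]].
by rewrite setTI; exact: HS.
Qed.

Definition rV2_coord (j : 'I_n + 'I_n) (z : E * E) : R :=
  match j with inl i => z.1 0 i | inr i => z.2 0 i end.

Lemma measurable_rV2_coord j : measurable_fun setT (rV2_coord j : E * E -> measurableTypeR R).
Proof.
case: j => i.
  by rewrite (_ : rV2_coord _ = rV_coord i \o fst)//; apply: measurableT_comp => //; exact: measurable_rV_coord.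
by rewrite (_ : rV2_coord _ = rV_coord i \o snd)//; apply: measurableT_comp => //; exact: measurable_rV_coord.
Qed.

Lemma rV2_coord_gen (S : set (set (E * E))) : sigma_algebra setT S ->
  (forall j (B : set (measurableTypeR R)), measurable B -> S (rV2_coord j @^-1` B)) ->
  measurable `<=` S.
Proof.
move=> sS HS; have [S0 SC SU] := sS; rewrite measurable_prod_measurableType; apply: smallest_sub => //.
have SI A B : S A -> S B -> S (A `&` B).
  move=> SA SB; rewrite -[A `&` B]setCK setCI -setTD; apply: (SC).
  rewrite -bigcup2E; apply: SU => -[|[|k]] //=; rewrite -setTD; exact: SC.
have S1 A : measurable A -> S (fst @^-1` A).
  move: A; apply: (@rV_coord_gen [set A | S (fst @^-1` A)]).
    split => /= [|A SA|F SF]; first by rewrite preimage_set0.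
    - by rewrite setTD preimage_setC -setTD; exact: SC.
    - by rewrite preimage_bigcup; exact: SU.
  by move=> j B mB /=; exact: (HS (inl j)).
have S2 A : measurable A -> S (snd @^-1` A).
  move: A; apply: (@rV_coord_gen [set A | S (snd @^-1` A)]).
    split => /= [|A SA|F SF]; first by rewrite preimage_set0.
    - by rewrite setTD preimage_setC -setTD; exact: SC.
    - by rewrite preimage_bigcup; exact: SU.
  by move=> j B mB /=; exact: (HS (inr j)).
move=> _ [A mA [B mB <-]].
rewrite (_ : A `*` B = fst @^-1` A `&` snd @^-1` B)//.
exact: SI (S1 _ mA) (S2 _ mB).
Qed.

Lemma measurable_rV_shift (h : E) : measurable_fun setT (fun x : E => x + h).
Proof.
apply: measurable_fun_rVP => i.
rewrite (_ : _ \o _ = (fun x => rV_coord i x + h 0 i)); last by apply/funext => x /=; rewrite /rV_coord mxE.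
by apply: measurable_funD => //; exact: measurable_rV_coord.
Qed.

Lemma lebesgue_rV_itv_box (a b : 'I_n -> R) :
  mu [set x | forall i, a i < x 0 i < b i] =
  (\prod_(i < n) lebesgue_measure (`]a i, b i[%classic : set R))%E.
Proof.
have := @lebesgue_rV_box R n (fun i => `]a i, b i[%classic) (fun i => measurable_itv _).
move=> <-; congr (mu _); apply/seteqP; split => x /= H i; have := H i; by rewrite /= in_itv.
Qed.

Lemma lebesgue_rV_itv_box_lty (a b : 'I_n -> R) :
  (mu [set x | forall i, (a i < x 0 i < b i)%R] < +oo)%E.
Proof.
rewrite lebesgue_rV_itv_box.
suff /andP[//] : (0 <= \prod_(i < n) lebesgue_measure (`]a i, b i[%classic : set R) < +oo)%E.
apply: (big_ind (fun x => 0 <= x < +oo)%E) => [|x y /andP[x0 xoo] /andP[y0 yoo]|i _].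
- by rewrite lee_fin ler01 ltry.
- by rewrite mule_ge0// lte_mul_pinfty// ge0_fin_numE.
- rewrite measure_ge0 lebesgue_measure_itv/=.
  by case: ifP => _; rewrite -?EFinB ltry.
Qed.

(** On a rational box the measure is the product of the side lengths, which a translation preserves;
    the rational boxes are a pi-system that determines the measure. *)
Lemma lebesgue_rV_shift (h : E) A : measurable A ->
  mu ((fun x => x + h) @^-1` A) = mu A.
Proof.
move=> mA; pose f : 'I_n -> E -> R := fun i x => x 0 i.
have mf i : measurable_fun setT (f i : _ -> measurableTypeR R) by exact: measurable_rV_coord.
pose m1 := measure_function_pushforward__canonical__measure_function_Measure mu (measurable_rV_shift h).
apply: (@measure_unique _ _ _ (range (rat_box_seq f)) (rat_cube f) _ _ _ _ m1 mu) => //.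
- exact: (measurable_rat_boxes mf rV_coord_gen).
- exact: rat_box_setI.
- exact: range_rat_cube.
- exact: rat_cube_bigcup.
- rewrite range_rat_box_seq => _ [q _ <-] /=; rewrite /pushforward.
  transitivity (mu [set x | forall i, ratr (q.1 i) - h 0 i < x 0 i < ratr (q.2 i) - h 0 i]).
    congr (mu _); apply/seteqP; split => x /= H i; have := H i; rewrite /f !mxE.
      by rewrite ltrBlDr ltrBrDr.
    by rewrite ltrBlDr ltrBrDr.
  rewrite (lebesgue_rV_itv_box (fun i => ratr (q.1 i)) (fun i => ratr (q.2 i))) lebesgue_rV_itv_box.
  apply: eq_bigr => i _; rewrite !lebesgue_measure_itv/= !lte_fin ltrD2r.
  by case: ifP => // _; rewrite -!EFinB; congr EFin; ring.
- move=> k.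
  have bfin := lebesgue_rV_itv_box_lty (fun i => - k%:R - h 0 i) (fun i => k%:R - h 0 i).
  apply: (eq_ind _ (fun A => (mu A < +oo)%E) bfin ((fun x => x + h) @^-1` rat_cube f k)).
  apply/seteqP; split => x /= H i; have := H i; rewrite /f /= !ffunE rmorphN /= !ratr_nat !mxE.
    by rewrite ltrBlDr ltrBrDr.
  by rewrite ltrBlDr ltrBrDr.
Qed.

Definition rV2_shift (h : E) (z : E * E) : E * E := (z.1 + h, z.2 + h).

Lemma measurable_rV2_shift h : measurable_fun setT (rV2_shift h).
Proof.
apply: measurable_fun_pair; apply: (measurableT_comp (measurable_rV_shift h)) => //.
Qed.

Lemma lebesgue_rV2_shift (h : E) A : measurable A ->
  mu2 (rV2_shift h @^-1` A) = mu2 A.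
Proof.
move=> mA.
pose m1 := measure_function_pushforward__canonical__measure_function_Measure mu2 (measurable_rV2_shift h).
apply/esym; apply: (@product_measure_unique _ _ _ _ _ mu mu m1) => // B C mB mC.
rewrite /= /pushforward -(lebesgue_rV_shift h mB) -(lebesgue_rV_shift h mC).
rewrite -product_measure1E//; rewrite -[X in measurable X]setTI; exact: measurable_rV_shift.
Qed.

Definition rV2_swap (z : E * E) : E * E := (z.2, z.1).

Lemma measurable_rV2_swap : measurable_fun setT rV2_swap.
Proof. by apply: measurable_fun_pair. Qed.

Lemma lebesgue_rV2_swap A : measurable A -> mu2 (rV2_swap @^-1` A) = mu2 A.
Proof.
move=> mA.
pose m1 := measure_function_pushforward__canonical__measure_function_Measure mu2 measurable_rV2_swap.
apply/esym; apply: (@product_measure_unique _ _ _ _ _ mu mu m1) => // B C mB mC.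
rewrite /= /pushforward muleC -product_measure1E//; congr (mu2 _).
by apply/seteqP; split => -[x y] /= [].
Qed.

Lemma lebesgue_rV2_rat_box_lty i :
  (mu2 (rat_box_seq (rV2_coord : _ -> _ -> R) i) < +oo)%E.
Proof.
have [q ->] : exists q, rat_box_seq (rV2_coord : _ -> _ -> R) i = rat_box (rV2_coord : _ -> _ -> R) q by eexists.
rewrite (_ : rat_box _ _ =
   [set x : E | forall i, ratr (q.1 (inl i)) < x 0 i < ratr (q.2 (inl i))] `*`
   [set x : E | forall i, ratr (q.1 (inr i)) < x 0 i < ratr (q.2 (inr i))]).
  have mb (a b : 'I_n -> R) : measurable [set x : E | forall i, a i < x 0 i < b i].
    have := @measurable_rV_box R n (fun i => `]a i, b i[%classic) (fun i => measurable_itv _).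
    by congr measurable; apply/seteqP; split => x /= H j; have := H j; rewrite /= in_itv.
  rewrite [mu2 _](product_measure1E mu mu (mb _ _) (mb _ _)).
  by rewrite lte_mul_pinfty// ?ge0_fin_numE//; exact: lebesgue_rV_itv_box_lty.
apply/seteqP; split => [z H|z [H1 H2] [i0|i0]].
- by split => i0; [exact: (H (inl i0))|exact: (H (inr i0))].
- exact: H1.
- exact: H2.
Qed.

End lebesgue_rV_theory.

Section Lfun_criteria.
Context d (T : measurableType d) (R : realType) (mu : {measure set T -> \bar R}).

Lemma LfunP (p : R) (f : T -> R) : 0 < p -> f \in Lfun mu p%:E <->
  measurable_fun setT f /\ mu.-integrable setT (EFin \o (fun x => `|f x| `^ p)).
Proof.
move=> p0; have N : (('N[mu]_p%:E[EFin \o f] `^ p)%E = \int[mu]_x (`|f x| `^ p)%:E)%E.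
  by rewrite poweR_Lnorm ?lt0r_neq0//.
rewrite inE /=; split.
  move=> /andP[]; rewrite inE => mf; rewrite inE /finite_norm => /= Noo; split => //.
  apply: L1_fin_norm.
    apply: measurableT_comp (measurable_powR _) _; exact: measurableT_comp.
  under eq_integral do rewrite ger0_norm ?powR_ge0//.
  by rewrite -N poweR_lty.
move=> [mf /integrableP[_]].
under eq_integral do rewrite /= ger0_norm ?powR_ge0//.
rewrite -N => Noo; apply/andP; split; rewrite inE//.
rewrite /= /finite_norm; apply: contraTT Noo; rewrite -!leNgt !leye_eq => /eqP ->.
by rewrite poweRyr ?lt0r_neq0.
Qed.

End Lfun_criteria.

(** * Weak-* limits of admissible coefficients *)

Section admissible_theory.
Context {R : realType} {n : nat}.
Local Notation E := 'rV[R]_n.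
Local Notation mu := (@lebesgue_rV R n).
Local Notation mu2 := (@lebesgue_rV2 R n).
Implicit Types (lam Lam : R).

Lemma admissible_measurable lam Lam a : @admissible R n lam Lam a -> measurable_fun setT a.
Proof. by case=> + _; rewrite inE => /andP[+ _]; rewrite inE. Qed.

Lemma bounded_admissible lam Lam (a : E * E -> R) : 0 <= lam -> measurable_fun setT a ->
  (forall z, lam <= a z <= Lam) -> (forall z, a (z.2, z.1) = a z) -> admissible lam Lam a.
Proof.
move=> lam0 ma ab asym; split; last first.
  by apply: aeW => z; split.
rewrite inE; apply/andP; split; rewrite inE//.
rewrite /finite_norm Lnorm.unlock /=; case: ifP => // _.
apply: (@le_lt_trans _ _ Lam%:E); last exact: ltry.
apply/ess_supP/nearW => z /=.
have /andP[h1 h2] := ab z.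
by rewrite lee_fin ger0_norm// (le_trans lam0).
Qed.


Lemma lebesgue_rV2_sigma_finite : sigma_finite setT mu2.
Proof.
pose f : 'I_n + 'I_n -> E * E -> R := rV2_coord.
exists (rat_cube f); first by rewrite rat_cube_bigcup.
move=> k; split; first exact: (measurable_rat_box measurable_rV2_coord).
by have [i _ <-] := range_rat_cube f k; exact: lebesgue_rV2_rat_box_lty.
Qed.

(** The measure is that of [lebesgue_rV2], bundled with its sigma-finiteness for the use of the
    Radon-Nikodym and Tonelli theorems. *)
Definition sigma_finite_rV2 : {sigma_finite_measure set (E * E)%type -> \bar R} :=
  HB.pack (mu \x mu)%E (@Measure_isSigmaFinite.Build _ _ _ (mu \x mu)%E lebesgue_rV2_sigma_finite).

Lemma weak_star_rV2 lam Lam (a_ : nat -> E * E -> R) : 0 <= lam -> lam <= Lam ->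
  (forall k, measurable_fun setT (a_ k)) -> (forall k z, lam <= a_ k z <= Lam) ->
  exists (sigma : nat -> nat) (a : E * E -> R),
  [/\ forall i j, (i < j)%N -> (sigma i < sigma j)%N, measurable_fun setT a,
      forall z, lam <= a z <= Lam &
      forall h, mu2.-integrable setT (EFin \o h) ->
        \int[mu2]_z ((a_ (sigma k) z - a z) * h z) @[k --> \oo] --> 0].
Proof.
pose f : 'I_n + 'I_n -> E * E -> R := rV2_coord.
move=> lam0 lamLam ma_ ab_.
refine (@weak_star_compactness _ _ R sigma_finite_rV2
  (rat_box_seq f) (rat_cube f) _ _ _ _ _ _ lam Lam a_ lam0 lamLam ma_ ab_).
- exact: (measurable_rat_boxes measurable_rV2_coord rV2_coord_gen).
- exact: rat_box_setI.
- exact: range_rat_cube.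
- exact: rat_cube_nd.
- exact: rat_cube_bigcup.
- exact: lebesgue_rV2_rat_box_lty.
Qed.

(** The bounds on [a_ k] hold almost everywhere only, hence the truncations [b k]. A weak-* limit
    [c] of these is averaged with its swap to be symmetric at every point, which keeps the bounds by
    convexity. As [b k] is symmetric almost everywhere, testing against [h] amounts to testing the
    convergence to [c] against [h] and against [h] swapped. *)
Lemma admissible_weak_star lam Lam (a_ : nat -> E * E -> R) : 0 <= lam -> lam <= Lam ->
  (forall k, admissible lam Lam (a_ k)) ->
  exists (sigma : nat -> nat) (a : E * E -> R),
  [/\ forall i j, (i < j)%N -> (sigma i < sigma j)%N, admissible lam Lam a &
      forall h, mu2.-integrable setT (EFin \o h) ->
        \int[mu2]_z ((a_ (sigma k) z - a z) * h z) @[k --> \oo] --> 0].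
Proof.
move=> lam0 lamLam ad; have Lam0 := le_trans lam0 lamLam.
pose b k z := Num.max lam (Num.min Lam (a_ k z)).
have mb k : measurable_fun setT (b k).
  apply: measurable_maxr => //; apply: measurable_minr => //.
  exact: admissible_measurable (ad k).
have bb k z : lam <= b k z <= Lam.
  by rewrite le_max lexx /= ge_max lamLam ge_min lexx.
have [sigma [c [sinc mc cb Hc]]] := weak_star_rV2 lam0 lamLam mb bb.
pose a (z : E * E) := 2^-1 * (c z + c (rV2_swap z)).
have mcs : measurable_fun setT (c \o rV2_swap) by apply: measurableT_comp => //; exact: measurable_rV2_swap.
have ma : measurable_fun setT a by apply: measurable_funM => //; exact: measurable_funD.
have ab z : lam <= a z <= Lam.
  by rewrite /a; have := cb z; have := cb (rV2_swap z); lra.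
have asym (z : E * E) : a (z.2, z.1) = a z.
  by rewrite /a addrC; case: z.
have norm_le u (v : R) : lam <= u <= Lam -> lam <= v <= Lam -> `|u - v| <= Lam.
  by move=> *; rewrite ler_norml; lra.
exists sigma, a; split => //; first exact: bounded_admissible.
move=> h lh; have mh := L1_measurable lh.
have lhs : mu2.-integrable setT (EFin \o (h \o rV2_swap)).
  exact: (L1_preserving measurable_rV2_swap lebesgue_rV2_swap lh).
have Lcb k u : mu2.-integrable setT (EFin \o u) ->
    mu2.-integrable setT (EFin \o (fun z => (b k z - c z) * u z)).
  move=> lu; apply: (L1M_bounded lu); first exact: measurable_funB.
  by move=> z; exact: norm_le.
have key k : \int[mu2]_z ((a_ k z - a z) * h z) =
  2^-1 * (\int[mu2]_z ((b k z - c z) * h z) + \int[mu2]_z ((b k z - c z) * h (rV2_swap z))).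
  have bsym : {ae mu2, forall z, b k (rV2_swap z) = b k z}.
    by case: (ad k) => _; apply: filterS => z [sy _]; rewrite /b sy.
  have ba : {ae mu2, forall z, a_ k z = b k z}.
    case: (ad k) => _; apply: filterS => z [_ /andP[h1 h2]].
    by rewrite /b min_r// max_r.
  have Ls := L1_preserving measurable_rV2_swap lebesgue_rV2_swap (Lcb k _ lhs).
  rewrite -(Rintegral_preserving measurable_rV2_swap lebesgue_rV2_swap (Lcb k _ lhs)).
  rewrite -RintegralD//; last exact: Lcb.
  rewrite -RintegralZl//; last by apply: L1D => //; exact: Lcb.
  apply: Rintegral_ae.
  - apply: (@le_L1_ae _ _ _ _ _ (fun z => Lam * `|h z|)); last exact/L1Z/L1_norm.
      by apply: measurable_funM => //; apply: measurable_funB => //; exact: admissible_measurable (ad k).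
    apply: filterS ba => z ->; rewrite normrM ler_wpM2r//; exact: norm_le.
  - by apply/L1Z/L1D => //; exact: Lcb.
  - apply: filterS2 bsym ba => z bs ->; rewrite /= bs /a.
    by rewrite (_ : rV2_swap (rV2_swap z) = z); [field|case: (z)].
rewrite (_ : (fun k => _) = (fun k => 2^-1 * (\int[mu2]_z ((b (sigma k) z - c z) * h z) +
  \int[mu2]_z ((b (sigma k) z - c z) * h (rV2_swap z))))); last by apply/funext => k; exact: key.
rewrite -[X in _ --> X](mulr0 2^-1); apply: cvgM; first exact: cvg_cst.
by rewrite -[X in _ --> X](addr0 0); apply: cvgD; exact: Hc.
Qed.

End admissible_theory.

(** * Jensen's inequality and continuity of translations in L^p *)

Section row_vector_norm.
Context {R : realType} {n : nat}.
Implicit Types x : 'rV[R]_n.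

Lemma rV_norm_coord x i : `|x 0 i| <= `|x|.
Proof. by rewrite /Num.norm/= mx_normrE; apply: (le_bigmax _ (fun ij => `|x ij.1 ij.2|) (0, i)). Qed.

Lemma rV_norm_le x r : 0 <= r -> (forall i, `|x 0 i| <= r) -> `|x| <= r.
Proof.
move=> r0 xr; rewrite /Num.norm/= mx_normrE; apply: bigmax_le => // -[i j] _ /=.
by rewrite ord1.
Qed.

Lemma rV_norm_lt x r : 0 < r -> (forall i, `|x 0 i| < r) -> `|x| < r.
Proof.
move=> r0 xr; rewrite /Num.norm/= mx_normrE; apply: bigmax_lt => // -[i j] _ /=.
by rewrite ord1.
Qed.

End row_vector_norm.

Section jensen.
Context d (T : measurableType d) (R : realType) (mu : {measure set T -> \bar R}).

(** The graph of the p-th power of the absolute value lies above its tangent at [a], of slope p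
    [Jp p a]; the constant term is rewritten with [Jp p a * a], the p-th power of the modulus of
    a. *)
Lemma powR_tangent (p a b : R) : 1 < p ->
  p * (Jp p a * b) <= (p - 1) * `|a| `^ p + `|b| `^ p.
Proof.
move=> p1; have p0 : 0 < p by lra.
have q0 : 0 < p / (p - 1) by apply: lt_trans (conj_exp p1).
have := @conjugate_powR R `|b| `|Jp p a| p (p / (p - 1)) (normr_ge0 _) (normr_ge0 _)
  p0 q0 (conj_exp_inv p1).
rewrite norm_Jp_conj// => h.
have h2 : Jp p a * b <= `|b| * `|Jp p a| by rewrite mulrC -normrM ler_norm.
have := le_trans h2 h; rewrite -(ler_pM2l p0) => /le_trans; apply.
rewrite le_eqVlt; apply/orP; left; apply/eqP; field.
by rewrite !lt0r_neq0// subr_gt0.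
Qed.

(** The tangent inequality at the mean value [a] is integrated against [rho]. An extended integral
    on the right covers the case where it is infinite. *)
Lemma jensen_powR (p : R) (rho f : T -> R) : 1 < p ->
  (forall x, 0 <= rho x) -> mu.-integrable setT (EFin \o rho) ->
  \int[mu]_x rho x = 1 -> measurable_fun setT f ->
  mu.-integrable setT (EFin \o (fun x => rho x * f x)) ->
  ((`|\int[mu]_x (rho x * f x)| `^ p)%:E <= \int[mu]_x (rho x * `|f x| `^ p)%:E)%E.
Proof.
move=> p1 rho0 lrho irho mf lf.
have mfp : measurable_fun setT (fun x => rho x * `|f x| `^ p).
  apply: measurable_funM; first exact: L1_measurable lrho.
  by apply: measurableT_comp (measurable_powR _) _; exact: measurableT_comp.
have [foo|foo] := ltP (\int[mu]_x (rho x * `|f x| `^ p)%:E)%E +oo%E; last first.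
  by move: foo; rewrite leye_eq => /eqP ->; rewrite leey.
have lfp : mu.-integrable setT (EFin \o (fun x => rho x * `|f x| `^ p)).
  apply: L1_fin_norm => //; under eq_integral do rewrite ger0_norm ?mulr_ge0 ?powR_ge0//.
  exact: foo.
rewrite -Rintegral_EFin// lee_fin.
set a := \int[mu]_x (rho x * f x).
have : p * (Jp p a * a) <= (p - 1) * `|a| `^ p + \int[mu]_x (rho x * `|f x| `^ p).
  rewrite {2}/a -RintegralZl// -RintegralZl//; last exact: L1Z.
  rewrite -[X in X + _]mulr1 -[X in _ * X + _]irho -RintegralZl// -RintegralD//; last exact: L1Z.
  apply: Rintegral_le; [exact/L1Z/L1Z|by apply: L1D => //; exact: L1Z|move=> x].
  have h := ler_wpM2l (rho0 x) (powR_tangent a (f x) p1).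
  rewrite [leLHS](_ : _ = rho x * (p * (Jp p a * f x))); last by ring.
  by rewrite [leRHS](_ : _ = rho x * ((p - 1) * `|a| `^ p + `|f x| `^ p)); last by ring.
by rewrite Jp_mulr//; lra.
Qed.

End jensen.

Section shift_continuity.
Context {R : realType} {n : nat}.
Local Notation E := 'rV[R]_n.
Local Notation mu2 := (@lebesgue_rV2 R n).
Local Notation "'L1 f" := (mu2.-integrable [set: (E * E)%type] (EFin \o f)) (at level 10, f at next level).
Implicit Types (u W : E * E -> R).

Lemma L1_shift h u : 'L1 u -> 'L1 (fun z => u (rV2_shift h z)).
Proof. exact: (L1_preserving (measurable_rV2_shift h) (lebesgue_rV2_shift h)). Qed.

Lemma Rintegral_shift h u : 'L1 u -> \int[mu2]_z u (rV2_shift h z) = \int[mu2]_z u z.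
Proof. exact: (Rintegral_preserving (measurable_rV2_shift h) (lebesgue_rV2_shift h)). Qed.

(** Density reduces the claim to the indicator of a rational box; being open, the box contains the
    small translates of each of its points. *)
Lemma shift_L1_cvg u (h : nat -> E) : 'L1 u -> `|h k| @[k --> \oo] --> 0 ->
  \int[mu2]_z `|u (rV2_shift (h k) z) - u z| @[k --> \oo] --> 0.
Proof.
move=> lu h0.
pose f : 'I_n + 'I_n -> E * E -> R := rV2_coord.
pose I (w : E * E -> R) k := \int[mu2]_z `|w (rV2_shift (h k) z) - w z|.
pose V := [set w : E * E -> R | 'L1 w /\ I w k @[k --> \oo] --> 0].
suff : V u by case.
have LI w k : 'L1 w -> 'L1 (fun z => `|w (rV2_shift (h k) z) - w z|).
  by move=> lw; apply/L1_norm/L1B => //; exact: L1_shift.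
have I0 w k : 0 <= I w k by exact: Rintegral_ge0.
apply: (@L1_pi_system_dense _ _ R mu2 (range (rat_box_seq f)) (rat_cube f) _ _ _ _ _ _ V _ _ _ u lu).
- exact: (measurable_rat_boxes measurable_rV2_coord rV2_coord_gen).
- exact: rat_box_setI.
- exact: range_rat_cube.
- exact: rat_cube_nd.
- exact: rat_cube_bigcup.
- by move=> _ [i _ <-]; exact: lebesgue_rV2_rat_box_lty.
- move=> c w v [lw cw] [lv cv]; split; first exact/L1D/lv/L1Z.
  apply: (@squeeze_cvgr _ _ _ _ (cst 0) (fun k => `|c| * I w k + I v k)).
  + apply: nearW => k; rewrite I0 /=.
    rewrite -RintegralZl//; last exact: LI.
    rewrite -RintegralD//; [|exact/L1Z/LI|exact: LI].
    apply: Rintegral_le; [by apply/LI/L1D => //; exact: L1Z| |move=> z].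
      by apply: L1D; [exact/L1Z/LI|exact: LI].
    rewrite -normrM (le_trans _ (ler_normD _ _))//.
    by rewrite le_eqVlt; apply/orP; left; apply/eqP; congr `|_|; ring.
  + exact: cvg_cst.
  + rewrite -[X in _ --> X](addr0 0) -[X in _ --> X + _](mulr0 `|c|).
    by apply: cvgD => //; apply: cvgM => //; exact: cvg_cst.
- move=> w_ w Vw_ lw_ lw w_w; split => //.
  apply/cvgr0Pnorm_le => e e0.
  have e40 : 0 < e / 4 by rewrite divr_gt0.
  have /cvgr0_norm_le /(_ _ e40) [m _ /(_ _ (leqnn m))] := w_w.
  rewrite ger0_norm; last exact: Rintegral_ge0.
  move=> h1; have LB := L1_norm (L1B lw (lw_ m)).
  have [_ /cvgr0_norm_le /(_ _ e40)] := Vw_ m; apply: filterS => k.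
  rewrite !ger0_norm// => h2.
  apply: (@le_trans _ _ (\int[mu2]_z `|w (rV2_shift (h k) z) - w_ m (rV2_shift (h k) z)| +
      I (w_ m) k + \int[mu2]_z `|w z - w_ m z|)).
    have La := L1_shift (h k) LB; have Lb := LI _ k (lw_ m); have Lab := L1D La Lb.
    rewrite -RintegralD// -RintegralD//.
    apply: Rintegral_le; [exact: LI|exact: L1D|].
    move=> z; rewrite [in leRHS](distrC (w z)).
    rewrite (le_trans _ (lerD (ler_normD _ _) (lexx _)))// (le_trans _ (ler_normD _ _))//.
    by rewrite le_eqVlt; apply/orP; left; apply/eqP; congr `|_|; ring.
  rewrite (Rintegral_shift _ LB).
  by move: h1 h2 => /=; lra.
- move=> _ [i _ <-]; set A := rat_box_seq f i.
  have mA : measurable A by exact: (measurable_rat_box measurable_rV2_coord).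
  have LA : 'L1 (\1_A : E * E -> R) by apply: L1_indic => //; exact: lebesgue_rV2_rat_box_lty.
  split => //.
  have mS k : measurable_fun setT (fun z => \1_A (rV2_shift (h k) z) : R).
    by exact: L1_measurable (L1_shift _ LA).
  have [||||_ cvA _] := @L1_dct _ _ _ mu2 (fun k z => \1_A (rV2_shift (h k) z) * \1_A z : R) \1_A \1_A.
  + by move=> k; apply: measurable_funM => //; exact: L1_measurable LA.
  + by move=> k z; rewrite !indicE; case: (_ \in _); case: (_ \in _); rewrite ?mulr0 ?mulr1 ?normr0 ?normr1.
  + move=> z; have [zA|zA] := pselect (A z); last first.
      apply: cvg_near_cst; apply: nearW => k.
      by rewrite !indicE (memNset zA) mulr0.
    rewrite indicE (mem_set zA); apply: cvg_near_cst.
    suff : \forall k \near \oo, A (rV2_shift (h k) z).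
      by apply: filterS => k Ak; rewrite !indicE (mem_set Ak) ?(mem_set zA) mulr1.
    apply: filter_forall => j /=.
    have /andP[z1 z2] := zA j.
    set a := ratr _ in z1 *; set b := ratr _ in z2 *.
    pose e := Num.min (f j z - a) (b - f j z).
    have e0 : 0 < e by rewrite lt_min !subr_gt0 z1.
    have /cvgr0_norm_lt /(_ _ e0) := h0; apply: filterS => k.
    rewrite normr_id /e lt_min => /andP[h1 h2].
    have [i' ->] : exists i', f j (rV2_shift (h k) z) = f j z + h k 0 i'.
      by case: j {z1 z2 a b e e0 h1 h2} => j; exists j; rewrite /f /= mxE.
    have := rV_norm_coord (h k) i'; rewrite ler_norml => /andP[h3 h4].
    by apply/andP; split; lra.
  + exact: LA.
  (* The L^1 distance of two indicators is the sum of the measures minus twice the measure of the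
     intersection, and the translated box has the measure of the box. *)
  rewrite (_ : I _ = (fun k => 2 * \int[mu2]_z (\1_A z : R) -
     2 * \int[mu2]_z (\1_A (rV2_shift (h k) z) * \1_A z : R))).
    rewrite -[X in _ --> X](subrr (2 * \int[mu2]_z (\1_A z : R))).
    apply: cvgB; first exact: cvg_cst.
    by apply: cvgM; [exact: cvg_cst|exact: cvA].
  apply/funext => k; rewrite /I.
  have L2 : 'L1 (fun z => \1_A (rV2_shift (h k) z) * \1_A z : R).
    apply: (L1M_bounded LA (mS k) (M := 1)) => z.
    by rewrite indicE; case: (_ \in _); rewrite ?normr0 ?normr1.
  rewrite mulrDl mul1r -{1}(Rintegral_shift (h k) LA).
  rewrite -RintegralD//; last exact: L1_shift.
  rewrite -RintegralZl// -RintegralB//; last 2 first.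
  + by apply: L1D => //; exact: L1_shift.
  + exact: L1Z.
  apply: eq_Rintegral => z _; rewrite !indicE.
  by case: (_ \in _); case: (_ \in _) => /=; rewrite ?subrr ?normr0 ?subr0 ?sub0r ?normrN ?normr1; ring.
Qed.

Lemma shift_L1_small u e : 'L1 u -> 0 < e -> exists2 delta, 0 < delta &
  forall h, `|h| < delta -> \int[mu2]_z `|u (rV2_shift h z) - u z| <= e.
Proof.
move=> lu e0; apply: contrapT => nd.
have /choice[h Hh] : forall k : nat, exists h : E, `|h| < k.+1%:R^-1 /\
    e < \int[mu2]_z `|u (rV2_shift h z) - u z|.
  move=> k; apply: contrapT => nh; apply: nd; exists k.+1%:R^-1; first by rewrite invr_gt0.
  move=> h hk; rewrite leNgt; apply/negP => eh; apply: nh; by exists h.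
have h0 : `|h k| @[k --> \oo] --> 0.
  apply: (@squeeze_cvgr _ _ _ _ (cst 0) (fun k => k.+1%:R^-1)).
  - by apply: nearW => k; rewrite normr_ge0 /= ltW//; have [] := Hh k.
  - exact: cvg_cst.
  - exact: cvg_harmonic.
have /cvgr0_norm_le /(_ _ e0) [m _ /(_ _ (leqnn m))] := shift_L1_cvg lu h0.
rewrite ger0_norm; last exact: Rintegral_ge0.
by rewrite leNgt => /negP; apply; have [] := Hh m.
Qed.

(** Keeping [W] only where its modulus lies between 1 / (m + 1) and m + 1 reduces the claim to L^1.
    The lower bound makes the truncation [W_ m] integrable; the upper bound controls the p-th power
    of a difference of its values by a multiple of the difference. *)
Lemma shift_Lp_small p W e : 1 < p -> measurable_fun setT W ->
  'L1 (fun z => `|W z| `^ p) -> 0 < e ->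
  exists2 delta, 0 < delta & forall h, `|h| < delta ->
    'L1 (fun z => `|W (rV2_shift h z) - W z| `^ p) /\
    \int[mu2]_z `|W (rV2_shift h z) - W z| `^ p <= e.
Proof.
move=> p1 mW lW e0; have p0 : 0 < p by lra.
pose A (m : nat) := [set z | m.+1%:R^-1 <= `|W z| <= m.+1%:R].
have mA m : measurable (A m).
  rewrite (_ : A m = (Num.norm \o W) @^-1` `[m.+1%:R^-1, m.+1%:R]%classic).
    by rewrite -[X in measurable X]setTI; apply: (measurableT_comp _ mW).
  by apply/seteqP; split => z /=; rewrite in_itv.
pose W_ m z := W z * \1_(A m) z.
have mW_ m : measurable_fun setT (W_ m) by apply: measurable_funM => //; exact: measurable_indic.
have mpow u : measurable_fun setT u -> measurable_fun setT (fun z => `|u z| `^ p).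
  by move=> mu_; apply: measurableT_comp (measurable_powR _) _; exact: measurableT_comp.
have W_le m z : `|W_ m z| <= `|W z|.
  by rewrite /W_ normrM indicE; case: (_ \in _); rewrite ?normr1 ?mulr1// normr0 mulr0.
have LW_ m : 'L1 (W_ m).
  apply: (@le_L1 _ _ _ _ _ (fun z => m.+1%:R `^ (p - 1) * `|W z| `^ p)) => //; last exact: L1Z.
  move=> z; rewrite /W_ normrM indicE; have [|] := boolP (z \in A m); last first.
    by rewrite normr0 mulr0 mulr_ge0 ?powR_ge0.
  rewrite inE => -/andP[h1 h2]; rewrite normr1 mulr1.
  rewrite -(@mulr_powRB1 _ `|W z|)// mulrCA ler_peMr// -powRM//.
  apply: (@le_trans _ _ (1 `^ (p - 1))); first by rewrite powR1.
  apply: ge0_ler_powR; rewrite ?nnegrE ?mulr_ge0//; first by lra.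
  by rewrite -ler_pdivrMl// mulr1.
have W_cvg z : `|W z - W_ m z| `^ p @[m --> \oo] --> 0.
  apply: cvg_near_cst.
  have [Wz|Wz] := eqVneq (W z) 0.
    by apply: nearW => m; rewrite /W_ Wz mul0r subrr normr0 powR0 ?lt0r_neq0.
  have Wz0 : 0 < `|W z| by rewrite normr_gt0.
  near=> m; rewrite /W_ indicE mem_set ?mulr1 ?subrr ?normr0 ?powR0 ?lt0r_neq0//.
  apply/andP; split.
    by apply/ltW; near: m; exact: (near_infty_natSinv_lt (PosNum Wz0)).
  have : `|W z| <= m%:R by near: m; exact: nbhs_infty_ger.
  by move=> /le_trans; apply; rewrite ler_nat.
have dom m z : `| `|W z - W_ m z| `^ p| <= `|W z| `^ p.
  rewrite ger0_norm ?powR_ge0//; apply: ge0_ler_powR; rewrite ?nnegrE//; first exact: ltW.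
  rewrite /W_ indicE; case: (_ \in _); first by rewrite mulr1 subrr normr0.
  by rewrite mulr0 subr0.
have [||||_ iW _] := @L1_dct _ _ _ mu2 (fun m z => `|W z - W_ m z| `^ p) (fun=> 0)
  (fun z => `|W z| `^ p) => //.
  by move=> m; apply: mpow; exact: measurable_funB.
rewrite Rintegral0 in iW.
(* The difference is split into three terms, which takes two applications of [powR_normD], each
   costing 2^p. *)
pose K : R := 2 `^ p * 2 `^ p.
have K0 : 0 < K by rewrite mulr_gt0// powR_gt0.
have e'0 : 0 < e / (3 * K) by rewrite divr_gt0// mulr_gt0.
have /cvgr0_norm_le /(_ _ e'0) [m _ /(_ _ (leqnn m))] := iW.
rewrite ger0_norm; last by apply: Rintegral_ge0 => z _; exact: powR_ge0.
move=> h1; pose c : R := (m.+1%:R + m.+1%:R) `^ (p - 1).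
have c0 : 0 < c by rewrite powR_gt0// addr_gt0.
have e''0 : 0 < e / (3 * K) / c by rewrite divr_gt0.
have [delta d0 Hd] := shift_L1_small (LW_ m) e''0.
exists delta => // h /Hd h2.
have mS u : measurable_fun setT u -> measurable_fun setT (fun z => u (rV2_shift h z)).
  by move=> mu_; apply: measurableT_comp => //; exact: measurable_rV2_shift.
have LB : 'L1 (fun z => `|W z - W_ m z| `^ p).
  by apply: le_L1 (dom m) lW; apply: mpow; exact: measurable_funB.
have LS := L1_shift h LB.
have LD : 'L1 (fun z => c * `|W_ m (rV2_shift h z) - W_ m z|).
  by apply/L1Z/L1_norm/L1B => //; exact: L1_shift.
have W_b z : `|W_ m z| <= m.+1%:R.
  rewrite /W_ normrM indicE; have [|] := boolP (z \in A m).
    by rewrite inE normr1 mulr1 => /andP[].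
  by rewrite normr0 mulr0.
have ptw z : `|W (rV2_shift h z) - W z| `^ p <= K * (`|W (rV2_shift h z) - W_ m (rV2_shift h z)| `^ p +
    c * `|W_ m (rV2_shift h z) - W_ m z| + `|W z - W_ m z| `^ p).
  have -> : W (rV2_shift h z) - W z = (W (rV2_shift h z) - W_ m (rV2_shift h z)) +
     ((W_ m (rV2_shift h z) - W_ m z) + (W_ m z - W z)) by ring.
  rewrite (le_trans (powR_normD _ _ p0))// /K -mulrA ler_pM2l ?powR_gt0//.
  rewrite -[X in _ <= 2 `^ p * X]addrA [leRHS]mulrDr.
  have two1 : 1 <= 2 `^ p :> R by apply: (@le_trans _ _ (1 `^ p)); [rewrite powR1|apply: ge0_ler_powR; rewrite ?nnegrE; lra].
  apply: lerD; first by rewrite ler_peMl// powR_ge0.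
  rewrite (le_trans (powR_normD _ _ p0))// ler_pM2l ?powR_gt0//.
  apply: lerD; last by rewrite distrC.
  rewrite -mulr_powRB1// mulrC ler_wpM2r//.
  apply: ge0_ler_powR; [by lra|by rewrite nnegrE|by rewrite nnegrE addr_ge0|].
  by rewrite (le_trans (ler_normB _ _))// lerD.
have LK : 'L1 (fun z => K * (`|W (rV2_shift h z) - W_ m (rV2_shift h z)| `^ p +
    c * `|W_ m (rV2_shift h z) - W_ m z| + `|W z - W_ m z| `^ p)).
  by apply/L1Z/L1D => //; exact: L1D.
have L0 : 'L1 (fun z => `|W (rV2_shift h z) - W z| `^ p).
  apply: (le_L1 _ _ LK) => [|z]; first by apply: mpow; apply: measurable_funB => //; exact: mS.
  by rewrite ger0_norm ?powR_ge0.
split => //; apply: (le_trans (Rintegral_le L0 LK ptw)).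
rewrite RintegralZl//; last by apply: L1D => //; exact: L1D.
rewrite RintegralD//; last exact: L1D.
rewrite RintegralD// (Rintegral_shift h LB) RintegralZl//; last by apply/L1_norm/L1B => //; exact: L1_shift.
rewrite ler_pdivlMr// mulrC in h2.
rewrite -ler_pdivlMl//.
apply: (@le_trans _ _ (e / (3 * K) + e / (3 * K) + e / (3 * K))); first by rewrite !lerD.
rewrite le_eqVlt; apply/orP; left; apply/eqP; field; exact: lt0r_neq0.
Unshelve. all: by end_near. Qed.

End shift_continuity.

(** * Energy and Poincare inequality *)

Section euclidean_norm.
Context {R : realType} {n : nat}.
Implicit Types x : 'rV[R]_n.

Lemma enorm_ge0 x : 0 <= enorm x. Proof. exact: sqrtr_ge0. Qed.

Lemma norm_le_enorm x : `|x| <= enorm x.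
Proof.
apply: rV_norm_le => [|i]; first exact: enorm_ge0.
rewrite -sqrtr_sqr ler_sqrt; last by apply: sumr_ge0 => j _; exact: sqr_ge0.
by rewrite (bigD1 i)//= lerDl; apply: sumr_ge0 => j _; exact: sqr_ge0.
Qed.

Lemma enorm_le_norm x : enorm x <= n%:R * `|x|.
Proof.
have s0 : 0 <= n%:R * `|x| by rewrite mulr_ge0.
rewrite -(ger0_norm s0) -sqrtr_sqr ler_sqrt ?sqr_ge0//.
apply: (@le_trans _ _ (\sum_(i < n) `|x| ^+ 2)).
  by apply: ler_sum => i _; rewrite -[leLHS]real_normK ?num_real// lerXn2r ?nnegrE// rV_norm_coord.
rewrite sumr_const card_ord exprMn -[leLHS]mulr_natl ler_wpM2r ?sqr_ge0//.
by rewrite expr2 -natrM ler_nat; case: (n) => // m; rewrite leq_pmull.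
Qed.

Lemma measurable_enorm d (T : measurableType d) (f : T -> 'rV[R]_n) :
  (forall i, measurable_fun setT (fun z => f z 0 i)) ->
  measurable_fun setT (fun z => enorm (f z)).
Proof.
move=> mf; rewrite (_ : (fun z => _) = (fun z => (\sum_(i < n) f z 0 i ^+ 2) `^ 2^-1)); last first.
  by apply/funext => z; rewrite powR12_sqrt// sumr_ge0// => i _; exact: sqr_ge0.
apply: measurableT_comp (measurable_powR _) _.
by apply: measurable_sum => i; exact: measurable_funX.
Qed.

End euclidean_norm.

Section energy.
Context {R : realType} {n : nat} (p s : R).
Hypotheses (p1 : 1 < p) (s01 : 0 < s < 1).
Local Notation E := 'rV[R]_n.
Local Notation mu := (@lebesgue_rV R n).
Local Notation mu2 := (@lebesgue_rV2 R n).
Local Notation D := (@nonlocal_gradient R n p s).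
Implicit Types (u v w : E -> R) (z : E * E).

Let p0 : 0 < p. Proof. by apply: lt_trans p1. Qed.
Let s0 : 0 < s. Proof. by case/andP: s01. Qed.

Lemma measurable_gradient u : measurable_fun setT u -> measurable_fun setT (D u).
Proof.
move=> mu_; rewrite (_ : D u = (fun z : E * E => (u z.1 - u z.2) * enorm (z.1 - z.2) `^ (- (n%:R / p + s)))).
  apply: measurable_funM.
    apply: measurable_funB; first exact: measurableT_comp mu_ measurable_fst.
    exact: measurableT_comp mu_ measurable_snd.
  apply: measurableT_comp (measurable_powR _) _.
  apply: measurable_enorm => i.
  rewrite (_ : (fun z => _) = (fun z : E * E => rV_coord i z.1 - rV_coord i z.2)).
    apply: measurable_funB.
      exact: measurableT_comp (measurable_rV_coord i) measurable_fst.
    exact: measurableT_comp (measurable_rV_coord i) measurable_snd.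
  by apply/funext => z; rewrite !mxE.
by apply/funext => z; rewrite powRN.
Qed.

Lemma gradient_lin c u v : D (fun x => c * u x + v x) = (fun z => c * D u z + D v z).
Proof.
by apply/funext => z; rewrite /nonlocal_gradient mulrA -mulrDl; congr (_ / _); ring.
Qed.

Lemma gradientB u v : D (fun x => u x - v x) = (fun z => D u z - D v z).
Proof.
apply/funext => z; have := gradient_lin (-1) v u => /(congr1 (fun f => f z)).
rewrite mulN1r addrC => <-; congr (D _ z).
by apply/funext => x; rewrite mulN1r addrC.
Qed.

Let qp : (n%:R / p + s) * p = n%:R + s * p.
Proof. by rewrite mulrDl divfK// lt0r_neq0. Qed.

Let q_neq0 : n%:R / p + s != 0.
Proof. by apply: lt0r_neq0; rewrite ltr_wpDl// divr_ge0// ltW. Qed.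

Lemma gradient_powR u z :
  `|D u z| `^ p = `|u z.1 - u z.2| `^ p / enorm (z.1 - z.2) `^ (n%:R + s * p).
Proof.
rewrite /nonlocal_gradient normrM powRM// normfV; congr (_ * _).
rewrite ger0_norm ?powR_ge0// -(powRN _ (n%:R / p + s)) -powRrM.
by rewrite mulNr qp powRN.
Qed.

Lemma powR_gradient u z : enorm (z.1 - z.2) != 0 ->
  `|u z.1 - u z.2| `^ p = `|D u z| `^ p * enorm (z.1 - z.2) `^ (n%:R + s * p).
Proof.
by move=> e0; rewrite gradient_powR divfK// powR_eq0 negb_and e0.
Qed.

(** The kernel exponent n + s p is p times the exponent n / p + s of the gradient: p - 1 of these
    come from [Jp p (D u z)] and one from [D v z]. On the diagonal both sides are quotients by 0,
    which are 0. *)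
Lemma gradient_pairing u v z :
  `|u z.1 - u z.2| `^ (p - 2) * (u z.1 - u z.2) * (v z.1 - v z.2)
     / enorm (z.1 - z.2) `^ (n%:R + s * p) = Jp p (D u z) * D v z.
Proof.
rewrite /nonlocal_gradient; set e := enorm _; set q := n%:R / p + s.
have [e0|e0] := eqVneq e 0.
  have nsp : n%:R + s * p != 0 by rewrite -qp mulf_neq0 ?q_neq0 ?lt0r_neq0.
  by rewrite e0 (powR0 q_neq0) (powR0 nsp) invr0 !mulr0.
have eq0 : 0 <= e `^ (- q) by exact: powR_ge0.
rewrite -!powRN JpM (JpE eq0)// -/(Jp p (u z.1 - u z.2)).
rewrite [RHS](_ : _ = Jp p (u z.1 - u z.2) * (v z.1 - v z.2) *
  (e `^ (- q) * e `^ (- q) `^ (p - 1))); last by rewrite powRN; ring.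
by rewrite mulr_powRB1// -powRrM mulNr qp powRN.
Qed.

Definition energy u : R := \int[mu2]_z (`|D u z| `^ p).

Lemma WspP u : Wsp p s u <-> [/\ measurable_fun setT u,
  mu.-integrable setT (EFin \o (fun x => `|u x| `^ p)) &
  mu2.-integrable setT (EFin \o (fun z => `|D u z| `^ p))].
Proof.
split=> [[/(LfunP _ _ p0)[m1 i1] /(LfunP _ _ p0)[_ i2]]|[m1 i1 i2]]; first by split.
split; apply/(LfunP _ _ p0); split => //; exact: measurable_gradient.
Qed.

Lemma L1_powR_lin d (T : measurableType d) (m : {measure set T -> \bar R}) c (f g : T -> R) :
  measurable_fun setT f -> measurable_fun setT g ->
  m.-integrable setT (EFin \o (fun x => `|f x| `^ p)) ->
  m.-integrable setT (EFin \o (fun x => `|g x| `^ p)) ->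
  m.-integrable setT (EFin \o (fun x => `|c * f x + g x| `^ p)).
Proof.
move=> mf mg lf lg.
apply: (@le_L1 _ _ _ _ _ (fun x => 2 `^ p * (`|c| `^ p * `|f x| `^ p + `|g x| `^ p))).
- apply: measurableT_comp (measurable_powR _) _; apply: measurableT_comp => //.
  by apply: measurable_funD => //; exact: measurable_funM.
- move=> x; rewrite ger0_norm ?powR_ge0// (le_trans (powR_normD _ _ p0))//.
  by rewrite normrM powRM.
- by apply/L1Z/L1D => //; exact: L1Z.
Qed.

Lemma Wsp_lin c u v : Wsp p s u -> Wsp p s v -> Wsp p s (fun x => c * u x + v x).
Proof.
move=> /WspP[m1 i1 j1] /WspP[m2 i2 j2]; apply/WspP; split.
- by apply: measurable_funD => //; exact: measurable_funM.
- exact: L1_powR_lin.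
- by rewrite gradient_lin; apply: L1_powR_lin => //; exact: measurable_gradient.
Qed.

Variable Omega : set E.

Lemma W0sp_lin c u v : W0sp p s Omega u -> W0sp p s Omega v ->
  W0sp p s Omega (fun x => c * u x + v x).
Proof.
move=> [w1 z1] [w2 z2]; split; first exact: Wsp_lin.
apply: filterS2 z1 z2 => x h1 h2 nx.
by rewrite h1// h2// mulr0 addr0.
Qed.

Lemma W0spB u v : W0sp p s Omega u -> W0sp p s Omega v ->
  W0sp p s Omega (fun x => u x - v x).
Proof.
move=> Wu Wv; have := W0sp_lin (-1) Wv Wu; congr (W0sp p s Omega).
by apply/funext => x; rewrite mulN1r addrC.
Qed.

Lemma ae_rV2 (P : E -> Prop) : {ae mu, forall x, P x} -> {ae mu2, forall z, P z.1 /\ P z.2}.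
Proof.
move=> [N [mN N0 PN]]; exists (N `*` setT `|` setT `*` N); split.
- by apply: measurableU; exact: measurableX.
- apply: null_set_setU; [exact: measurableX|exact: measurableX| |].
    by rewrite /= product_measure1E//; rewrite [X in (X * _)%E]N0 mul0e.
  by rewrite /= product_measure1E//; rewrite [X in (_ * X)%E]N0 mule0.
- move=> z /= /not_andP[nP|nP]; [left|right]; split => //; exact: PN.
Qed.

End energy.

Section poincare.
Context {R : realType} {n : nat} (p s : R).
Hypotheses (p1 : 1 < p) (s01 : 0 < s < 1) (n1 : (1 <= n)%N).
Local Notation E := 'rV[R]_n.
Local Notation mu := (@lebesgue_rV R n).
Local Notation mu2 := (@lebesgue_rV2 R n).
Local Notation D := (@nonlocal_gradient R n p s).
Implicit Types (u v w : E -> R) (z : E * E).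
Variable Omega : set E.
Hypothesis bOmega : bounded_set Omega.

Let p0 : 0 < p. Proof. by apply: lt_trans p1. Qed.
Let s0 : 0 < s. Proof. by case/andP: s01. Qed.

Lemma bounded_set_ex : exists2 M : R, 0 < M & forall x, Omega x -> `|x| <= M.
Proof.
have [M [_ HM]] := bOmega; exists (`|M| + 1) => [|x Ox]; first by rewrite ltr_wpDl.
by apply: HM Ox; rewrite (le_lt_trans (ler_norm _))// ltrDl.
Qed.

Lemma tonelli_tensor (f g : E -> R) : measurable_fun setT f -> measurable_fun setT g ->
  (forall x, 0 <= f x) -> (forall x, 0 <= g x) ->
  (\int[mu2]_z (f z.1 * g z.2)%:E = \int[mu]_x (f x)%:E * \int[mu]_x (g x)%:E)%E.
Proof.
move=> mf mg f0 g0.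
have mfg : measurable_fun setT (fun z : E * E => (f z.1 * g z.2)%:E).
  apply/measurable_EFinP; apply: measurable_funM.
    exact: measurableT_comp mf measurable_fst.
  exact: measurableT_comp mg measurable_snd.
have fg0 z : (0 <= (f z.1 * g z.2)%:E)%E by rewrite lee_fin mulr_ge0.
have := @fubini_tonelli1 _ _ _ _ _ mu mu _ mfg fg0 => ->.
rewrite /fubini_F /=.
under eq_integral => x _.
  under eq_integral do rewrite EFinM.
  rewrite ge0_integralZl ?lee_fin//; first over.
  - exact/measurable_EFinP.
  - by move=> y _; rewrite lee_fin.
rewrite ge0_integralZr//.
- exact/measurable_EFinP.
- by move=> x _; rewrite lee_fin.
- by apply: integral_ge0 => x _; rewrite lee_fin.
Qed.

(** The unit cube [B] lies at distance at least 1 from [Omega], so u vanishes almost everywhere on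
    it. For x in [Omega] and y in [B] the value u x is thus the difference u x - u y, which the
    gradient controls; integrating over y costs nothing because [B] has measure 1. *)
Lemma poincare : exists2 C : R, 0 <= C &
  forall u, W0sp p s Omega u -> \int[mu]_x `|u x| `^ p <= C * energy p s u.
Proof.
have [M M0 OM] := bounded_set_ex.
pose i0 := Ordinal n1.
pose B : set E := [set x | forall i, M + 1 < x 0 i < M + 2].
have mB : measurable B.
  have := @measurable_rV_box R n (fun i => `]M + 1, M + 2[%classic) (fun i => measurable_itv _).
  by congr measurable; apply/seteqP; split => x /= H i; have := H i; rewrite /= in_itv.
have muB : mu B = 1%E.
  rewrite /B (lebesgue_rV_itv_box (fun=> M + 1) (fun=> M + 2)) big1// => i _.
  rewrite lebesgue_measure_itv/= lte_fin ltrD2l ltr1n -EFinB; congr EFin; ring.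
(* This bounds the Euclidean distance from a point of [Omega] to a point of [B], raised to the
   exponent of the kernel; the factor n compares the Euclidean norm with the sup norm. *)
pose C := (n%:R * (M + M + 2)) `^ (n%:R + s * p).
have q0 : 0 <= n%:R + s * p by rewrite addr_ge0// mulr_ge0// ltW.
exists C; first exact: powR_ge0.
move=> u [/(WspP s p1) [mu_ Lu LD] u0].
pose F z := `|u z.1| `^ p * \1_B z.2.
have mup : measurable_fun setT (fun x => `|u x| `^ p) := L1_measurable Lu.
have mF : measurable_fun setT F.
  apply: measurable_funM; first exact: measurableT_comp mup measurable_fst.
  exact: measurableT_comp (measurable_indic mB) measurable_snd.
have F0 z : 0 <= F z by rewrite mulr_ge0 ?powR_ge0.
have FD : {ae mu2, forall z, `|F z| <= C * `|D u z| `^ p}.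
  apply: filterS (ae_rV2 u0) => z [z1 z2]; rewrite ger0_norm// /F indicE.
  have [|] := boolP (z.2 \in B); last first.
    by rewrite mulr0 mulr_ge0 ?powR_ge0.
  rewrite inE mulr1 => Bz.
  have [Oz|nOz] := pselect (Omega z.1); last first.
    by rewrite z1// normr0 powR0 ?lt0r_neq0// mulr_ge0 ?powR_ge0.
  have M1 := OM _ Oz.
  have u20 : u z.2 = 0.
    apply: z2 => /OM; have := Bz i0; have := rV_norm_coord z.2 i0.
    by have := ler_norm (z.2 0 i0); lra.
  have d1 : 1 <= `|z.1 - z.2|.
    have := Bz i0; have := rV_norm_coord z.1 i0; have := rV_norm_coord (z.1 - z.2) i0.
    rewrite !mxE; have := ler_norm (z.1 0 i0); have := ler_norm (- (z.1 0 i0 - z.2 0 i0)).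
    by rewrite normrN; lra.
  have e1 : 1 <= enorm (z.1 - z.2) := le_trans d1 (norm_le_enorm _).
  have := @powR_gradient _ _ p s p1 u z; rewrite u20 subr0 => ->; last first.
    by apply: lt0r_neq0; apply: lt_le_trans e1.
  rewrite mulrC ler_wpM2r ?powR_ge0//; apply: ge0_ler_powR => //.
  - by rewrite nnegrE enorm_ge0.
  - by rewrite nnegrE mulr_ge0// !addr_ge0// ltW.
  - apply: le_trans (enorm_le_norm _) _; rewrite ler_wpM2l//.
    rewrite (le_trans (ler_normB _ _))//.
    have : `|z.2| <= M + 2.
      apply: rV_norm_le => [|i]; first by lra.
      by have := Bz i; rewrite ler_norml; lra.
    by lra.
have LCD : mu2.-integrable setT (EFin \o (fun z => C * `|D u z| `^ p)) by exact: L1Z.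
have LF : mu2.-integrable setT (EFin \o F) by exact: (le_L1_ae mF FD).
have -> : \int[mu]_x `|u x| `^ p = \int[mu2]_z F z.
  rewrite /Rintegral; congr fine.
  have -> := @tonelli_tensor (fun x => `|u x| `^ p) \1_B mup (measurable_indic mB) _ _.
  - by rewrite integral_indic// setIT [X in (_ * X)%E]muB mule1.
  - by move=> x; exact: powR_ge0.
  - by [].
rewrite /energy -RintegralZl//.
apply: Rintegral_le_ae => //; apply: filterS FD => z.
by rewrite ger0_norm.
Qed.

Lemma Wsp_normE u : Wsp p s u -> Wsp_norm p s u =
  ((\int[mu]_x `|u x| `^ p + energy p s u) `^ p^-1)%:E.
Proof.
move=> /(WspP s p1) [mu_ Lu LD]; rewrite /Wsp_norm.
rewrite !poweR_Lnorm ?lt0r_neq0//.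
rewrite /= -(Rintegral_EFin Lu).
by rewrite -[X in (_ + X)%E](Rintegral_EFin LD).
Qed.

Lemma energy_ge0 u : 0 <= energy p s u.
Proof. by apply: Rintegral_ge0 => z _; exact: powR_ge0. Qed.

(** The Poincare inequality absorbs the L^p part of the norm. Bounds on functionals are stated from
    here on with p-th powers, which makes them linear in the energy. *)
Lemma dual_energy_bound F : dual_W0sp p s Omega F -> exists2 C : R, 0 <= C &
  forall u, W0sp p s Omega u -> `|F u| `^ p <= C * energy p s u.
Proof.
move=> [_ [C HC]]; have [K K0 HK] := poincare.
exists (`|C| `^ p * (K + 1)); first by rewrite mulr_ge0 ?powR_ge0// addr_ge0.
move=> u Wu; have := HC u Wu; rewrite Wsp_normE; last by case: Wu.
rewrite -EFinM lee_fin => Fu.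
have S0 : 0 <= \int[mu]_x `|u x| `^ p + energy p s u.
  by rewrite addr_ge0 ?energy_ge0// Rintegral_ge0// => x _; exact: powR_ge0.
have : `|F u| <= `|C| * (\int[mu]_x `|u x| `^ p + energy p s u) `^ p^-1.
  by rewrite (le_trans Fu)// ler_wpM2r ?powR_ge0// ler_norm.
move=> /(ge0_ler_powR (ltW p0)); rewrite !nnegrE => /(_ (normr_ge0 _) (mulr_ge0 (normr_ge0 _) (powR_ge0 _ _))).
rewrite powRM ?powR_ge0// -powRrM mulVf ?lt0r_neq0// powRr1// => /le_trans; apply.
by rewrite -mulrA ler_wpM2l ?powR_ge0// mulrDl mul1r lerD2r HK.
Qed.

End poincare.

(** * Compactness of bounded sets of the energy space *)

(** For t > eta, the factor (t / eta)^(p - 1) exceeds 1. This trades a first power for an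
    arbitrarily small constant and a p-th power. *)
Lemma le_addr_powR {R : realType} (p eta t : R) : 1 < p -> 0 < eta -> 0 <= t ->
  t <= eta + eta `^ (1 - p) * t `^ p.
Proof.
move=> p1 e0 t0; have [te|et] := leP t eta.
  by rewrite -[leLHS]addr0 lerD// mulr_ge0 ?powR_ge0.
rewrite -[leLHS]add0r lerD//; first exact: ltW.
have tp : 0 < t by apply: lt_trans et.
rewrite -[X in _ <= _ * X]mulr_powRB1//; last by lra.
rewrite mulrCA ler_peMr// -opprB powRN.
rewrite mulrC ler_pdivlMr ?powR_gt0// mul1r.
by apply: ge0_ler_powR; rewrite ?nnegrE; lra.
Qed.

Section grid.
Context {R : realType} {n : nat}.
Local Notation E := 'rV[R]_n.
Local Notation mu := (@lebesgue_rV R n).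
Implicit Types x y : E.
Variables (r : R) (L : nat).
Hypotheses (r0 : 0 < r) (L0 : (0 < L)%N).

Definition grid_step : R := (r + r) / L%:R.

(** The sides are half-open, so that the cells partition the half-open cube. *)
Definition grid_cell (j : {ffun 'I_n -> 'I_L}) : set E :=
  [set x | forall i, (j i)%:R * grid_step - r <= x 0 i < (j i).+1%:R * grid_step - r].

Let d0 : 0 < grid_step. Proof. by rewrite divr_gt0 ?addr_gt0 ?ltr0n. Qed.

Lemma grid_cellE j : grid_cell j = [set x : E | forall i,
  `[(j i)%:R * grid_step - r, (j i).+1%:R * grid_step - r[%classic (x 0 i)].
Proof. by apply/seteqP; split => x /= H i; have := H i; rewrite /= in_itv. Qed.

Lemma measurable_grid_cell j : measurable (grid_cell j).
Proof. by rewrite grid_cellE; exact: measurable_rV_box (fun i => measurable_itv _). Qed.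

Lemma lebesgue_grid_cell j : mu (grid_cell j) = (grid_step ^+ n)%:E.
Proof.
rewrite grid_cellE; etransitivity.
  exact: (@lebesgue_rV_box R n (fun i => `[(j i)%:R * grid_step - r, (j i).+1%:R * grid_step - r[%classic)
    (fun i => measurable_itv _)).
rewrite (eq_bigr (fun=> grid_step%:E)).
  by rewrite prodEFin prodr_const card_ord.
move=> i _; rewrite lebesgue_measure_itv/= lte_fin ltrD2r ltr_pM2r// ltr_nat ltnSn.
by rewrite -EFinB; congr EFin; rewrite -natr1; ring.
Qed.

Lemma grid_cell_diam j x y : grid_cell j x -> grid_cell j y -> `|x - y| <= grid_step.
Proof.
move=> Hx Hy; apply: rV_norm_le => [|i]; first exact: ltW.
have := Hx i; have := Hy i; rewrite !mxE ler_norml -natr1 mulrDl mul1r.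
move=> /andP[h1 h2] /andP[h3 h4]; apply/andP; split; lra.
Qed.

Lemma grid_cell_cover x : (forall i, - r <= x 0 i < r) -> exists j, grid_cell j x.
Proof.
move=> xr; pose t i := (x 0 i + r) / grid_step.
have t0 i : 0 <= t i by rewrite divr_ge0 ?(ltW d0)//; have /andP[] := xr i; lra.
have tL i : (Num.truncn (t i) < L)%N.
  rewrite truncn_lt_nat//; rewrite /t ltr_pdivrMr// /grid_step mulrC divfK; last by rewrite pnatr_eq0 -lt0n.
  by have /andP[] := xr i; lra.
exists [ffun i => Ordinal (tL i)] => i; rewrite ffunE /=.
have /andP[h1 h2] := truncn_itv (t0 i).
by rewrite lerBlDr -ler_pdivlMr// h1 /= ltrBrDr -ltr_pdivrMr.
Qed.

Lemma grid_cell_inj x i j : grid_cell i x -> grid_cell j x -> i = j.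
Proof.
move=> Hi Hj; apply/ffunP => k; apply: val_inj => /=.
have /andP[a1 a2] := Hi k; have /andP[b1 b2] := Hj k.
have h1 : ((i k)%:R * grid_step < (j k).+1%:R * grid_step) by lra.
have h2 : ((j k)%:R * grid_step < (i k).+1%:R * grid_step) by lra.
move: h1 h2; rewrite !ltr_pM2r// !ltr_nat !ltnS => h1 h2.
by apply/eqP; rewrite eqn_leq h1.
Qed.

Lemma sum_grid_cell (c : {ffun 'I_n -> 'I_L} -> R) x j : grid_cell j x ->
  \sum_i c i * \1_(grid_cell i) x = c j.
Proof.
move=> jx; rewrite (bigD1 j)//= big1 ?addr0.
  by rewrite indicE mem_set// mulr1.
move=> i ij; rewrite indicE memNset ?mulr0// => ix.
by move/eqP: ij; apply; exact: grid_cell_inj ix jx.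
Qed.

End grid.

Section step_approximation.
Context {R : realType} {n : nat} (p s : R).
Hypotheses (p1 : 1 < p) (s01 : 0 < s < 1).
Local Notation E := 'rV[R]_n.
Local Notation mu := (@lebesgue_rV R n).
Local Notation mu2 := (@lebesgue_rV2 R n).
Local Notation D := (@nonlocal_gradient R n p s).

Let p0 : 0 < p. Proof. by apply: lt_trans p1. Qed.
Let s0 : 0 < s. Proof. by case/andP: s01. Qed.

(* Total boundedness in [L^1] of bounded cubes of a ball of [W^{s,p}]: the step
   function takes the mean value of [w] on each cell of a fine grid. *)
Lemma step_approx (r M e : R) : 0 < r -> 0 <= M -> 0 < e ->
  exists (J : finType) (A : J -> set E) (B : R),
    (forall j, measurable (A j)) /\
  forall w, Wsp p s w -> \int[mu]_x `|w x| `^ p <= M -> energy p s w <= M ->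
  exists m : J -> R, (forall j, `|m j| <= B) /\
    (\int[mu]_x (\1_[set y : E | forall i, - r <= y 0 i < r] x *
       `|w x - \sum_j m j * \1_(A j) x|)%:E <= e%:E)%E.
Proof.
move=> r0 M0 e0.
(* Over the whole cube, of measure (r + r)^n, an error [eta] amounts to e / 2. The other half of [e]
   is left for the energy term [K] d^(s p), where d is the step of the grid; [L] is chosen to make
   it small. *)
pose eta := e / 2 / ((r + r) ^+ n).
have rr0 : 0 < (r + r) ^+ n by rewrite exprn_gt0// addr_gt0.
have eta0 : 0 < eta by rewrite !divr_gt0.
pose K := eta `^ (1 - p) * n%:R `^ (n%:R + s * p) * M.
have K0 : 0 <= K by rewrite !mulr_ge0 ?powR_ge0.
have sp0 : 0 < s * p by rewrite mulr_gt0.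
have [L L0 HL] : exists2 L : nat, (0 < L)%N & K * (@grid_step R r L) `^ (s * p) <= e / 2.
  pose t := (e / 2 / (K + 1)) `^ (s * p)^-1.
  have K1 : 0 < K + 1 by rewrite ltr_wpDl.
  have t0 : 0 < t by rewrite powR_gt0// !divr_gt0.
  have rt0 : 0 <= (r + r) / t by rewrite divr_ge0 ?addr_ge0// ltW.
  have bt := archi_boundP rt0.
  exists (Num.bound ((r + r) / t)); first by rewrite -(ltr0n R) (le_lt_trans rt0).
  have L0 : 0 < (Num.bound ((r + r) / t))%:R :> R by rewrite (le_lt_trans rt0).
  apply: (@le_trans _ _ (K * t `^ (s * p))).
    rewrite ler_wpM2l//; apply: ge0_ler_powR; rewrite ?nnegrE.
    - exact: ltW.
    - by rewrite divr_ge0 ?addr_ge0// ltW.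
    - exact: ltW.
    - by rewrite ler_pdivrMr// mulrC -ler_pdivrMr// ltW.
  rewrite /t -powRrM mulVf ?lt0r_neq0// powRr1; last by rewrite !divr_ge0// ltW.
  rewrite mulrCA -[leRHS]mulr1 ler_wpM2l ?divr_ge0 ?(ltW e0)//.
  by rewrite ler_pdivrMr// mul1r lerDl.
pose d := @grid_step R r L.
have d0 : 0 < d by rewrite divr_gt0 ?addr_gt0 ?ltr0n.
pose A := @grid_cell R n r L.
have mA j : measurable (A j) by exact: measurable_grid_cell.
have muA j : mu (A j) = (d ^+ n)%:E by exact: lebesgue_grid_cell.
have mAoo j : (mu (A j) < +oo)%E by rewrite [X in (X < _)%E]muA ltry.
pose v := d ^+ n; have v0 : 0 < v by exact: exprn_gt0.
have LA j : mu.-integrable setT (EFin \o (\1_(A j) : E -> R)) by apply: L1_indic; [exact: mA|exact: mAoo].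
have iA j : \int[mu]_x (\1_(A j) x : R) = v.
  by rewrite /Rintegral integral_indic// setIT; exact: (congr1 fine (muA j)).
(* The mean over a cell of volume [v] is bounded through the inequality t <= 1 + t^p for nonnegative
   t. *)
exists {ffun 'I_n -> 'I_L}, A, (v^-1 * (v + M)); split => // w /(WspP s p1)[mw Lw LD] wM DM.
have Lwj j : mu.-integrable setT (EFin \o (fun x => \1_(A j) x * w x)).
  apply: (@le_L1 _ _ _ _ _ (fun x => \1_(A j) x + `|w x| `^ p)); last exact: L1D.
    by apply: measurable_funM => //; exact: measurable_indic.
  move=> x; rewrite normrM indicE; case: (_ \in _); last by rewrite normr0 mul0r add0r powR_ge0.
  rewrite normr1 mul1r; have := le_addr_powR p1 ltr01 (normr_ge0 (w x)).
  by rewrite powR1 mul1r.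
pose m j := v^-1 * \int[mu]_x (\1_(A j) x * w x).
exists m; split.
  move=> j; rewrite /m normrM gtr0_norm ?invr_gt0// ler_wpM2l ?invr_ge0 ?(ltW v0)//.
  apply: (@le_trans _ _ (\int[mu]_x (\1_(A j) x + `|w x| `^ p))).
    apply: Rintegral_norm_le => //; first exact: L1D.
    move=> x; rewrite normrM indicE; case: (_ \in _); last by rewrite normr0 mul0r add0r powR_ge0.
    rewrite normr1 mul1r; have := le_addr_powR p1 ltr01 (normr_ge0 (w x)).
    by rewrite powR1 mul1r.
  by rewrite RintegralD// iA lerD2l.
pose H (z : E * E) := \sum_j \1_(A j) z.1 * (\1_(A j) z.2 * `|w z.1 - w z.2|).
have mw12 : measurable_fun setT (fun z : E * E => `|w z.1 - w z.2|).
  apply: measurableT_comp => //; apply: measurable_funB.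
    exact: measurableT_comp mw measurable_fst.
  exact: measurableT_comp mw measurable_snd.
have mi1 j : measurable_fun setT (fun z : E * E => \1_(A j) z.1 : R).
  exact: measurableT_comp (measurable_indic (mA j)) measurable_fst.
have mi2 j : measurable_fun setT (fun z : E * E => \1_(A j) z.2 : R).
  exact: measurableT_comp (measurable_indic (mA j)) measurable_snd.
have mH : measurable_fun setT H.
  by apply: measurable_sum => j; do 2!apply: measurable_funM => //.
have H0 z : 0 <= H z by apply: sumr_ge0 => j _; rewrite !mulr_ge0.
have sumE (f : {ffun 'I_n -> 'I_L} -> R) x j : A j x -> \sum_i \1_(A i) x * f i = f j.
  by move=> Ajx; rewrite -(sum_grid_cell r0 L0 f Ajx); apply: eq_bigr => i _; rewrite mulrC.
have HE x y j : A j x -> H (x, y) = \1_(A j) y * `|w x - w y|.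
  by move=> Ajx; rewrite /H (sumE (fun i => \1_(A i) y * `|w x - w y|) _ _ Ajx).
(* the deviation from the mean on a cell is the mean of the differences *)
have key x : ((\1_[set y : E | forall i, (- r <= y 0 i < r)%R] x * `|w x - \sum_j m j * \1_(A j) x|)%:E
    <= (v^-1)%:E * \int[mu]_y (H (x, y))%:E)%E.
  rewrite indicE; have [|_] := boolP (x \in _); last first.
    by rewrite mul0r mule_ge0 ?lee_fin ?invr_ge0 ?(ltW v0)// integral_ge0// => y _; rewrite lee_fin.
  rewrite inE /= mul1r => /(grid_cell_cover r0 L0)[j Ajx].
  rewrite (sum_grid_cell r0 L0 _ Ajx).
  under eq_integral do rewrite (HE _ _ j)//.
  have Lj : mu.-integrable setT (EFin \o (fun y => \1_(A j) y * (w x - w y))).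
    under eq_fun do rewrite mulrBr; apply: L1B => //.
    by under eq_fun do rewrite mulrC; exact: L1Z.
  have Ljn : mu.-integrable setT (EFin \o (fun y => \1_(A j) y * `|w x - w y|)).
    have := L1_norm Lj; congr (_.-integrable _ _); apply/funext => y /=.
    by rewrite normrM [X in (X * _)%:E]ger0_norm.
  rewrite -(Rintegral_EFin Ljn) -EFinM lee_fin.
  have -> : w x - m j = v^-1 * \int[mu]_y (\1_(A j) y * (w x - w y)).
    under eq_Rintegral do rewrite mulrBr.
    rewrite RintegralB//; last by under eq_fun do rewrite mulrC; exact: L1Z.
    rewrite RintegralZr// iA mulrBr mulrA mulVf ?mul1r//.
    exact: lt0r_neq0.
  rewrite normrM gtr0_norm ?invr_gt0// ler_wpM2l ?invr_ge0 ?(ltW v0)//.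
  by apply: Rintegral_norm_le => // y; rewrite normrM ger0_norm.
(* For two points of a common cell [le_addr_powR] bounds the difference by [eta] plus a multiple of
   its p-th power, and the kernel distance is at most n d. Outside of common cells [H] is zero and
   the last term is only added. *)
pose H' z := \sum_j eta * (\1_(A j) z.1 * \1_(A j) z.2) +
  eta `^ (1 - p) * (n%:R * d) `^ (n%:R + s * p) * `|D w z| `^ p.
have q0 : 0 <= n%:R + s * p by rewrite addr_ge0// ltW.
have HH' z : H z <= H' z.
  rewrite /H /H'; have tail0 : 0 <= eta `^ (1 - p) * (n%:R * d) `^ (n%:R + s * p) * `|D w z| `^ p.
    by rewrite !mulr_ge0 ?powR_ge0.
  have [[j Ajz]|nz] := pselect (exists j, A j z.1); last first.
    rewrite big1; last first.
      by move=> j _; rewrite indicE memNset ?mul0r// => Aj; apply: nz; exists j.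
    by rewrite addr_ge0//; apply: sumr_ge0 => j _; apply: mulr_ge0; [exact: ltW|exact: mulr_ge0].
  rewrite (sumE (fun i => \1_(A i) z.2 * `|w z.1 - w z.2|) _ _ Ajz).
  rewrite (eq_bigr (fun i => \1_(A i) z.1 * (eta * \1_(A i) z.2))); last by move=> i _; ring.
  rewrite (sumE (fun i => eta * \1_(A i) z.2) _ _ Ajz) indicE.
  have [|_] := boolP (z.2 \in A j); last by rewrite mul0r mulr0 add0r.
  rewrite inE mul1r mulr1 => Ajz2.
  apply: (le_trans (le_addr_powR p1 eta0 (normr_ge0 _))).
  rewrite lerD2l -mulrA ler_wpM2l ?powR_ge0//.
  have [ez|ez] := eqVneq (enorm (z.1 - z.2)) 0.
    have /eqP : `|z.1 - z.2| = 0.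
      by apply/eqP; rewrite eq_le normr_ge0 andbT -ez norm_le_enorm.
    rewrite normr_eq0 subr_eq0 => /eqP ->; rewrite subrr normr0 powR0 ?lt0r_neq0//.
    by rewrite mulr_ge0 ?powR_ge0.
  rewrite (powR_gradient s p1 w ez) mulrC ler_wpM2r ?powR_ge0//.
  apply: ge0_ler_powR; [exact: q0|by rewrite nnegrE enorm_ge0|by rewrite nnegrE mulr_ge0//; exact: ltW|].
  apply: le_trans (enorm_le_norm _) _; rewrite ler_wpM2l//.
  exact: grid_cell_diam Ajz Ajz2.
have LH1 j : mu2.-integrable setT (EFin \o (fun z => eta * (\1_(A j) z.1 * \1_(A j) z.2))) /\
    \int[mu2]_z (eta * (\1_(A j) z.1 * \1_(A j) z.2)) = eta * (v * v).
  have iE : (\int[mu2]_z (\1_(A j) z.1 * \1_(A j) z.2)%:E = (v * v)%:E)%E.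
    have -> := @tonelli_tensor R n \1_(A j) \1_(A j) (measurable_indic (mA j)) (measurable_indic (mA j)) _ _ => //.
    by rewrite integral_indic// setIT EFinM; congr (_ * _)%E; exact: muA.
  have Lp : mu2.-integrable setT (EFin \o (fun z : E * E => \1_(A j) z.1 * \1_(A j) z.2 : R)).
    apply: L1_fin_norm; first exact: measurable_funM.
    under eq_integral do rewrite ger0_norm ?mulr_ge0//.
    by rewrite iE ltry.
  split; first exact: L1Z.
  by rewrite RintegralZl//; congr (_ * _); rewrite /Rintegral iE.
have LH : mu2.-integrable setT (EFin \o H') /\ \int[mu2]_z H' z =
    (L ^ n)%:R * (eta * (v * v)) + eta `^ (1 - p) * (n%:R * d) `^ (n%:R + s * p) * energy p s w.
  have sL (t : seq {ffun 'I_n -> 'I_L}) :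
      mu2.-integrable setT (EFin \o (fun z => \sum_(j <- t) eta * (\1_(A j) z.1 * \1_(A j) z.2))) /\
      \int[mu2]_z (\sum_(j <- t) eta * (\1_(A j) z.1 * \1_(A j) z.2)) = (size t)%:R * (eta * (v * v)).
    elim: t => [|j t [IH1 IH2]].
      rewrite (_ : (fun z => \sum_(j <- [::]) _) = (fun=> 0)); last by apply/funext => z; rewrite big_nil.
      by rewrite Rintegral0 mul0r; split => //; exact: L1_0.
    rewrite (_ : (fun z => \sum_(j <- j :: t) _) = (fun z => eta * (\1_(A j) z.1 * \1_(A j) z.2) +
      \sum_(j <- t) eta * (\1_(A j) z.1 * \1_(A j) z.2))); last by apply/funext => z; rewrite big_cons.
    have [l1 l2] := LH1 j; rewrite RintegralD// l2 IH2; split; first exact: L1D.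
    by rewrite /= -natr1; ring.
  have [l1 l2] := sL (index_enum {ffun 'I_n -> 'I_L}).
  split; first by apply: L1D => //; exact: L1Z.
  rewrite RintegralD//; last exact: L1Z.
  rewrite RintegralZl// l2; congr (_%:R * _ + _).
  by rewrite [index_enum _]unlock -enumT -cardT card_ffun !card_ord.
have mEH : measurable_fun setT (fun z => (H z)%:E) by exact/measurable_EFinP.
have EH0 z : (0 <= (H z)%:E)%E by rewrite lee_fin.
have mF : measurable_fun setT (fun x => \int[mu]_y (H (x, y))%:E)%E.
  exact: (@measurable_fun_fubini_tonelli_F _ _ _ _ _ mu (fun z => (H z)%:E)).
have F0 x : (0 <= \int[mu]_y (H (x, y))%:E)%E by apply: integral_ge0 => y _; rewrite lee_fin.
have mQ : measurable [set y : E | forall i, - r <= y 0 i < r].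
  have := @measurable_rV_box R n (fun i => `[- r, r[%classic) (fun i => measurable_itv _).
  by congr measurable; apply/seteqP; split => x /= Hx i; have := Hx i; rewrite /= in_itv.
apply: (@le_trans _ _ (\int[mu]_x ((v^-1)%:E * \int[mu]_y (H (x, y))%:E))%E).
  apply: ge0_le_integral => //.
  - apply/measurable_EFinP; apply: measurable_funM; first exact: measurable_indic.
    apply: measurableT_comp => //; apply: measurable_funB => //.
    by apply: measurable_sum => j; apply: measurable_funM => //; exact: measurable_indic.
  - by apply: measurable_funeM.
rewrite ge0_integralZl//; last by rewrite lee_fin invr_ge0 ltW.
have -> : (\int[mu]_x \int[mu]_y (H (x, y))%:E = \int[mu2]_z (H z)%:E)%E.
  by apply/esym; apply: (@fubini_tonelli1 _ _ _ _ _ mu mu (fun z => (H z)%:E)) => // z; rewrite lee_fin.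
have [LH'1 LH'2] := LH.
have LHH : mu2.-integrable setT (EFin \o H) by apply: (le_L1 mH _ LH'1) => z; rewrite ger0_norm.
rewrite -(Rintegral_EFin LHH) -EFinM lee_fin.
apply: (@le_trans _ _ (v^-1 * \int[mu2]_z H' z)).
  by rewrite ler_wpM2l ?invr_ge0 ?(ltW v0)//; exact: Rintegral_le.
rewrite LH'2 mulrDr [leRHS](splitr e); apply: lerD.
  rewrite le_eqVlt; apply/orP; left; apply/eqP.
  have Ld : L%:R * d = r + r by rewrite mulrC divfK// pnatr_eq0 -lt0n.
  rewrite /eta -Ld exprMn -natrX; rewrite -/v; field.
  rewrite !lt0r_neq0 ?ltr0n ?expn_gt0 ?L0//.
apply: le_trans HL; rewrite -/d.
have -> : (n%:R * d) `^ (n%:R + s * p) = n%:R `^ (n%:R + s * p) * (v * d `^ (s * p)).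
  rewrite powRM// ?ltW// [d `^ (_ + _)]powRD; last by rewrite (lt0r_neq0 d0) implybT.
  by rewrite powR_mulrn// ltW.
rewrite [leLHS](_ : _ = eta `^ (1 - p) * n%:R `^ (n%:R + s * p) * energy p s w * d `^ (s * p)).
  rewrite /K ler_wpM2r ?powR_ge0// ler_wpM2l//.
  by rewrite mulr_ge0 ?powR_ge0.
by field; exact: lt0r_neq0.
Qed.

End step_approximation.

(** * Pairing weak-* null coefficients with functions of bounded energy *)

Section weak_pairing.
Context {R : realType} {n : nat} (p s : R).
Hypotheses (p1 : 1 < p) (s01 : 0 < s < 1).
Local Notation E := 'rV[R]_n.
Local Notation mu := (@lebesgue_rV R n).
Local Notation mu2 := (@lebesgue_rV2 R n).
Local Notation "'L1 f" := (mu2.-integrable [set: (E * E)%type] (EFin \o f)) (at level 10, f at next level).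


Lemma L1_tensor (f g : E -> R) : mu.-integrable setT (EFin \o f) ->
  mu.-integrable setT (EFin \o g) -> 'L1 (fun z => f z.1 * g z.2).
Proof.
move=> lf lg; have mf := L1_measurable lf; have mg := L1_measurable lg.
apply: L1_fin_norm.
  apply: measurable_funM; first exact: measurableT_comp mf measurable_fst.
  exact: measurableT_comp mg measurable_snd.
under eq_integral do rewrite normrM.
rewrite (@tonelli_tensor R n (fun x => `|f x|) (fun x => `|g x|))//.
- rewrite lte_mul_pinfty//.
  + by apply: integral_ge0 => x _; rewrite lee_fin.
  + rewrite ge0_fin_numE; first by have /integrableP[] := lf.
    by apply: integral_ge0 => x _; rewrite lee_fin.
  + by have /integrableP[] := lg.
- exact: measurableT_comp.
- exact: measurableT_comp.
Qed.

Definition half_open_cube (r : R) : set E := [set y | forall i, - r <= y 0 i < r].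

Lemma measurable_half_open_cube r : measurable (half_open_cube r).
Proof.
have := @measurable_rV_box R n (fun i => `[- r, r[%classic) (fun i => measurable_itv _).
by congr measurable; apply/seteqP; split => x /= Hx i; have := Hx i; rewrite /= in_itv.
Qed.

Lemma L1_half_open_cube r : mu.-integrable setT (EFin \o (\1_(half_open_cube r) : E -> R)).
Proof.
apply: L1_indic; first exact: measurable_half_open_cube.
apply: le_lt_trans (lebesgue_rV_itv_box_lty (fun=> - r - 1) (fun=> r)).
apply: le_measure; rewrite ?inE.
- exact: measurable_half_open_cube.
- have := @measurable_rV_box R n (fun i => `]- r - 1, r[%classic) (fun i => measurable_itv _).
  by congr measurable; apply/seteqP; split => x /= Hx i; have := Hx i; rewrite /= in_itv.
- by move=> x Hx i; have /andP[h1 h2] := Hx i; apply/andP; split; lra.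
Qed.

Section sequences.
Variables (b : nat -> E * E -> R) (K : R) (w : nat -> E -> R) (M : R).
Hypothesis mb : forall k, measurable_fun setT (b k).
Hypotheses (K0 : 0 <= K) (bK : forall k, {ae mu2, forall z, `|b k z| <= K}).
Hypothesis b0 : forall h, 'L1 h -> \int[mu2]_z (b k z * h z) @[k --> \oo] --> 0.
Hypotheses (M0 : 0 <= M) (Ww : forall k, Wsp p s (w k)).
Hypotheses (wM : forall k, \int[mu]_x `|w k x| `^ p <= M) (DwM : forall k, energy p s (w k) <= M).

Let LbM k h : 'L1 h -> 'L1 (fun z => b k z * h z).
Proof.
move=> lh; apply: (@le_L1_ae _ _ _ _ _ (fun z => K * `|h z|)); last exact/L1Z/L1_norm.
  by apply: measurable_funM => //; exact: L1_measurable lh.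
by apply: filterS (bK k) => z bz; rewrite normrM ler_wpM2r.
Qed.

Let RbM k h : 'L1 h -> `|\int[mu2]_z (b k z * h z)| <= K * \int[mu2]_z `|h z|.
Proof.
move=> lh; rewrite -RintegralZl//; last exact: L1_norm.
apply: Rintegral_norm_le_ae; [exact: LbM|exact/L1Z/L1_norm|].
by apply: filterS (bK k) => z bz; rewrite normrM ler_wpM2r.
Qed.

(** Both [b k] and [w k] vary with k. Up to a small L^1 error, [w k] is a combination of finitely
    many indicators that do not depend on k, with coefficients bounded by a common [B]. The
    hypothesis on [b k] then has to be applied to the finitely many functions [G z * \1_(A j) z.1],
    and the whole sequence converges. *)
Lemma pairing_fst (G : E * E -> R) (c r : R) : measurable_fun setT G -> 0 <= c -> 0 < r ->
  (forall z, `|G z| <= c * (\1_(half_open_cube r) z.1 * \1_(half_open_cube r) z.2)) ->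
  (forall k, 'L1 (fun z => G z * w k z.1)) /\
  \int[mu2]_z (b k z * (G z * w k z.1)) @[k --> \oo] --> 0.
Proof.
move=> mG c0 r0 Gc; set Q := half_open_cube r.
have mQ : measurable Q by exact: measurable_half_open_cube.
have LQ : mu.-integrable setT (EFin \o (\1_Q : E -> R)) by exact: L1_half_open_cube.
have mw k : measurable_fun setT (w k) by have /(WspP s p1)[] := Ww k.
have Lw k : mu.-integrable setT (EFin \o (fun x => `|w k x| `^ p)) by have /(WspP s p1)[] := Ww k.
have LQw k : mu.-integrable setT (EFin \o (fun x => \1_Q x * w k x)).
  apply: (@le_L1 _ _ _ _ _ (fun x => \1_Q x + `|w k x| `^ p)); last exact: L1D.
    by apply: measurable_funM => //; exact: measurable_indic.
  move=> x; rewrite normrM indicE; case: (_ \in _); last by rewrite normr0 mul0r add0r powR_ge0.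
  rewrite normr1 mul1r; have := le_addr_powR p1 ltr01 (normr_ge0 (w k x)).
  by rewrite powR1 mul1r.
have LGu (u : E -> R) : measurable_fun setT u -> mu.-integrable setT (EFin \o (fun x => \1_Q x * u x)) ->
    'L1 (fun z => G z * u z.1).
  move=> mu_ lu; apply: (@le_L1 _ _ _ _ _ (fun z => c * ((`|\1_Q z.1 * u z.1|) * \1_Q z.2))).
  - by apply: measurable_funM => //; exact: measurableT_comp mu_ measurable_fst.
  - move=> z; rewrite normrM (le_trans (ler_wpM2r _ (Gc z)))// normrM (@ger0_norm _ (\1_Q z.1))//.
    by rewrite le_eqVlt; apply/orP; left; apply/eqP; rewrite /Q; ring.
  - by apply/L1Z/(@L1_tensor (fun x => `|\1_Q x * u x|)) => //; exact: L1_norm.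
split; first by move=> k; exact: LGu.
apply/cvgr0Pnorm_le => e e0.
pose q := \int[mu]_x (\1_Q x : R).
have q0 : 0 <= q by exact: Rintegral_ge0.
have Kcq : 0 <= K * c * q by rewrite !mulr_ge0.
(* The step approximation error gets multiplied by the bound [K] of [b k], the bound [c] of [G] and
   the measure [q] of the cube in the second variable. *)
have e1 : 0 < e / 2 / (K * c * q + 1) by rewrite !divr_gt0// ltr_wpDl.
have [J [A [B [mA HA]]]] := step_approx (n := n) p1 s01 r0 M0 e1.
have /choice[m Hm] : forall k, exists m : J -> R, (forall j, `|m j| <= B) /\
    (\int[mu]_x (\1_Q x * `|w k x - \sum_j m j * \1_(A j) x|)%:E <= (e / 2 / (K * c * q + 1))%:E)%E.
  by move=> k; exact: HA.
have LGA j : 'L1 (fun z => G z * \1_(A j) z.1).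
  apply: LGu; first exact: measurable_indic.
  apply: (@le_L1 _ _ _ _ _ (\1_Q)) => //.
    by apply: measurable_funM; exact: measurable_indic.
  by move=> x; rewrite !indicE; case: (_ \in _); case: (_ \in _); rewrite ?mulr0 ?mulr1 ?normr0 ?normr1.
have B1 : 0 < `|B| + 1 by rewrite ltr_wpDl.
(* There are [#|J|] terms, each with a coefficient of modulus at most the modulus of [B]. *)
have e2 : 0 < e / 2 / (`|B| + 1) / (#|J|%:R + 1) by rewrite !divr_gt0// ltr_wpDl.
have : \forall k \near \oo, forall j, `|\int[mu2]_z (b k z * (G z * \1_(A j) z.1))| <= e / 2 / (`|B| + 1) / (#|J|%:R + 1).
  by apply: filter_forall => j; have /cvgr0_norm_le := b0 (LGA j); exact.
apply: filterS => k Hk; have [mB mk] := Hm k.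
pose P x := \sum_j m k j * \1_(A j) x.
have mP : measurable_fun setT P.
  by apply: measurable_sum => j; apply: measurable_funM => //; exact: measurable_indic.
have mwP : measurable_fun setT (fun x => w k x - P x) by exact: measurable_funB.
have LQwP : mu.-integrable setT (EFin \o (fun x => \1_Q x * (w k x - P x))).
  apply: L1_fin_norm; first by apply: measurable_funM => //; exact: measurable_indic.
  under eq_integral do rewrite normrM (@ger0_norm _ (\1_Q _))//.
  by apply: le_lt_trans mk _; exact: ltry.
have LQwPn : mu.-integrable setT (EFin \o (fun x => \1_Q x * `|w k x - P x|)).
  have := L1_norm LQwP; congr (_.-integrable _ _); apply/funext => x /=.
  by rewrite normrM (@ger0_norm _ (\1_Q _)).
have L1' := LGu _ mwP LQwP.
have sumL (t : seq J) : 'L1 (fun z => \sum_(j <- t) m k j * (G z * \1_(A j) z.1)) /\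
   \int[mu2]_z (b k z * (\sum_(j <- t) m k j * (G z * \1_(A j) z.1))) =
   \sum_(j <- t) m k j * \int[mu2]_z (b k z * (G z * \1_(A j) z.1)).
  elim: t => [|j t [IH1 IH2]].
    rewrite (_ : (fun z => \sum_(j <- [::]) _) = (fun=> 0)); last by apply/funext => z; rewrite big_nil.
    rewrite big_nil; split; first exact: L1_0.
    rewrite -[RHS](@Rintegral0 _ _ _ mu2); apply: eq_Rintegral => z _.
    by rewrite big_nil mulr0.
  split.
    rewrite (_ : (fun z => \sum_(j <- j :: t) _) = (fun z => m k j * (G z * \1_(A j) z.1) +
      \sum_(j <- t) m k j * (G z * \1_(A j) z.1))); last by apply/funext => z; rewrite big_cons.
    by apply: L1D => //; exact: L1Z.
  rewrite big_cons -IH2 -RintegralZl//; last exact: LbM.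
  rewrite -RintegralD//; [|exact/L1Z/LbM|exact: LbM].
  by apply: eq_Rintegral => z _; rewrite big_cons mulrDr mulrCA.
have [SL SE] := sumL (index_enum J).
rewrite (@eq_Rintegral _ _ _ _ _ (fun z => b k z * (G z * (w k z.1 - P z.1)) +
   b k z * (\sum_j m k j * (G z * \1_(A j) z.1)))); last first.
  move=> z _; rewrite -mulrDr; congr (_ * _); rewrite mulrBr /P mulr_sumr.
  rewrite (eq_bigr (fun j => m k j * (G z * \1_(A j) z.1))); last by move=> j _; ring.
  by rewrite subrK.
rewrite RintegralD//; [|exact: LbM|exact: LbM].
rewrite (le_trans (ler_normD _ _))// (splitr e) lerD//.
  apply: (le_trans (RbM k L1')).
  apply: (@le_trans _ _ (K * (c * (q * (e / 2 / (K * c * q + 1)))))).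
    rewrite ler_wpM2l//.
    apply: (@le_trans _ _ (\int[mu2]_z (c * ((\1_Q z.1 * `|w k z.1 - P z.1|) * \1_Q z.2)))).
      apply: Rintegral_le; first exact: L1_norm.
        by apply/L1Z/(@L1_tensor (fun x => \1_Q x * `|w k x - P x|)).
      move=> z; rewrite normrM (le_trans (ler_wpM2r _ (Gc z)))//.
      by rewrite le_eqVlt; apply/orP; left; apply/eqP; rewrite /Q; ring.
    rewrite RintegralZl//; last by apply: (@L1_tensor (fun x => \1_Q x * `|w k x - P x|)).
    rewrite ler_wpM2l// /Rintegral.
    rewrite (@tonelli_tensor R n (fun x => \1_Q x * `|w k x - P x|) \1_Q).
    - rewrite -(Rintegral_EFin LQwPn) -(Rintegral_EFin LQ) -EFinM /= mulrC ler_wpM2l//.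
      by rewrite -lee_fin (Rintegral_EFin LQwPn).
    - exact: L1_measurable LQwPn.
    - exact: measurable_indic.
    - by move=> x; rewrite mulr_ge0.
    - by [].
  rewrite !mulrA -[leRHS]mulr1 -mulrA; rewrite [leLHS](_ : _ = e / 2 * (K * c * q / (K * c * q + 1))).
    rewrite ler_wpM2l ?divr_ge0 ?(ltW e0)//.
    by rewrite ler_pdivrMr ?ltr_wpDl// mul1r lerDl.
  by field; rewrite lt0r_neq0 ?ltr_wpDl.
rewrite SE (le_trans (ler_norm_sum _ _ _))//.
apply: (@le_trans _ _ (\sum_(j : J) (`|B| + 1) * (e / 2 / (`|B| + 1) / (#|J|%:R + 1)))).
  apply: ler_sum => j _; rewrite normrM ler_pM//.
  by rewrite (le_trans (mB j))// (le_trans (ler_norm _))// lerDl.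
rewrite sumr_const -[leLHS]mulr_natl.
rewrite [leLHS](_ : _ = e / 2 * (#|J|%:R / (#|J|%:R + 1))).
  rewrite -[leRHS]mulr1 ler_wpM2l ?divr_ge0 ?(ltW e0)//.
  by rewrite ler_pdivrMr ?ltr_wpDl// mul1r lerDl.
field; rewrite !lt0r_neq0 ?ltr_wpDl//.
Qed.

End sequences.

End weak_pairing.

Section flux_pairing.
Context {R : realType} {n : nat} (p s : R).
Hypotheses (p1 : 1 < p) (s01 : 0 < s < 1).
Local Notation E := 'rV[R]_n.
Local Notation mu := (@lebesgue_rV R n).
Local Notation mu2 := (@lebesgue_rV2 R n).
Local Notation D := (@nonlocal_gradient R n p s).
Local Notation "'L1 f" := (mu2.-integrable [set: (E * E)%type] (EFin \o f)) (at level 10, f at next level).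
Local Notation p' := (p / (p - 1)).

Let p0 : 0 < p. Proof. by apply: lt_trans p1. Qed.
Let s0 : 0 < s. Proof. by case/andP: s01. Qed.

Lemma L1_young (f g : E * E -> R) : measurable_fun setT f -> measurable_fun setT g ->
  'L1 (fun z => `|f z| `^ p') -> 'L1 (fun z => `|g z| `^ p) -> 'L1 (fun z => f z * g z).
Proof.
move=> mf mg lf lg; have [C C0 HC] := @young R p 1 p1 ltr01.
apply: (@le_L1 _ _ _ _ _ (fun z => 1 * `|g z| `^ p + C * `|f z| `^ p')) => //.
  exact: measurable_funM.
by apply: L1D; exact: L1Z.
Qed.

Variables (b : nat -> E * E -> R) (K : R) (w : nat -> E -> R) (M : R).
Hypothesis mb : forall k, measurable_fun setT (b k).
Hypotheses (K0 : 0 <= K) (bK : forall k, {ae mu2, forall z, `|b k z| <= K}).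
Hypothesis b0 : forall h, 'L1 h -> \int[mu2]_z (b k z * h z) @[k --> \oo] --> 0.
Hypotheses (M0 : 0 <= M) (Ww : forall k, Wsp p s (w k)).
Hypotheses (wM : forall k, \int[mu]_x `|w k x| `^ p <= M) (DwM : forall k, energy p s (w k) <= M).

(* The part of [g] near the diagonal, near infinity or where it is large is small
   in [L^p'] and is absorbed by the energy bound; on the remaining set [D w] is
   a bounded multiple of [w z.1 - w z.2]. *)
Lemma flux_pairing (g : E * E -> R) : measurable_fun setT g ->
  'L1 (fun z => `|g z| `^ p') ->
  \int[mu2]_z (b k z * (g z * D (w k) z)) @[k --> \oo] --> 0.
Proof.
move=> mg lg; have p'1 := conj_exp p1.
have p'0 : 0 < p' by lra.
have q0 : 0 <= n%:R / p + s by rewrite addr_ge0// ?divr_ge0// ltW.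
have mw k : measurable_fun setT (w k) by have /(WspP s p1)[] := Ww k.
have LDw k : 'L1 (fun z => `|D (w k) z| `^ p) by have /(WspP s p1)[] := Ww k.
have mDw k : measurable_fun setT (D (w k)) by exact: measurable_gradient.
have LbM k h : 'L1 h -> 'L1 (fun z => b k z * h z).
  move=> lh; apply: (@le_L1_ae _ _ _ _ _ (fun z => K * `|h z|)); last exact/L1Z/L1_norm.
    by apply: measurable_funM => //; exact: L1_measurable lh.
  by apply: filterS (bK k) => z bz; rewrite normrM ler_wpM2r.
have me : measurable_fun setT (fun z : E * E => enorm (z.1 - z.2)).
  apply: measurable_enorm => i.
  rewrite (_ : (fun z => _) = (fun z : E * E => rV_coord i z.1 - rV_coord i z.2)).
    apply: measurable_funB.
      exact: measurableT_comp (measurable_rV_coord i) measurable_fst.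
    exact: measurableT_comp (measurable_rV_coord i) measurable_snd.
  by apply/funext => z; rewrite !mxE.
pose Q m := @half_open_cube R n m.+1%:R.
pose S (m : nat) := [set z : E * E | m.+1%:R^-1 <= enorm (z.1 - z.2)] `&`
  ([set z | `|g z| <= m.+1%:R] `&` (Q m `*` Q m)).
have mS m : measurable (S m).
  apply: measurableI; last apply: measurableI.
  - have := measurable_fun_ler (@measurable_cst _ _ (E * E)%type _ setT (m.+1%:R^-1 : R)) me.
    by move=> /(_ measurableT [set true] I); rewrite setTI; congr measurable; apply/seteqP; split => x.
  - have mgn : measurable_fun setT (fun z => `|g z|) by exact: measurableT_comp.
    have := measurable_fun_ler mgn (@measurable_cst _ _ (E * E)%type _ setT (m.+1%:R : R)).
    by move=> /(_ measurableT [set true] I); rewrite setTI; congr measurable; apply/seteqP; split => x.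
  - by apply: measurableX; exact: measurable_half_open_cube.
have miS m : measurable_fun setT (\1_(S m) : E * E -> R) by exact: measurable_indic.
(* The gradient is 0 on the diagonal, being a quotient by 0 there. Removing the diagonal from [g]
   thus leaves the pairing unchanged and makes [h m] tend to 0 at every point. *)
pose off z : R := \1_[set z : E * E | enorm (z.1 - z.2) != 0] z.
have moff : measurable_fun setT off.
  apply: measurable_indic; rewrite (_ : [set _ | _] = ~` [set z : E * E | enorm (z.1 - z.2) == 0]).
    apply: measurableC.
    have := measurable_fun_eqr me (@measurable_cst _ _ (E * E)%type _ setT (0 : R)).
    by move=> /(_ measurableT [set true] I); rewrite setTI; congr measurable; apply/seteqP; split => x.
  by apply/seteqP; split => x /= /negP.
pose h m z := (off z - \1_(S m) z) * g z.
have mh m : measurable_fun setT (h m) by apply: measurable_funM => //; exact: measurable_funB.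
have offS m z : 0 <= off z - \1_(S m) z <= 1.
  rewrite /off !indicE; have [|] := boolP (z \in S m).
    rewrite inE => -[/= e1 _]; rewrite mem_set ?subrr ?lexx ?ler01//=.
    by apply: lt0r_neq0; apply: lt_le_trans e1; rewrite invr_gt0.
  by move=> _; rewrite subr0; case: (_ \in _); rewrite /= ?lexx ?ler01.
have hleg m z : `|h m z| <= `|g z|.
  have /andP[c1 c2] := offS m z.
  by rewrite /h normrM (ger0_norm c1) ler_piMl.
have h0 z : (fun m => h m z) @ \oo --> (0 : R).
  apply: cvg_near_cst.
  have [ez|ez] := eqVneq (enorm (z.1 - z.2)) 0.
    apply: nearW => m; rewrite /h /off !indicE memNset/= ?ez ?eqxx//.
    rewrite memNset ?subrr ?mul0r//= => -[/= + _]; rewrite ez.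
    by rewrite leNgt invr_gt0 ltr0n.
  have ez0 : 0 < enorm (z.1 - z.2) by rewrite lt_neqAle eq_sym ez enorm_ge0.
  near=> m; rewrite /h /off !indicE mem_set//= mem_set ?subrr ?mul0r//.
  have cube x : `|x| <= m%:R -> Q m x.
    move=> xm i; have := rV_norm_coord x i; rewrite ler_norml => /andP[x1 x2].
    have m1 : m.+1%:R = m%:R + 1 :> R by rewrite natr1.
    by rewrite m1; apply/andP; split; lra.
  split; [|split; [|split]].
  - by rewrite /= ltW//; near: m; exact: (near_infty_natSinv_lt (PosNum ez0)).
  - apply: (@le_trans _ _ m%:R); last by rewrite ler_nat.
    by near: m; exact: nbhs_infty_ger.
  - by apply: cube; near: m; exact: nbhs_infty_ger.
  - by apply: cube; near: m; exact: nbhs_infty_ger.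
have mpow (u : E * E -> R) : measurable_fun setT u -> measurable_fun setT (fun z => `|u z| `^ p').
  by move=> mu_; apply: measurableT_comp (measurable_powR _) _; exact: measurableT_comp.
have dom m z : `| `|h m z| `^ p'| <= `|g z| `^ p'.
  rewrite ger0_norm ?powR_ge0//; apply: ge0_ler_powR; [exact: ltW|by rewrite nnegrE|by rewrite nnegrE|exact: hleg].
have Lh m : 'L1 (fun z => `|h m z| `^ p') by apply: (le_L1 _ (dom m) lg); exact: mpow.
have [|||_ ih _] := @L1_dct _ _ _ mu2 (fun m z => `|h m z| `^ p') (fun=> 0) (fun z => `|g z| `^ p') _ dom.
- by move=> m; exact: mpow.
- move=> z; apply/cvgr0Pnorm_le => e e0.
  have e1 : 0 < e `^ p'^-1 by exact: powR_gt0.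
  have /cvgr0_norm_le /(_ _ e1) := h0 z; apply: filterS => m hm.
  rewrite ger0_norm ?powR_ge0//.
  have -> : e = (e `^ p'^-1) `^ p' by rewrite -powRrM mulVf ?lt0r_neq0// powRr1// ltW.
  by apply: ge0_ler_powR; [exact: ltW|by rewrite nnegrE|by rewrite nnegrE powR_ge0|].
- exact: lg.
rewrite Rintegral0 in ih.
apply/cvgr0Pnorm_le => e e0.
have KM1 : 0 < K * M + 1 by rewrite ltr_wpDl// mulr_ge0.
(* The budget is four times e / 4: two shares for the Young bound of the [h m] part, in its energy
   term and in its p' term, and one for each of the two values of [w k] in the difference. *)
have e1 : 0 < e / 4 / (K * M + 1) by rewrite !divr_gt0.
have [C C0 HC] := young p1 e1.
have KC1 : 0 < K * C + 1 by rewrite ltr_wpDl// mulr_ge0.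
have e2 : 0 < e / 4 / (K * C + 1) by rewrite !divr_gt0.
have /cvgr0_norm_le /(_ _ e2) [m _ /(_ _ (leqnn m))] := ih.
rewrite ger0_norm; last by apply: Rintegral_ge0 => z _; exact: powR_ge0.
move=> hm.
pose q := n%:R / p + s.
(* On [S m] the singular kernel is bounded, so it joins the bounded factor and the difference
   quotient splits into two terms in the values of [w k]. *)
pose G z := \1_(S m) z * g z * enorm (z.1 - z.2) `^ (- q).
have mG : measurable_fun setT G.
  by do 2?apply: measurable_funM => //; exact: measurableT_comp (measurable_powR _) me.
pose c : R := m.+1%:R * m.+1%:R `^ q.
have c0 : 0 <= c by rewrite mulr_ge0 ?powR_ge0.
have GE z : `|G z| <= c * (\1_(Q m) z.1 * \1_(Q m) z.2).
  rewrite /G !indicE; have [|] := boolP (z \in S m); last first.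
    by rewrite !mul0r normr0 mulr_ge0// mulr_ge0.
  rewrite inE => -[/= se [/= sg [sq1 sq2]]].
  rewrite (mem_set sq1) (mem_set sq2) !mulr1 mul1r normrM (@ger0_norm _ (_ `^ _)) ?powR_ge0//.
  rewrite /c ler_pM ?powR_ge0//.
  rewrite (_ : _ `^ (- q) = (enorm (z.1 - z.2))^-1 `^ q); last first.
    by rewrite -[in RHS]powR_inv1 ?enorm_ge0// -powRrM mulN1r.
  apply: ge0_ler_powR; [exact: q0|by rewrite nnegrE invr_ge0 enorm_ge0|by rewrite nnegrE|].
  rewrite -[leRHS]invrK lef_pV2 ?posrE ?invr_gt0//.
  by apply: lt_le_trans se; rewrite invr_gt0.
have m10 : 0 < m.+1%:R :> R by [].
have [LG1 cG1] := pairing_fst p1 s01 mb K0 bK b0 M0 Ww wM DwM mG c0 m10 GE.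
(* The term in [w k z.2] becomes one in [w k z.1] after exchanging the variables; the swapped
   coefficients satisfy the same hypotheses as [b k]. *)
have mbs k : measurable_fun setT (b k \o rV2_swap) by apply: measurableT_comp => //; exact: measurable_rV2_swap.
have bKs k : {ae mu2, forall z, `|(b k \o rV2_swap) z| <= K}.
  have [N [mN N0 NP]] := bK k; exists (rV2_swap @^-1` N); split.
  - by rewrite -[X in measurable X]setTI; exact: measurable_rV2_swap.
  - by rewrite lebesgue_rV2_swap.
  - by move=> z /= nz; exact: NP.
have swap_int u : 'L1 u -> 'L1 (fun z => u (rV2_swap z)) /\
    \int[mu2]_z u (rV2_swap z) = \int[mu2]_z u z.
  move=> lu; split; first exact: (L1_preserving measurable_rV2_swap lebesgue_rV2_swap lu).
  exact: (Rintegral_preserving measurable_rV2_swap lebesgue_rV2_swap lu).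
have swapK z : rV2_swap (rV2_swap z) = z :> E * E by case: z.
have b0s u : 'L1 u -> \int[mu2]_z ((b k \o rV2_swap) z * u z) @[k --> \oo] --> 0.
  move=> lu; have [lus _] := swap_int _ lu.
  rewrite (_ : (fun k => _) = (fun k => \int[mu2]_z (b k z * u (rV2_swap z)))); first exact: b0.
  apply/funext => k; have [_ <-] := swap_int _ (LbM k _ lus).
  by apply: eq_Rintegral => z _ /=; rewrite swapK.
have mGs : measurable_fun setT (G \o rV2_swap) by apply: measurableT_comp => //; exact: measurable_rV2_swap.
have GEs z : `|(G \o rV2_swap) z| <= c * (\1_(Q m) z.1 * \1_(Q m) z.2).
  by rewrite /= (le_trans (GE _))// [X in c * X]mulrC.
have [LG2 cG2] := pairing_fst p1 s01 mbs K0 bKs b0s M0 Ww wM DwM mGs c0 m10 GEs.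
have e40 : 0 < e / 4 by rewrite divr_gt0.
have /cvgr0_norm_le /(_ _ e40) near1 := cG1.
have /cvgr0_norm_le /(_ _ e40) near2 := cG2.
apply: filterS2 near1 near2 => k n1 n2.
have LhD : 'L1 (fun z => h m z * D (w k) z) by exact: L1_young.
have [LG2' iG2'] := swap_int _ (LG2 k).
have LG2s : 'L1 (fun z => G z * w k z.2) by have := LG2'; rewrite /= (_ : (fun z => _) = (fun z => G z * w k z.2))//;
  apply/funext => z; rewrite /= swapK.
have bG2 : \int[mu2]_z (b k z * (G z * w k z.2)) =
    \int[mu2]_z ((b k \o rV2_swap) z * ((G \o rV2_swap) z * w k z.1)).
  by have [_ <-] := swap_int _ (LbM k _ LG2s).
rewrite (@eq_Rintegral _ _ _ _ _ (fun z => b k z * (h m z * D (w k) z) +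
  (b k z * (G z * w k z.1) - b k z * (G z * w k z.2)))); last first.
  move=> z _; rewrite -mulrBr -mulrDr; congr (_ * _).
  have -> : g z * D (w k) z = off z * g z * D (w k) z.
    rewrite /off indicE; have [|] := boolP (z \in _); first by rewrite mul1r.
    rewrite notin_setE /= => /negP; rewrite negbK => /eqP ez.
    by rewrite /nonlocal_gradient ez powR0 ?invr0 ?mulr0// lt0r_neq0// ltr_wpDl// divr_ge0// ltW.
  by rewrite /h /G /nonlocal_gradient powRN; ring.
rewrite RintegralD//; [|exact: LbM|by apply: L1B; exact: LbM].
rewrite RintegralB//; [|exact: LbM|exact: LbM].
rewrite bG2.
suff n3 : `|\int[mu2]_z (b k z * (h m z * D (w k) z))| <= e / 2.
  rewrite (le_trans (ler_normD _ _))// (splitr e) lerD//.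
  apply: (le_trans (ler_normB _ _)).
  have -> : e / 2 = e / 4 + e / 4 by field.
  by apply: lerD; [exact: n1|exact: n2].
have Lyou : 'L1 (fun z => e / 4 / (K * M + 1) * `|D (w k) z| `^ p + C * `|h m z| `^ p').
  by apply: L1D; exact: L1Z.
apply: (@le_trans _ _ (\int[mu2]_z (K * (e / 4 / (K * M + 1) * `|D (w k) z| `^ p + C * `|h m z| `^ p')))).
  apply: Rintegral_norm_le_ae; [exact: LbM|exact: L1Z|].
  apply: filterS (bK k) => z bz; rewrite normrM ler_pM//.
rewrite RintegralZl// RintegralD//; [|exact: L1Z|exact: L1Z].
rewrite RintegralZl// RintegralZl//.
have t1 : K * (e / 4 / (K * M + 1) * energy p s (w k)) <= e / 4.
  apply: (@le_trans _ _ (K * (e / 4 / (K * M + 1) * M))).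
    by rewrite ler_wpM2l// ler_wpM2l// ltW.
  rewrite [leLHS](_ : _ = e / 4 * (K * M / (K * M + 1))); last by field; rewrite lt0r_neq0.
  by rewrite -[leRHS]mulr1 ler_wpM2l ?(ltW e40)// ler_pdivrMr// mul1r lerDl.
have t2 : K * (C * \int[mu2]_z `|h m z| `^ p') <= e / 4.
  apply: (@le_trans _ _ (K * (C * (e / 4 / (K * C + 1))))).
    by rewrite ler_wpM2l// ler_wpM2l.
  rewrite [leLHS](_ : _ = e / 4 * (K * C / (K * C + 1))); last by field; rewrite lt0r_neq0.
  by rewrite -[leRHS]mulr1 ler_wpM2l ?(ltW e40)// ler_pdivrMr// mul1r lerDl.
have -> : e / 2 = e / 4 + e / 4 by field.
by rewrite mulrDr; apply: lerD; [exact: t1|exact: t2].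
Unshelve. all: by end_near. Qed.

End flux_pairing.

(** * Smooth kernels and mollification *)

Section smooth_bump.
Context {R : realType}.

(** The powers of 1 / t make the family stable under differentiation, up to linear combinations. *)
Definition expinv (m : nat) (t : R) : R :=
  if 0 < t then t^-1 ^+ m * expR (- t^-1) else 0.

Lemma expinv_ge0 m t : 0 <= expinv m t.
Proof.
rewrite /expinv; case: ifPn => // t0.
by rewrite mulr_ge0 ?expR_ge0// exprn_ge0// invr_ge0 ltW.
Qed.

(** With y = 1 / t this compares exp y with the single term y^m / m! of its series. *)
Lemma expinv_le_fact m t : expinv m t <= m`!%:R.
Proof.
rewrite /expinv; case: ifPn => [t0|_]; last exact: ler0n.
have y0 : 0 < t^-1 by rewrite invr_gt0.
rewrite expRN ler_pdivrMr ?expR_gt0//; case: m => [|m].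
  by rewrite expr0 mul1r -expR0 ler_expR ltW.
rewrite mulrC -ler_pdivrMr ?ltr0n ?fact_gt0//.
by apply: le_trans (expR_ge1Dxn m (ltW y0)); rewrite lerDr.
Qed.

Lemma expinv_sqr m t : expinv m t = t ^+ 2 * expinv m.+2 t.
Proof.
rewrite /expinv; case: ifPn => [t0|_]; last by rewrite mulr0.
by rewrite !exprS; field; rewrite lt0r_neq0.
Qed.

Lemma is_derive_expinv m (t : R) :
  is_derive t 1 (expinv m) (expinv m.+2 t - m%:R * expinv m.+1 t).
Proof.
have [t0|t0|->] := ltgtP t 0.
- rewrite /expinv !ltNge !(ltW t0)/= mulr0 subrr.
  apply: (@near_eq_is_derive _ _ _ (cst 0)).
  by near=> x; rewrite ltNge ltW//; near: x; exact: lt_nbhsl.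
- rewrite {2 3}/expinv t0.
  apply: (@near_eq_is_derive R R R (fun x : R => x^-1 ^+ m * expR (- x^-1))).
    by near=> x; rewrite /expinv (_ : 0 < x)//; near: x; exact: lt_nbhsr.
  have tn0 : t != 0 by rewrite gt_eqF.
  have dV : is_derive t 1 (fun x : R => x^-1) (- t ^- 2).
    by have := @is_deriveV R id t 1 1 tn0 (is_derive_id _ _); rewrite /GRing.scale/= mulr1.
  have dX : is_derive t 1 (fun x : R => x^-1 ^+ m) (m%:R * t^-1 ^+ m.-1 * - t ^- 2).
    have := @is_deriveX R R (fun x : R => x^-1) m t 1 _ dV.
    rewrite (_ : (fun x : R => x^-1) ^+ m = (fun x : R => x^-1 ^+ m)); last by apply/funext => x; rewrite exprfctE.
    by rewrite /GRing.scale/= mulr_natl.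
  have dN : is_derive t 1 (fun x : R => - x^-1) (t ^- 2) by have := is_deriveN dV; rewrite opprK.
  have dE := @is_derive1_comp R expR (fun x : R => - x^-1) t _ _ (is_derive_expR _) dN.
  have dM : is_derive t 1 (fun x : R => x^-1 ^+ m * expR (- x^-1)) _ := is_deriveM dX dE.
  apply: (is_derive_eq dM); rewrite /GRing.scale/=.
  by case: m {dX dM} => [|m]; rewrite /= ?mulr0n ?mul0r !exprS; field; rewrite gt_eqF.
- have -> : expinv m.+2 0 - m%:R * expinv m.+1 0 = 0 :> R.
    by rewrite /expinv ltxx mulr0 subrr.
  (* By [expinv_sqr] two powers of z factor out; one of them is the increment, and the other makes
     the slope, z times a bounded function, tend to 0. *)
  apply/is_derive1_caratheodory; exists (fun z => z * expinv m.+2 z); split.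
  + by move=> z; rewrite {2}/expinv ltxx !subr0 expinv_sqr; ring.
  + apply/cvgrPdist_le => e e0.
    have f0 : 0 < (m.+2)`!%:R :> R by rewrite ltr0n fact_gt0.
    have d0 : 0 < e / (m.+2)`!%:R by rewrite divr_gt0.
    near=> z.
    have zd : `|z| <= e / (m.+2)`!%:R.
      by near: z; have := @nbhs0_le R R _ d0; apply.
    rewrite mul0r sub0r normrN normrM (ger0_norm (expinv_ge0 _ _)).
    apply: (@le_trans _ _ (e / (m.+2)`!%:R * (m.+2)`!%:R)); last by rewrite divfK// lt0r_neq0.
    by rewrite ler_pM ?expinv_ge0// expinv_le_fact.
  + by rewrite mul0r.
Unshelve. all: by end_near. Qed.

(* A class of bounded functions containing its own derivatives. *)
Inductive bumpy : (R -> R) -> Prop :=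
| bumpy_base m k : bumpy (fun t => expinv m (1 + t) * expinv k (1 - t))
| bumpy_lin c f g : bumpy f -> bumpy g -> bumpy (fun t => c * f t + g t).

Lemma bumpy_bounded f : bumpy f -> exists B, forall t, `|f t| <= B.
Proof.
elim=> [m k|c g h _ [B HB] _ [B' HB']].
  exists (m`!%:R * k`!%:R) => t.
  by rewrite normrM !ger0_norm ?expinv_ge0// ler_pM ?expinv_ge0 ?expinv_le_fact.
exists (`|c| * B + B') => t; rewrite (le_trans (ler_normD _ _))// lerD//.
by rewrite normrM ler_wpM2l.
Qed.

Lemma bumpy_derive f : bumpy f -> exists f', bumpy f' /\ forall t : R, is_derive t 1 f (f' t).
Proof.
elim=> [m k|c g h _ [g' [bg dg]] _ [h' [bh dh]]].
  exists (fun t => - m%:R * (expinv m.+1 (1 + t) * expinv k (1 - t)) +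
    (-1 * (expinv m (1 + t) * expinv k.+2 (1 - t)) +
     (k%:R * (expinv m (1 + t) * expinv k.+1 (1 - t)) +
      expinv m.+2 (1 + t) * expinv k (1 - t)))); split.
    apply: (bumpy_lin _ (bumpy_base _ _)).
    apply: (bumpy_lin _ (bumpy_base _ _)).
    exact: (bumpy_lin _ (bumpy_base _ _) (bumpy_base _ _)).
  move=> t.
  have d1 : is_derive t 1 (fun t : R => 1 + t) 1.
    by have := is_deriveD (@is_derive_cst R R R 1 t 1) (@is_derive_id R R t 1); rewrite add0r.
  have d2 : is_derive t 1 (fun t : R => 1 - t) (-1).
    by have := is_deriveB (@is_derive_cst R R R 1 t 1) (@is_derive_id R R t 1); rewrite sub0r.
  have c1 := @is_derive1_comp R _ _ t _ _ (is_derive_expinv m (1 + t)) d1.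
  have c2 := @is_derive1_comp R _ _ t _ _ (is_derive_expinv k (1 - t)) d2.
  have dM : is_derive t 1 (fun x : R => expinv m (1 + x) * expinv k (1 - x)) _ := is_deriveM c1 c2.
  apply: (is_derive_eq dM); rewrite /GRing.scale/=.
  by ring.
exists (fun t => c * g' t + h' t); split; first exact: bumpy_lin.
move=> t; have := is_deriveD (@is_deriveZ _ _ _ _ c _ _ _ (dg t)) (dh t).
by [].
Qed.

(** The bump comes with the sequence of all its derivatives, so that differentiating later on is a
    mere shift of index. *)
Lemma exists_bump : exists F : nat -> R -> R,
  [/\ forall k (t : R), is_derive t 1 (F k) (F k.+1 t),
      forall k, exists B, forall t, `|F k t| <= B,
      forall t, 0 <= F 0%N t,
      forall t, 1 <= `|t| -> F 0%N t = 0 &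
      forall t, `|t| < 1 -> 0 < F 0%N t].
Proof.
have /choice[d Hd] : forall f : R -> R, exists f', bumpy f -> bumpy f' /\ forall t : R, is_derive t 1 f (f' t).
  move=> f; have [/bumpy_derive [f' Hf]|nf] := pselect (bumpy f); first by exists f'.
  by exists f.
pose phi t : R := expinv 0 (1 + t) * expinv 0 (1 - t).
have bF k : bumpy (iter k d phi).
  by elim: k => [|k /Hd[]//]; exact: bumpy_base.
exists (fun k => iter k d phi); split => //=.
- by move=> k t; have [_] := Hd _ (bF k); exact.
- by move=> k; exact: bumpy_bounded.
- by move=> t; rewrite mulr_ge0 ?expinv_ge0.
- move=> t; rewrite /phi /expinv ler_normr => /orP[] h.
    by rewrite subr_gt0 (ltNge t) h mulr0.
  by rewrite (_ : 0 < 1 + t = false) ?mul0r//; apply/negbTE; rewrite -leNgt; lra.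
- move=> t; rewrite ltr_norml => /andP[t1 t2]; rewrite /phi /expinv.
  have -> : 0 < 1 + t by lra.
  by rewrite subr_gt0 t2 mulr_gt0// mulr_gt0 ?expR_gt0.
Qed.

End smooth_bump.

Section tensor_kernel.
Context {R : realType} {n : nat}.
Local Notation E := 'rV[R]_n.
Local Notation mu := (@lebesgue_rV R n).

Lemma is_derive_lipschitz (f df : R -> R) B : (forall t : R, is_derive t 1 f (df t)) ->
  (forall t, `|df t| <= B) -> forall t u, `|f t - f u| <= B * `|t - u|.
Proof.
move=> fdf dB; suff H t u : u <= t -> `|f t - f u| <= B * `|t - u|.
  move=> t u; have [tu|/ltW tu] := leP u t; first exact: H.
  by rewrite distrC (distrC t); exact: H.
move=> ut; have [|c _ ->] := @MVT_segment R f df u t ut (fun x _ => fdf x).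
  apply: continuous_subspaceT => x; apply: differentiable_continuous.
  by apply/derivable1_diffP; case: (fdf x).
by rewrite normrM ler_wpM2r.
Qed.

(** The remainder is quadratic uniformly in t, which lets it be integrated against an arbitrary
    integrable function. *)
Lemma is_derive_taylor (f df ddf : R -> R) B : (forall t : R, is_derive t 1 f (df t)) ->
  (forall t : R, is_derive t 1 df (ddf t)) -> (forall t, `|ddf t| <= B) ->
  forall t h, `|f (t + h) - f t - h * df t| <= B * h ^+ 2.
Proof.
move=> fdf dfd dB t h; have lip := is_derive_lipschitz dfd dB.
have cf (a b : R) : {within `[a, b], continuous f}.
  apply: continuous_subspaceT => x; apply: differentiable_continuous.
  by apply/derivable1_diffP; case: (fdf x).
have B0 : 0 <= B by apply: le_trans (dB 0).
have [c ch ->] : exists2 c, `|c - t| <= `|h| & f (t + h) - f t = h * df c.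
  have [h0|/ltW h0] := leP 0 h.
    have [|c] := @MVT_segment R f df t (t + h) _ (fun x _ => fdf x) (cf _ _); first by rewrite lerDl.
    rewrite in_itv/= => /andP[c1 c2] ->; exists c; last by ring.
    by rewrite !ger0_norm//; lra.
  have [|c] := @MVT_segment R f df (t + h) t _ (fun x _ => fdf x) (cf _ _); first by rewrite gerDl.
  rewrite in_itv/= => /andP[c1 c2] e; exists c.
    by rewrite !ler0_norm//; lra.
  by rewrite -opprB e; ring.
rewrite -mulrBr normrM -(real_normK (num_real h)) expr2 mulrCA ler_wpM2l//.
by apply: (le_trans (lip _ _)); rewrite ler_wpM2l.
Qed.

Lemma lipschitz_continuous_rV (f : E -> R) C : 0 <= C ->
  (forall x y, `|f x - f y| <= C * `|x - y|) -> continuous f.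
Proof.
move=> C0 lip x; apply: (@cvgrPdist_le _ _ E (nbhs x) (nbhs_filter x) f (f x)).2 => e e0.
have C1 : 0 < C + 1 by rewrite ltr_wpDl.
have d0 : 0 < e / (C + 1) by rewrite divr_gt0.
apply/nbhs_ballP; exists (e / (C + 1)) => // y; rewrite -ball_normE /= => xy.
apply: (le_trans (lip _ _)).
apply: (@le_trans _ _ ((C + 1) * (e / (C + 1)))); last by rewrite mulrC divfK// gt_eqF.
by rewrite ler_pM// ?lerDl// ltW.
Qed.

(** [k] is a multi-index: with [F i j] the j-th derivative of the i-th factor, this is a mixed
    partial derivative of the product kernel. *)
Definition tensor (F : 'I_n -> nat -> R -> R) (k : 'I_n -> nat) (z : E) : R :=
  \prod_(i < n) F i (k i) (z 0 i).

Variable F : 'I_n -> nat -> R -> R.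
Hypothesis dF : forall i k (t : R), is_derive t 1 (F i k) (F i k.+1 t).
Hypothesis bF : forall i k, exists B, forall t, `|F i k t| <= B.

Let mF i k : measurable_fun setT (F i k).
Proof.
apply: continuous_measurable_fun => x; apply: differentiable_continuous.
by apply/derivable1_diffP; case: (dF i k x).
Qed.

Lemma measurable_tensor d (T : measurableType d) (f : T -> E) k :
  (forall i, measurable_fun setT (fun z => f z 0 i)) ->
  measurable_fun setT (fun z => tensor F k (f z)).
Proof.
move=> mf; apply: measurable_prod => i _.
exact: measurableT_comp (mF i (k i)) (mf i).
Qed.

Lemma tensor_bounded_lipschitz k : exists2 B, 0 <= B &
  (forall z, `|tensor F k z| <= B) /\
  (forall z y, `|tensor F k z - tensor F k y| <= B * `|z - y|).
Proof.
rewrite /tensor; elim: (index_enum _) => [|i r [B B0 [HB HL]]].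
  exists 1 => //; split=> [z|z y]; first by rewrite big_nil normr1.
  by rewrite !big_nil subrr normr0 mulr_ge0.
have [C HC] := bF i (k i); have [C' HC'] := bF i (k i).+1.
have C0 : 0 <= C by apply: le_trans (HC 0).
have C'0 : 0 <= C' by apply: le_trans (HC' 0).
have lip := is_derive_lipschitz (dF i (k i)) HC'.
exists (C * B + C' * B); first by rewrite addr_ge0 ?mulr_ge0.
split=> [z|z y].
  by rewrite big_cons normrM ler_wpDr ?mulr_ge0// ler_pM.
rewrite !big_cons; set a := F _ _ _; set b := \big[_/_]_(_ <- _) _.
set a' := F i _ (y 0 i); set b' := \big[_/_]_(_ <- _) _.
rewrite (_ : a * b - a' * b' = a * (b - b') + (a - a') * b'); last by ring.
apply: (le_trans (ler_normD _ _)); rewrite [leRHS]mulrDl !normrM lerD//.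
  by rewrite -mulrA ler_pM//; [exact: HC|exact: HL].
rewrite mulrAC ler_pM//; last exact: HB.
apply: (le_trans (lip _ _)); rewrite ler_wpM2l//.
by have := rV_norm_coord (z - y) i; rewrite !mxE.
Qed.

Definition incr_index (k : 'I_n -> nat) (i : 'I_n) : 'I_n -> nat :=
  fun j => if j == i then (k j).+1 else k j.

Lemma tensor_taylor k i : exists2 B, 0 <= B & forall z h,
  `|tensor F k (z + h *: delta_mx 0 i) - tensor F k z -
     h * tensor F (incr_index k i) z| <= B * h ^+ 2.
Proof.
pose k' j := if j == i then 0%N else k j.
have [B B0 HB] : exists2 B, 0 <= B & forall z : E, `|\prod_(j < n | j != i) F j (k j) (z 0 j)| <= B.
  elim: (index_enum _) => [|j r [B B0 HB]]; first by exists 1 => // z; rewrite big_nil normr1.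
  have [C HC] := bF j (k j); have C0 : 0 <= C by apply: le_trans (HC 0).
  exists (C * B + B); first by rewrite addr_ge0// mulr_ge0.
  move=> z; rewrite big_cons; case: ifP => _; last by rewrite ler_wpDl// mulr_ge0.
  by rewrite normrM ler_wpDr// ler_pM.
have [C HC] := bF i (k i).+2; have C0 : 0 <= C by apply: le_trans (HC 0).
exists (C * B) => [|z h]; first exact: mulr_ge0.
have tE kk y : tensor F kk y = F i (kk i) (y 0 i) * \prod_(j < n | j != i) F j (kk j) (y 0 j).
  by rewrite /tensor (bigD1 i).
rewrite !tE !mxE !eqxx mulr1.
have -> : incr_index k i i = (k i).+1 by rewrite /incr_index eqxx.
rewrite (eq_bigr (fun j => F j (k j) (z 0 j))); last first.
  by move=> j ji; rewrite !mxE eqxx/= (negbTE ji) mulr0 addr0.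
rewrite [X in h * (_ * X)](eq_bigr (fun j => F j (k j) (z 0 j))); last first.
  by move=> j ji; rewrite /incr_index (negbTE ji).
set P := \prod_(_ < _ | _) _.
rewrite (_ : _ - _ = (F i (k i) (z 0 i + h) - F i (k i) (z 0 i) - h * F i (k i).+1 (z 0 i)) * P); last by ring.
rewrite normrM mulrAC ler_pM//; last exact: HB.
exact: is_derive_taylor (dF i (k i)) (dF i (k i).+1) HC _ _.
Qed.

Variable w : E -> R.
Hypothesis lw : mu.-integrable setT (EFin \o w).

Definition tensor_conv k (x : E) : R := \int[mu]_y (tensor F k (x - y) * w y).

Lemma L1_tensor_conv k x : mu.-integrable setT (EFin \o (fun y => tensor F k (x - y) * w y)).
Proof.
have [B B0 [HB _]] := tensor_bounded_lipschitz k.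
apply: (@le_L1 _ _ _ _ _ (fun y => B * `|w y|)).
- apply: measurable_funM; last exact: L1_measurable lw.
  apply: measurable_tensor => i.
  rewrite (_ : (fun z => _) = (fun z : E => x 0 i - rV_coord i z)); last by apply/funext => z; rewrite !mxE.
  by apply: measurable_funB => //; exact: measurable_rV_coord.
- by move=> y; rewrite normrM ler_wpM2r.
- exact/L1Z/L1_norm.
Qed.

Lemma tensor_conv_continuous k : continuous (tensor_conv k).
Proof.
have [B B0 [_ HL]] := tensor_bounded_lipschitz k.
have lip x x' : `|tensor_conv k x - tensor_conv k x'| <= B * (\int[mu]_y `|w y|) * `|x - x'|.
  rewrite /tensor_conv -RintegralB//; [|exact: L1_tensor_conv|exact: L1_tensor_conv].
  rewrite mulrAC -RintegralZl//; last exact: L1_norm.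
  apply: Rintegral_norm_le.
  - by apply: L1B; exact: L1_tensor_conv.
  - exact/L1Z/L1_norm.
  - move=> y; rewrite -mulrBl normrM ler_wpM2r//.
    by rewrite (le_trans (HL _ _))// opprB addrA subrK.
set C := B * _ in lip.
have C0 : 0 <= C by rewrite mulr_ge0//; apply: Rintegral_ge0.
exact: lipschitz_continuous_rV C0 lip.
Qed.

(** Integrating the uniform Taylor remainder of the kernel against [w] gives an error C h^2, hence
    the difference quotient converges to the convolution with the differentiated kernel. *)
Lemma is_derive_tensor_conv k i x :
  is_derive x (delta_mx 0 i) (tensor_conv k) (tensor_conv (incr_index k i) x).
Proof.
have [B B0 HB] := tensor_taylor k i.
set C := B * (\int[mu]_y `|w y|).
have C0 : 0 <= C by rewrite mulr_ge0//; apply: Rintegral_ge0.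
have key h : `|tensor_conv k (x + h *: delta_mx 0 i) - tensor_conv k x -
     h * tensor_conv (incr_index k i) x| <= C * h ^+ 2.
  have L0 := L1_tensor_conv k x; have L1' := L1_tensor_conv k (x + h *: delta_mx 0 i).
  have L2 := L1_tensor_conv (incr_index k i) x.
  rewrite /tensor_conv -RintegralB// -RintegralZl//.
  rewrite -RintegralB//; [|exact: L1B|exact: L1Z].
  rewrite /C mulrAC -RintegralZl//; last exact: L1_norm.
  apply: Rintegral_norm_le.
  - by apply: L1B; [exact: L1B|exact: L1Z].
  - exact/L1Z/L1_norm.
  - move=> y; rewrite mulrA -!mulrBl normrM ler_wpM2r//.
    by have := HB (x - y) h; rewrite (addrAC x (- y)).
have cv : h^-1 *: ((tensor_conv k \o shift x) (h *: delta_mx 0 i) - tensor_conv k x) @[h --> 0^'] -->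
    tensor_conv (incr_index k i) x.
  apply/cvgrPdist_le => e e0.
  have C1 : 0 < C + 1 by rewrite ltr_wpDl.
  have d0 : 0 < e / (C + 1) by rewrite divr_gt0.
  near=> h.
  have h0 : h != 0 by near: h; exact: nbhs_dnbhs_neq.
  rewrite /= distrC [h *: _ + x]addrC.
  rewrite (_ : _ - _ = h^-1 * (tensor_conv k (x + h *: delta_mx 0 i) - tensor_conv k x -
     h * tensor_conv (incr_index k i) x)); last first.
    by rewrite /GRing.scale/= [RHS]mulrBr [h^-1 * (h * _)]mulKf.
  rewrite normrM normfV ler_pdivrMl ?normr_gt0//.
  apply: (le_trans (key h)); rewrite -(real_normK (num_real h)) expr2 mulrCA ler_wpM2l//.
  apply: (@le_trans _ _ ((C + 1) * (e / (C + 1)))); last by rewrite mulrC divfK// gt_eqF.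
  rewrite ler_pM//; first by rewrite lerDl.
  near: h; exact: dnbhs0_le.
apply: DeriveDef; first exact: cvgP cv.
exact: cvg_lim cv.
Unshelve. all: by end_near. Qed.

Lemma smooth_tensor_conv k : smooth (tensor_conv k).
Proof.
have itE l : exists k', iter_partial l (tensor_conv k) = tensor_conv k'.
  elim: l => [|i l [k' /= ->]]; first by exists k.
  exists (incr_index k' i); apply/funext => x.
  by case: (is_derive_tensor_conv k' i x).
move=> l; have [k' ->] := itE l; split; first exact: tensor_conv_continuous.
by move=> x i; case: (is_derive_tensor_conv k' i x).
Qed.

End tensor_kernel.

Section mollifier.
Context {R : realType} {n : nat}.
Local Notation E := 'rV[R]_n.
Local Notation mu := (@lebesgue_rV R n).
Local Notation "'L1 f" := (mu.-integrable setT (EFin \o f)) (at level 10, f at next level).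

(** Tonelli's theorem gives measurability for nonnegative integrands; [g] is the difference of two
    of them, g plus its modulus and its modulus. *)
Lemma measurable_Rintegral_param d (T : measurableType d) (g : T * E -> R) :
  measurable_fun setT g -> (forall x, 'L1 (fun y => g (x, y))) ->
  measurable_fun setT (fun x => \int[mu]_y g (x, y)).
Proof.
move=> mg lg.
have mabs : measurable_fun setT (fun z => `|g z|) by exact: measurableT_comp.
rewrite (_ : (fun x => _) = (fun x => \int[mu]_y (g (x, y) + `|g (x, y)|) - \int[mu]_y `|g (x, y)|)); last first.
  apply/funext => x; rewrite RintegralD//; first by ring.
  exact: L1_norm.
have pos (f : T * E -> R) : measurable_fun setT f -> (forall z, 0 <= f z) ->
    measurable_fun setT (fun x => \int[mu]_y f (x, y)).
  move=> mf f0; apply: (@measurableT_comp _ _ _ _ _ _ fine _ (fun x => \int[mu]_y (f (x, y))%:E)%E) => //.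
  apply: (measurable_fun_fubini_tonelli_F (EFin \o f)); first exact/measurable_EFinP.
  by move=> z; rewrite lee_fin.
apply: measurable_funB; last exact: (pos (fun z => `|g z|)).
apply: (pos (fun z => g z + `|g z|)); first exact: measurable_funD.
by move=> z; rewrite -(opprK (g z)) addrC subr_ge0 opprK -normrN ler_norm.
Qed.

(** The kernel is centred at [c], so that mollifying also translates. Its support is a ball of the
    sup norm, that is a cube, which suits a product of one-dimensional bumps. *)
Lemma exists_mollifier (c : E) (eta : R) : 0 < eta -> exists (rho : E -> R) (B : R),
  [/\ measurable_fun setT rho /\ (forall h, 0 <= rho h <= B),
      'L1 rho, \int[mu]_h rho h = 1,
      forall h, rho h != 0 -> `|h - c| < eta &
      forall w, 'L1 w -> smooth (fun x => \int[mu]_y (rho (y - x) * w y))].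
Proof.
move=> eta0; have [phi [dphi bphi phi0 phiN phiP]] := @exists_bump R.
(* The kernel is evaluated at - h, whence the sign in [t + c 0 i]: the bump at - h i is nonzero
   where h i is within eta of c i. The powers of 1 / eta come from the chain rule. *)
pose F (i : 'I_n) k t := eta^-1 ^+ k * phi k ((t + c 0 i) / eta).
have dF i k (t : R) : is_derive t 1 (F i k) (F i k.+1 t).
  have d1 : is_derive t 1 (fun t : R => (t + c 0 i) / eta) eta^-1.
    have dD := is_deriveD (@is_derive_id R R t 1) (@is_derive_cst R R R (c 0 i) t 1).
    have dM : is_derive t 1 (fun t : R => eta^-1 * (t + c 0 i)) _ := is_deriveZ eta^-1 dD.
    rewrite (_ : (fun _ => _) = (fun t : R => eta^-1 * (t + c 0 i))).
      by apply: (is_derive_eq dM); rewrite addr0 /GRing.scale/= mulr1.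
    by apply/funext => x; rewrite mulrC.
  have dC := @is_derive1_comp R (phi k) (fun t : R => (t + c 0 i) / eta) t _ _ (dphi k _) d1.
  have dM : is_derive t 1 (F i k) _ := is_deriveZ (eta^-1 ^+ k) dC.
  by apply: (is_derive_eq dM); rewrite /F /GRing.scale/= exprS; ring.
have bF i k : exists B, forall t, `|F i k t| <= B.
  have [B HB] := bphi k; exists (eta^-1 ^+ k * B) => t.
  by rewrite normrM (ger0_norm (exprn_ge0 _ _)) ?invr_ge0 ?(ltW eta0)// ler_wpM2l// exprn_ge0// invr_ge0 ltW.
pose kappa z := tensor F (fun=> 0%N) z.
have [B B0 [HB _]] := tensor_bounded_lipschitz dF bF (fun=> 0%N).
have F0 i t : F i 0%N t = phi 0%N ((t + c 0 i) / eta) by rewrite /F expr0 mul1r.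
have k0 z : 0 <= kappa z by apply: prodr_ge0 => i _; rewrite F0.
have kN (h : E) : kappa (- h) != 0 -> `|h - c| < eta.
  move=> kh; apply: rV_norm_lt => // i.
  have : F i 0%N ((- h) 0 i) != 0.
    by apply: contraNneq kh => Fi; rewrite /kappa /tensor (bigD1 i)//= Fi mul0r.
  rewrite F0; apply: contraNT; rewrite -leNgt !mxE => hc; apply/eqP/phiN.
  rewrite normrM normfV (gtr0_norm eta0) ler_pdivlMr// mul1r.
  by rewrite -normrN opprD opprK.
have kP (h : E) : (forall i, c 0 i - eta < h 0 i < c 0 i + eta) -> 0 < kappa (- h).
  move=> hc; apply: prodr_gt0 => i _; rewrite F0; apply: phiP.
  have /andP[h1 h2] := hc i.
  by rewrite mxE normrM normfV (gtr0_norm eta0) ltr_pdivrMr// mul1r ltr_norml; apply/andP; split; lra.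
have mk : measurable_fun setT (fun h : E => kappa (- h)).
  apply: (measurable_tensor dF) => i.
  rewrite (_ : (fun z => _) = (fun z : E => - rV_coord i z)); last by apply/funext => z; rewrite !mxE.
  by apply: measurableT_comp => //; exact: measurable_rV_coord.
have lk : 'L1 (fun h : E => kappa (- h)).
  apply: (@le_L1 _ _ _ _ _ (fun h => B * \1_(half_open_cube (`|c| + eta)) h)) => //; last first.
    by apply: L1Z; exact: L1_half_open_cube.
  move=> h; have [->|/kN hc] := eqVneq (kappa (- h)) 0; first by rewrite normr0 mulr_ge0.
  rewrite indicE mem_set ?mulr1; first exact: HB.
  move=> i; have := rV_norm_coord (h - c) i; have := rV_norm_coord c i; rewrite !mxE !ler_norml.
  by move=> /andP[a1 a2] /andP[a3 a4]; apply/andP; split; lra.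
pose Z := \int[mu]_h kappa (- h).
have Z0 : 0 < Z.
  rewrite lt_neqAle; apply/andP; split; last by apply: Rintegral_ge0.
  apply/negP => /eqP/esym /(Rintegral_eq0_ae lk (fun h => k0 (- h))) [N [mN N0 HN]].
  pose A := [set h : E | forall i, c 0 i - eta < h 0 i < c 0 i + eta].
  have AN : A `<=` N.
    by move=> h /kP kh; apply: HN => /= k00; move: kh; rewrite k00 ltxx.
  have mA : measurable A.
    have := @measurable_rV_box R n (fun i => `]c 0 i - eta, c 0 i + eta[%classic) (fun i => measurable_itv _).
    by congr measurable; apply/seteqP; split => x /= Hx i; have := Hx i; rewrite /= in_itv.
  have : (mu A <= 0)%E by rewrite -N0; apply: le_measure; rewrite ?inE.
  rewrite lebesgue_rV_itv_box leNgt => /negP; apply.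
  apply: (big_ind (fun x : \bar R => 0 < x)%E) => // [x y x0 y0|i _]; first exact: mule_gt0.
  by rewrite lebesgue_measure_itv/= lte_fin ltrD2l gtrN// lte_fin; lra.
exists (fun h => Z^-1 * kappa (- h)), (Z^-1 * B).
have Zi : 0 <= Z^-1 by rewrite invr_ge0 ltW.
split.
- split; first exact: measurable_funM.
  move=> h; rewrite mulr_ge0//= ler_wpM2l//.
  by rewrite (le_trans (ler_norm _))// HB.
- exact: L1Z.
- by rewrite RintegralZl// mulVf// gt_eqF.
- by move=> h; rewrite mulf_eq0 negb_or => /andP[_ /kN].
- move=> w lw; have := smooth_tensor_conv dF bF (L1Z Z^-1 lw) (fun=> 0%N).
  congr smooth; apply/funext => x; apply: eq_Rintegral => y _.
  by rewrite opprB mulrCA mulrA.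
Qed.

End mollifier.

Section mollification.
Context {R : realType} {n : nat} (p s : R).
Hypotheses (p1 : 1 < p).
Local Notation E := 'rV[R]_n.
Local Notation mu := (@lebesgue_rV R n).
Local Notation mu2 := (@lebesgue_rV2 R n).
Local Notation D := (@nonlocal_gradient R n p s).

Lemma gradient_shift (w : E -> R) h z : D w (rV2_shift h z) =
  (w (h + z.1) - w (h + z.2)) / enorm (z.1 - z.2) `^ (n%:R / p + s).
Proof.
rewrite /nonlocal_gradient /rV2_shift /=.
have -> : z.1 + h - (z.2 + h) = z.1 - z.2 by rewrite opprD addrACA subrr addr0.
by rewrite (addrC z.1 h) (addrC z.2 h).
Qed.

(** The nonlocal gradient commutes with translations, so that of v - w is the average, with weight
    [rho], of the differences between the translated gradient of w and itself. Jensen's inequality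
    and Tonelli's theorem then average the translation errors, which matter only where [rho] is
    nonzero. *)
Lemma mollification_energy (w rho : E -> R) (B e : R) :
  measurable_fun setT w -> mu.-integrable setT (EFin \o w) ->
  measurable_fun setT rho -> (forall h, 0 <= rho h <= B) ->
  mu.-integrable setT (EFin \o rho) -> \int[mu]_h rho h = 1 ->
  (forall h, rho h != 0 ->
    mu2.-integrable setT (EFin \o (fun z => `|D w (rV2_shift h z) - D w z| `^ p)) /\
    \int[mu2]_z `|D w (rV2_shift h z) - D w z| `^ p <= e) ->
  let v x := \int[mu]_y (rho (y - x) * w y) in
  [/\ measurable_fun setT v, forall x, `|v x| <= B * \int[mu]_y `|w y|,
     mu2.-integrable setT (EFin \o (fun z => `|D (fun x => v x - w x) z| `^ p)) &
     energy p s (fun x => v x - w x) <= e].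
Proof.
move=> mw lw mrho rhoB lrho irho He v.
have p0 : 0 < p := lt_trans ltr01 p1.
have rho0 h : 0 <= rho h by have /andP[] := rhoB h.
have msh x : measurable_fun setT (fun y : E => y - x) by exact: measurable_rV_shift.
have lvx x : mu.-integrable setT (EFin \o (fun y => rho (y - x) * w y)).
  apply: (@L1M_bounded _ _ _ _ w (fun y => rho (y - x)) B) => //.
    exact: (measurableT_comp mrho (msh x)).
  by move=> y; rewrite ger0_norm//; have /andP[] := rhoB (y - x).
have mv : measurable_fun setT v.
  apply: (measurable_Rintegral_param (g := fun z : E * E => rho (z.2 - z.1) * w z.2)) => //.
  apply: measurable_funM; last exact: measurableT_comp mw measurable_snd.
  suff mi : measurable_fun setT (fun z : E * E => z.2 - z.1) by exact: (measurableT_comp mrho mi).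
  apply: measurable_fun_rVP => i.
  rewrite (_ : _ \o _ = (fun z : E * E => rV_coord i z.2 - rV_coord i z.1)); last first.
    by apply/funext => z /=; rewrite /rV_coord !mxE.
  apply: measurable_funB.
    exact: measurableT_comp (measurable_rV_coord i) measurable_snd.
  exact: measurableT_comp (measurable_rV_coord i) measurable_fst.
have vE x : mu.-integrable setT (EFin \o (fun h => rho h * w (h + x))) /\
    v x = \int[mu]_h (rho h * w (h + x)).
  have mp := @measurable_rV_shift R n x; have mup := @lebesgue_rV_shift R n x.
  have := L1_preserving mp mup (lvx x); have := Rintegral_preserving mp mup (lvx x).
  rewrite /v => <- /= lp; split.
    by move: lp; congr (integrable _ _ (EFin \o _)); apply/funext => h /=; rewrite addrK.
  by apply: eq_Rintegral => h _; rewrite addrK.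
pose f z h := D w (rV2_shift h z) - D w z.
have fE z : mu.-integrable setT (EFin \o (fun h => rho h * f z h)) /\
    D (fun x => v x - w x) z = \int[mu]_h (rho h * f z h).
  have [l1 e1] := vE z.1; have [l2 e2] := vE z.2.
  pose K := enorm (z.1 - z.2) `^ (n%:R / p + s).
  have eqf : (fun h => rho h * f z h) = (fun h => K^-1 * (rho h * w (h + z.1) - rho h * w (h + z.2)) - D w z * rho h).
    apply/funext => h.
    have -> : f z h = (w (h + z.1) - w (h + z.2)) / K - D w z.
      by rewrite /f gradient_shift.
    by move: (D w z) (w _) (w _) (rho h) (K^-1) => a b c d k; ring.
  rewrite eqf; split.
    by apply: L1B; [apply: L1Z; exact: L1B|exact: L1Z].
  have l12 := L1B l1 l2.
  rewrite RintegralB//; [|exact: L1Z|exact: L1Z].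
  rewrite !RintegralZl// RintegralB// -e1 -e2 irho mulr1 gradientB [K^-1 * _]mulrC.
  by [].
have mDw := @measurable_gradient R n p s _ mw.
have mf2 : measurable_fun setT (fun zh : (E * E) * E => f zh.1 zh.2).
  apply: measurable_funB; last exact: measurableT_comp mDw measurable_fst.
  suff mi : measurable_fun setT (fun zh : (E * E) * E => rV2_shift zh.2 zh.1) by exact: (measurableT_comp mDw mi).
  have madd d (T : measurableType d) (a b : T -> E) : measurable_fun setT a -> measurable_fun setT b ->
      measurable_fun setT (fun t => a t + b t).
    move=> ma mb; apply: measurable_fun_rVP => i.
    rewrite (_ : _ \o _ = (fun t => rV_coord i (a t) + rV_coord i (b t))); last first.
      by apply/funext => t /=; rewrite /rV_coord !mxE.
    apply: measurable_funD.
      exact: measurableT_comp (measurable_rV_coord i) ma.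
    exact: measurableT_comp (measurable_rV_coord i) mb.
  apply: measurable_fun_pair; apply: madd => //.
    exact: measurableT_comp measurable_fst measurable_fst.
  exact: measurableT_comp measurable_snd measurable_fst.
have mfz z : measurable_fun setT (f z).
  exact: (measurableT_comp mf2 (measurable_pair1 z)).
pose g (zh : (E * E) * E) := rho zh.2 * `|f zh.1 zh.2| `^ p.
have mg : measurable_fun setT g.
  apply: measurable_funM; first exact: measurableT_comp mrho measurable_snd.
  apply: measurableT_comp (measurable_powR _) _; exact: measurableT_comp.
have g0 zh : 0 <= g zh by rewrite mulr_ge0 ?powR_ge0.
have jen z : ((`|D (fun x => v x - w x) z| `^ p)%:E <= \int[mu]_h (g (z, h))%:E)%E.
  have [l1 e1] := fE z.
  have := @jensen_powR _ _ _ mu p rho (f z) p1 rho0 lrho irho (mfz z) l1.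
  by rewrite -e1.
have mDv : measurable_fun setT (fun z => `|D (fun x => v x - w x) z| `^ p).
  apply: measurableT_comp (measurable_powR _) _.
  apply: measurableT_comp => //; apply: measurable_gradient; exact: measurable_funB.
have e0 : 0 <= e.
  have [[h /He[_ eh]]|rn] := pselect (exists h, rho h != 0).
    by apply: le_trans eh; apply: Rintegral_ge0 => z _; exact: powR_ge0.
  have rh0 : rho = fun=> 0.
    by apply/funext => h; apply/eqP/negPn/negP => rh; apply: rn; exists h.
  by move: irho; rewrite rh0 Rintegral0 => /eqP; rewrite eq_sym oner_eq0.
have tot : (\int[mu2]_z (`|D (fun x => v x - w x) z| `^ p)%:E <= e%:E)%E.
  apply: (@le_trans _ _ (\int[mu2]_z \int[mu]_h (g (z, h))%:E)%E).
    apply: ge0_le_integral => //.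
    - exact/measurable_EFinP.
    - by apply: (measurable_fun_fubini_tonelli_F (EFin \o g)); [exact/measurable_EFinP|move=> z; rewrite lee_fin].
  have := @fubini_tonelli _ _ _ _ _ (@sigma_finite_rV2 R n) mu (EFin \o g).
  move=> /= ->; [|exact/measurable_EFinP|by move=> z; rewrite lee_fin].
  have -> : (e%:E = \int[mu]_h (e * rho h)%:E)%E.
    by rewrite -Rintegral_EFin ?RintegralZl ?irho ?mulr1//; exact: L1Z.
  apply: ge0_le_integral => //.
  - by move=> h _; apply: integral_ge0 => z _; rewrite lee_fin.
  - by apply: (@measurable_fun_fubini_tonelli_G _ _ _ _ _ (@sigma_finite_rV2 R n) (EFin \o g)); [exact/measurable_EFinP|move=> z; rewrite lee_fin].
  - by apply/measurable_EFinP; exact: measurable_funM.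
  - move=> h _; rewrite /g /=.
    have [->|rh] := eqVneq (rho h) 0.
      by rewrite mulr0 integral0_eq// => z _; rewrite mul0r.
    have [lh eh] := He h rh.
    under eq_integral do rewrite EFinM.
    rewrite ge0_integralZl//; last by rewrite lee_fin.
      rewrite (mulrC e) EFinM; apply: lee_wpmul2l; first by rewrite lee_fin.
      by rewrite -Rintegral_EFin// lee_fin.
    by have /measurable_EFinP := L1_measurable lh.
have L1D : mu2.-integrable setT (EFin \o (fun z => `|D (fun x => v x - w x) z| `^ p)).
  apply: L1_fin_norm => //.
  under eq_integral do rewrite ger0_norm ?powR_ge0//.
  by apply: le_lt_trans tot _; exact: ltry.
split => //.
- move=> x; rewrite -RintegralZl//; last exact: L1_norm.
  apply: Rintegral_norm_le => //; first exact/L1Z/L1_norm.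
  by move=> y; rewrite normrM ler_wpM2r// ger0_norm//; have /andP[] := rhoB (y - x).
- by rewrite -lee_fin /energy Rintegral_EFin.
Qed.

End mollification.

(** * Multiplication by cutoff functions *)

Section cutoff.
Context {R : realType} {n : nat} (p s : R).
Hypotheses (p1 : 1 < p) (s01 : 0 < s < 1).
Local Notation E := 'rV[R]_n.
Local Notation mu := (@lebesgue_rV R n).
Local Notation mu2 := (@lebesgue_rV2 R n).
Local Notation q := (n%:R + s * p).

Let p0 : 0 < p. Proof. exact: lt_trans ltr01 p1. Qed.
Let s0 : 0 < s. Proof. by case/andP: s01. Qed.
Let sp0 : 0 < p - s * p.
Proof. by rewrite subr_gt0 gtr_pMl//; case/andP: s01. Qed.
Let q0 : 0 < q. Proof. by rewrite ltr_wpDl// mulr_gt0. Qed.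

Lemma lebesgue_half_open_cube (t : R) : 0 < t ->
  mu (half_open_cube t) = ((t *+ 2) ^+ n)%:E.
Proof.
move=> t0; rewrite (_ : half_open_cube t = [set x : E | forall i, `[- t, t[%classic (x 0 i)]); last first.
  by apply/seteqP; split => x /= Hx i; have := Hx i; rewrite /= in_itv.
rewrite (@lebesgue_rV_box R n (fun i => `[- t, t[%classic))//.
under eq_bigr do rewrite lebesgue_measure_itv/= lte_fin gtrN//.
under eq_bigr do rewrite -EFinD opprK -mulr2n.
by rewrite prodEFin prodr_const card_ord.
Qed.

(** Up to the factor L^p this bounds the p-th power of the nonlocal gradient of an L-Lipschitz
    function at points closer than [r]. *)
Definition truncated_kernel (r : R) (h : E) : R :=
  if enorm h < r then enorm h `^ p / enorm h `^ q else 0.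

Lemma truncated_kernel_ge0 r h : 0 <= truncated_kernel r h.
Proof. by rewrite /truncated_kernel; case: ifP => // _; rewrite divr_ge0 ?powR_ge0. Qed.

Lemma measurable_truncated_kernel r : measurable_fun setT (truncated_kernel r).
Proof.
have me : measurable_fun setT (fun h : E => enorm h).
  by apply: measurable_enorm => i; exact: measurable_rV_coord.
apply: measurable_fun_ifT => //.
  by apply: measurable_fun_ltr => //.
rewrite (_ : (fun x => _) = (fun h : E => enorm h `^ p * enorm h `^ (- q))); last first.
  by apply/funext => h; rewrite powRN.
by apply: measurable_funM; exact: measurableT_comp (measurable_powR _) me.
Qed.

(** On the dyadic shell between [t j.+1] and [t j] the kernel is at most [c j], and the shell lies
    in a cube of half side [t j]. The resulting series is geometric of ratio 2^-(p - s p), less than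
    1 because s < 1. *)
Lemma L1_truncated_kernel r : 0 < r -> mu.-integrable setT (EFin \o truncated_kernel r).
Proof.
move=> r0; pose t j := r * 2^-1 ^+ j.
have t0 j : 0 < t j by rewrite mulr_gt0// exprn_gt0// invr_gt0.
pose c j := t j `^ p / (t j / 2) `^ q.
have c0 j : 0 <= c j by rewrite divr_ge0 ?powR_ge0.
pose f (j : nat) (h : E) : \bar R := (c j * \1_(half_open_cube (t j)) h)%:E.
have f0 j h : (0 <= f j h)%E by rewrite lee_fin mulr_ge0.
have mf j : measurable_fun setT (f j).
  apply/measurable_EFinP; apply: measurable_funM => //.
  by apply: measurable_indic; exact: measurable_half_open_cube.
pose a := 2 ^+ n * 2 `^ q * r `^ (p - s * p).
pose x := 2^-1 `^ (p - s * p) : R.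
have if_ j : (\int[mu]_h f j h = (a * x ^+ j)%:E)%E.
  have [lc ic] : mu.-integrable setT (EFin \o (fun h => c j * \1_(half_open_cube (t j)) h)) /\
      \int[mu]_h (c j * \1_(half_open_cube (t j)) h) = c j * (t j *+ 2) ^+ n.
    split; first by apply: L1Z; exact: L1_half_open_cube.
    rewrite RintegralZl//; last exact: L1_half_open_cube.
    congr (_ * _); rewrite /Rintegral integral_indic//; last exact: measurable_half_open_cube.
    by rewrite setIT; exact: (congr1 fine (lebesgue_half_open_cube (t0 j))).
  rewrite -Rintegral_EFin// ic; congr _%:E.
  have tE : t j `^ (n%:R + p - q) = r `^ (p - s * p) * x ^+ j.
    rewrite (_ : n%:R + p - q = p - s * p); last by ring.
    rewrite powRM ?(ltW r0)// ?exprn_ge0// ?invr_ge0//; congr (_ * _).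
    have pX (y b : R) : 0 <= y -> (y ^+ j) `^ b = (y `^ b) ^+ j.
      move=> y0; elim: (j) => [|m IH]; first by rewrite !expr0 powR1.
      by rewrite !exprS powRM ?IH// exprn_ge0.
    by apply: pX; rewrite invr_ge0.
  rewrite /a -[RHS]mulrA -tE /c.
  have pE (y Q : R) : 0 < y -> y `^ (n%:R + p - Q) = y ^+ n * y `^ p / y `^ Q.
    move=> y0; have yN : y != 0 by rewrite gt_eqF.
    rewrite powRD; last by rewrite yN implybT.
    by rewrite powRD ?powR_mulrn ?powRN ?(ltW y0)// yN implybT.
  have hE (y Q : R) : 0 <= y -> (y / 2) `^ Q = y `^ Q / 2 `^ Q.
    move=> y0; rewrite powRM ?invr_ge0//; congr (_ * _).
    by rewrite -powR_inv1// -powRrM mulN1r powRN.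
  rewrite pE//; move: (t j) (t0 j) q => y y0 Q; rewrite hE ?(ltW y0)//.
  have -> : y *+ 2 = 2 * y by rewrite mulr_natl.
  rewrite exprMn.
  have : 2 `^ Q != 0 :> R by rewrite gt_eqF// powR_gt0.
  have : y `^ Q != 0 by rewrite gt_eqF// powR_gt0.
  move: (y `^ Q) (2 `^ Q) (2 ^+ n) (y ^+ n) (y `^ p) => A B C G H A0 B0.
  by field; rewrite A0 B0.
have x0 : 0 < x by rewrite powR_gt0// invr_gt0.
have x1 : x < 1.
  have : 2^-1 `^ (p - s * p) < 1 `^ (p - s * p) :> R.
    by apply: gt0_ltr_powR; rewrite // ?nnegrE ?invr_ge0// invf_lt1// ltr1n.
  by rewrite powR1.
have a0 : 0 <= a by rewrite !mulr_ge0 ?powR_ge0// exprn_ge0.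
apply: L1_fin_norm; first exact: measurable_truncated_kernel.
apply: (@le_lt_trans _ _ (\int[mu]_h (\sum_(0 <= j <oo) f j h))%E).
  apply: ge0_le_integral => //.
  - by apply/measurable_EFinP; apply: measurableT_comp => //; exact: measurable_truncated_kernel.
  - exact: ge0_emeasurable_sum.
  move=> h _; rewrite ger0_norm ?truncated_kernel_ge0// /truncated_kernel.
  case: ifPn => [hr|_]; last exact: nneseries_ge0.
  have [e0|eN0] := eqVneq (enorm h) 0.
    by rewrite e0 powR0 ?mul0r ?gt_eqF//; exact: nneseries_ge0.
  have ep : 0 < enorm h by rewrite lt_neqAle eq_sym eN0 enorm_ge0.
  have [j /andP[h1 h2]] : exists j, t j.+1 <= enorm h < t j.
    have exN : exists N, t N <= enorm h.
      have h21 : `|2^-1 : R| < 1 by rewrite ger0_norm ?invr_ge0// invf_lt1// ltr1n.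
      have /cvgr0_norm_le /(_ _ ep) [N _ /(_ N (leqnn N))] := @cvg_geometric R r _ h21.
      by exists N; apply: le_trans (ler_norm _) _.
    have := ex_minnP exN => -[[|N] tN mN].
      by move: tN; rewrite /t expr0 mulr1 leNgt hr.
    by exists N; rewrite tN ltNge; apply/negP => /mN; rewrite ltnn.
  apply: (@le_trans _ _ (f j h)); last first.
    apply: le_trans (@nneseries_lim_ge _ (f^~ h) xpredT 0 j.+1 _) => //.
    by rewrite big_nat_recr//= leeDr// sume_ge0.
  rewrite lee_fin /f indicE mem_set ?mulr1; last first.
    move=> i; have := le_trans (rV_norm_coord h i) (norm_le_enorm h).
    by rewrite ler_norml => /andP[h3 h4]; apply/andP; split; lra.
  rewrite /c ler_pM ?powR_ge0 ?invr_ge0 ?powR_ge0//.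
    by apply: ge0_ler_powR; rewrite ?nnegrE ?enorm_ge0 ?ltW.
  rewrite lef_pV2 ?posrE ?powR_gt0 ?divr_gt0//.
  apply: ge0_ler_powR; rewrite ?nnegrE ?enorm_ge0 ?(ltW q0) ?divr_ge0 ?(ltW (t0 j))//.
  by move: h1; rewrite /t exprS [2^-1 * _]mulrC mulrA.
rewrite integral_nneseries//.
under eq_eseriesr do rewrite if_.
apply: (@le_lt_trans _ _ (a / (1 - x))%:E); last exact: ltry.
apply: lime_le; first by apply: is_cvg_nneseries => j _ _; rewrite lee_fin mulr_ge0// exprn_ge0// ltW.
apply: nearW => N; rewrite sumEFin lee_fin.
by have := @geometric_le_lim R N a x a0 x0; rewrite gtr0_norm// => /(_ x1).
Qed.

Lemma L1_weighted_kernel (u : E -> R) r : 0 < r -> mu.-integrable setT (EFin \o u) ->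
  mu2.-integrable setT (EFin \o (fun z => u z.2 * truncated_kernel r (z.1 - z.2))).
Proof.
move=> r0 lu; have mu_ := L1_measurable lu; have lk := L1_truncated_kernel r0.
have mk : measurable_fun setT (fun z : E * E => truncated_kernel r (z.1 - z.2)).
  suff mi : measurable_fun setT (fun z : E * E => z.1 - z.2) by exact: (measurableT_comp (measurable_truncated_kernel r) mi).
  apply: measurable_fun_rVP => i.
  rewrite (_ : _ \o _ = (fun z : E * E => rV_coord i z.1 - rV_coord i z.2)); last first.
    by apply/funext => z /=; rewrite /rV_coord !mxE.
  apply: measurable_funB.
    exact: measurableT_comp (measurable_rV_coord i) measurable_fst.
  exact: measurableT_comp (measurable_rV_coord i) measurable_snd.
have mf : measurable_fun setT (fun z : E * E => u z.2 * truncated_kernel r (z.1 - z.2)).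
  by apply: measurable_funM => //; exact: measurableT_comp mu_ measurable_snd.
apply: L1_fin_norm => //.
rewrite (@fubini_tonelli2 _ _ _ _ _ mu mu (fun z => `|u z.2 * truncated_kernel r (z.1 - z.2)|%:E)); last 2 first.
- by apply/measurable_EFinP; exact: measurableT_comp.
- by move=> z; rewrite lee_fin.
rewrite /fubini_G/= (eq_integral (fun y => (\int[mu]_h truncated_kernel r h)%:E * `|u y|%:E)%E); last first.
  move=> y _; rewrite -[in RHS](@Rintegral_preserving _ _ _ mu (fun x => x - y) (@measurable_rV_shift R n (- y)) (@lebesgue_rV_shift R n (- y)))//.
  have lky : mu.-integrable setT (EFin \o (fun x => truncated_kernel r (x - y))).
    exact: (L1_preserving (@measurable_rV_shift R n (- y)) (@lebesgue_rV_shift R n (- y)) lk).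
  rewrite Rintegral_EFin// -ge0_integralZr//; first last.
  - by move=> x _; rewrite lee_fin truncated_kernel_ge0.
  - by have /measurable_EFinP := L1_measurable lky.
  by apply: eq_integral => x _; rewrite -EFinM normrM (ger0_norm (truncated_kernel_ge0 _ _)) mulrC.
have lu' := L1Z (\int[mu]_h truncated_kernel r h) (L1_norm lu).
under eq_integral do rewrite -EFinM.
by rewrite -Rintegral_EFin// ltry.
Qed.

End cutoff.

Section cutoff_multiplication.
Context {R : realType} {n : nat} (p s : R).
Hypotheses (p1 : 1 < p) (s01 : 0 < s < 1).
Local Notation E := 'rV[R]_n.
Local Notation D := (@nonlocal_gradient R n p s).

Let p0 : 0 < p. Proof. exact: lt_trans ltr01 p1. Qed.

Definition clamp (x0 : E) (r : R) (x : E) : R :=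
  Num.min 1 (Num.max 0 (2 - 2 * `|x - x0| / r)).

Lemma measurable_rV_norm : measurable_fun setT (fun x : E => `|x|).
Proof.
rewrite (_ : (fun x => _) = (fun x : E => \big[Num.max/0]_(ij : 'I_1 * 'I_n) `|x ij.1 ij.2|)); last first.
  by apply/funext => x; rewrite /Num.norm/= mx_normrE.
elim: (index_enum _) => [|ij r IH].
  by rewrite (_ : (fun x => _) = cst 0)//; apply/funext => x; rewrite big_nil.
rewrite (_ : (fun x => _) = (fun x : E => `|rV_coord ij.2 x|) \max (fun x : E => \big[Num.max/0]_(i <- r) `|x i.1 i.2|)).
  by apply: measurable_maxr => //; apply: measurableT_comp => //; exact: measurable_rV_coord.
by apply/funext => x; rewrite big_cons /= /rV_coord (ord1 ij.1).
Qed.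

Lemma measurable_clamp x0 r : measurable_fun setT (clamp x0 r).
Proof.
rewrite (_ : clamp x0 r = cst 1 \min (cst 0 \max (fun x : E => 2 - 2 * `|x - x0| / r)))//.
apply: measurable_minr => //; apply: measurable_maxr => //.
apply: measurable_funB => //; apply: measurable_funM => //; apply: measurable_funM => //.
exact: (measurableT_comp measurable_rV_norm (measurable_rV_shift (- x0))).
Qed.

Lemma clamp_ge0_le1 x0 r x : 0 <= clamp x0 r x <= 1.
Proof. by rewrite /clamp ge_min lexx le_min ler01 le_max lexx. Qed.

Lemma clamp1 x0 r x : 0 < r -> `|x - x0| <= r / 2 -> clamp x0 r x = 1.
Proof.
move=> r0 xr; rewrite /clamp; apply/min_idPl; rewrite le_max; apply/orP; right.
have : 2 * `|x - x0| / r <= 1 by rewrite ler_pdivrMr//; lra.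
by lra.
Qed.

Lemma clamp0 x0 r x : 0 < r -> r <= `|x - x0| -> clamp x0 r x = 0.
Proof.
move=> r0 xr; rewrite /clamp (_ : Num.max 0 _ = 0); first by apply/min_idPr.
apply/max_idPl; have : 2 <= 2 * `|x - x0| / r by rewrite ler_pdivlMr//; lra.
by lra.
Qed.

Lemma clamp_lipschitz x0 r x y : 0 < r ->
  `|clamp x0 r x - clamp x0 r y| <= 2 / r * enorm (x - y).
Proof.
move=> r0; apply: (@le_trans _ _ (2 / r * `|x - y|)); last first.
  by rewrite ler_wpM2l ?norm_le_enorm// divr_ge0// ltW.
have Hmax (a b : R) : `|Num.max 0 a - Num.max 0 b| <= `|a - b|.
  have := ler_norm (a - b); have := ler_norm (- (a - b)); rewrite normrN.
  by case: (leP 0 a) => ?; case: (leP 0 b) => ? *; rewrite ler_norml; apply/andP; split; lra.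
have Hmin (a b : R) : `|Num.min 1 a - Num.min 1 b| <= `|a - b|.
  have := ler_norm (a - b); have := ler_norm (- (a - b)); rewrite normrN.
  by case: (leP 1 a) => ?; case: (leP 1 b) => ? *; rewrite ler_norml; apply/andP; split; lra.
apply: (le_trans (Hmin _ _)); apply: (le_trans (Hmax _ _)).
rewrite (_ : _ - _ = 2 / r * (`|y - x0| - `|x - x0|)); last by ring.
rewrite normrM ger0_norm ?divr_ge0 ?(ltW r0)// ler_wpM2l ?divr_ge0 ?(ltW r0)//.
apply: (le_trans (ler_dist_dist _ _)).
by rewrite opprB addrA subrK distrC.
Qed.

Variable Omega : set E.
Hypothesis bOmega : bounded_set Omega.

(** For close points the product rule gives the gradient of w and a term in the gradient of chi,
    integrable by [L1_weighted_kernel]. For distant points at most one of them is in [Omega], so the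
    difference of the products is at most that of w. *)
Lemma W0sp_cutoff (w chi : E -> R) L : 0 <= L -> measurable_fun setT chi ->
  (forall x, 0 <= chi x <= 1) -> (forall x y, `|chi x - chi y| <= L * enorm (x - y)) ->
  W0sp p s Omega w -> W0sp p s Omega (fun x => chi x * w x).
Proof.
move=> L0 mchi chi01 lchi [Ww w0]; have /(WspP s p1)[mw lw lDw] := Ww.
have mcw : measurable_fun setT (fun x => chi x * w x) by exact: measurable_funM.
split; last by apply: filterS w0 => x wx nx; rewrite wx// mulr0.
have chin x : `|chi x| <= 1 by have /andP[c0 c1] := chi01 x; rewrite ger0_norm.
apply/(WspP s p1); split => //.
  apply: (le_L1 _ _ lw).
    by apply: measurableT_comp (measurable_powR _) _; exact: measurableT_comp.
  move=> x; rewrite ger0_norm ?powR_ge0// ge0_ler_powR ?nnegrE ?(ltW p0)//.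
  by rewrite normrM ler_piMl.
have [M M0 OM] : exists2 M : R, 0 < M & forall x, Omega x -> `|x| <= M.
  have [M [_ HM]] := bOmega; exists (`|M| + 1) => [|x Ox]; first by rewrite ltr_wpDl.
  by apply: HM Ox; rewrite (le_lt_trans (ler_norm _))// ltrDl.
(* This exceeds the Euclidean diameter of [Omega]. *)
pose r := n%:R * (M + M) + 1.
have r0 : 0 < r by rewrite ltr_wpDl// mulr_ge0// addr_ge0// ltW.
have lk := @L1_weighted_kernel R n p s p1 s01 _ _ r0 lw.
have := L1Z (2 `^ p) (L1D lDw (L1Z (L `^ p) lk)).
apply: le_L1_ae.
  apply: measurableT_comp (measurable_powR _) _; apply: measurableT_comp => //.
  exact: measurable_gradient.
apply: filterS (ae_rV2 w0) => z [z1 z2].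
rewrite ger0_norm ?powR_ge0//.
set K := enorm (z.1 - z.2) `^ (n%:R / p + s).
have K0 : 0 <= K by exact: powR_ge0.
have kp : 0 <= L `^ p * (`|w z.2| `^ p * @truncated_kernel R n p s r (z.1 - z.2)).
  by rewrite !mulr_ge0 ?powR_ge0// truncated_kernel_ge0.
have le1 (a : R) : 0 <= a -> a <= 2 `^ p * a.
  move=> a0; rewrite ler_peMl//; have := @ler_powR R 2 _ 0 p.
  by rewrite powRr0 => -> //; [rewrite ler1n|exact: ltW].
have [er|er] := ltP (enorm (z.1 - z.2)) r; last first.
  have [wz2|wz2] := eqVneq (w z.2) 0; last first.
    have wz1 : w z.1 = 0.
      apply: z1 => O1; have O2 : Omega z.2 by apply: contrapT => /z2 /eqP; rewrite (negbTE wz2).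
      move: er; rewrite leNgt => /negP; apply; rewrite /r.
      apply: (le_lt_trans (enorm_le_norm _)); rewrite ltr_pwDr// ler_wpM2l//.
      by rewrite (le_trans (ler_normB _ _))// lerD// OM.
    apply: (@le_trans _ _ (`|D w z| `^ p)); last first.
      by rewrite (le_trans (le1 _ (powR_ge0 _ _)))// ler_wpM2l ?powR_ge0// lerDl.
    rewrite ge0_ler_powR ?nnegrE ?(ltW p0)// /nonlocal_gradient wz1 mulr0 !sub0r -/K !normrM !normrN normrM.
    by rewrite ler_wpM2r// ler_piMl.
  apply: (@le_trans _ _ (`|D w z| `^ p)); last first.
    by rewrite (le_trans (le1 _ (powR_ge0 _ _)))// ler_wpM2l ?powR_ge0// lerDl.
  rewrite ge0_ler_powR ?nnegrE ?(ltW p0)// /nonlocal_gradient wz2 mulr0 !subr0 -/K !normrM.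
  by rewrite ler_wpM2r// ler_piMl.
have -> : D (fun x => chi x * w x) z = chi z.1 * D w z + w z.2 * D chi z.
  by rewrite /nonlocal_gradient -/K; ring.
apply: (le_trans (powR_normD _ _ p0)); rewrite ler_wpM2l ?powR_ge0// lerD//.
  by rewrite ge0_ler_powR ?nnegrE ?(ltW p0)// normrM ler_piMl.
rewrite normrM powRM// mulrCA ler_wpM2l ?powR_ge0// gradient_powR// /truncated_kernel er.
rewrite mulrA ler_wpM2r ?invr_ge0 ?powR_ge0// -powRM ?enorm_ge0//.
by rewrite ge0_ler_powR ?nnegrE ?mulr_ge0 ?enorm_ge0 ?(ltW p0).
Qed.

End cutoff_multiplication.

(** * Density of test functions *)

Section inward_translation.
Context {R : realType} {n : nat}.
Local Notation E := 'rV[R]_n.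
Implicit Types (x y z h c : E) (Omega : set E).

Lemma nbhs_rV x (A : set E) : nbhs x A <-> exists2 r : R, 0 < r & forall y, `|y - x| < r -> A y.
Proof.
split=> [/nbhs_ballP[r r0 H]|[r r0 H]].
  by exists r => // y yx; apply: H; rewrite -ball_normE /= distrC.
apply/nbhs_ballP; exists r => // y; rewrite -ball_normE /= distrC; exact: H.
Qed.

Lemma mulmx_norm_le (Q : 'M[R]_n) : exists2 C : R, 0 <= C & forall x j, `|(x *m Q) 0 j| <= C * `|x|.
Proof.
exists (\sum_i \sum_j `|Q i j|); first by apply: sumr_ge0 => i _; apply: sumr_ge0.
move=> x j; rewrite mxE (le_trans (ler_norm_sum _ _ _))// mulr_suml ler_sum// => i _.
rewrite normrM mulrC ler_pM ?rV_norm_coord//.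
by rewrite (bigD1 j)//= lerDl sumr_ge0.
Qed.

(** In the chart, [Omega] is where the Lipschitz function [g] is negative, and moving by t along the
    direction [d] lowers [g] by exactly t. This gain outweighs the variation caused by a deviation
    of h from c; such a whole ball of translations is what a kernel centred at c requires. *)
Lemma inward_translation Omega x0 : open Omega -> lipschitz_boundary Omega -> closure Omega x0 ->
  exists2 r : R, 0 < r & forall e, 0 < e -> exists c (eta : R),
    [/\ 0 < eta, `|c| + eta < e & forall y, closure Omega y -> `|y - x0| <= r ->
      forall h, `|h - c| <= eta -> Omega (y - h)].
Proof.
move=> oO lO clx0; have [ix0|nix0] := pselect (interior Omega x0).
  have [d d0 Hd] := (nbhs_rV x0 Omega).1 ix0.
  exists (d / 2); first exact: divr_gt0.
  move=> e e0; pose m := Num.min e d.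
  have m0 : 0 < m by rewrite lt_min e0.
  have me : m <= e by rewrite ge_min lexx.
  have md : m <= d by rewrite ge_min lexx orbT.
  exists 0, (m / 4); split; first exact: divr_gt0.
    by rewrite normr0 add0r; lra.
  move=> y _ yx h; rewrite subr0 => hm; apply: Hd.
  rewrite (_ : y - h - x0 = y - x0 - h); last by rewrite addrAC.
  by rewrite (le_lt_trans (ler_normB _ _))//; lra.
have [r0 [Q [i [k [gamma [r00 QQ lgamma HO]]]]]] := lO x0 (conj clx0 nix0).
have [C C0 HC] := mulmx_norm_le Q.
have QtQ : Q^T *m Q = 1%:M by exact: mulmx1C.
pose g x := gamma (col' i (x *m Q)) - (x *m Q) 0 i.
pose K := (`|k| + 1) * C + 1.
have K1 : 1 <= K by rewrite lerDr mulr_ge0// addr_ge0.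
have K0 : 0 < K by lra.
have gK x y : `|g x - g y| <= K * `|x - y|.
  have xyQ j : `|(x *m Q) 0 j - (y *m Q) 0 j| <= C * `|x - y|.
    by have := HC (x - y) j; rewrite mulmxBl !mxE.
  apply: (@le_trans _ _ (`|k| * (C * `|x - y|) + C * `|x - y|)); last first.
    by rewrite /K !mulrDl !mul1r mulrA lerDl.
  rewrite (_ : g x - g y = (gamma (col' i (x *m Q)) - gamma (col' i (y *m Q))) - ((x *m Q) 0 i - (y *m Q) 0 i)); last by rewrite /g; ring.
  rewrite (le_trans (ler_normB _ _))// lerD//.
  have := lgamma (col' i (x *m Q), col' i (y *m Q)) (conj I I) => /= lg.
  rewrite (le_trans lg)//.
  apply: (@le_trans _ _ (`|k| * `|col' i (x *m Q) - col' i (y *m Q)|)).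
    by rewrite ler_wpM2r// ler_norm.
  rewrite ler_wpM2l//; apply: rV_norm_le; first by rewrite mulr_ge0.
  by move=> j; have := xyQ (lift i j); rewrite !mxE.
(* This is the i-th axis of the rotated coordinates, written in the original ones. *)
pose d : E := delta_mx 0 i *m Q^T.
have gd x (t : R) : g (x + t *: d) = g x - t.
  have e : (x + t *: d) *m Q = x *m Q + t *: delta_mx 0 i.
    by rewrite mulmxDl -scalemxAl -mulmxA QtQ mulmx1.
  rewrite /g e; move: (x *m Q) => A.
  have -> : (A + t *: delta_mx 0 i) 0 i = A 0 i + t by rewrite !mxE !eqxx mulr1.
  have -> : col' i (A + t *: delta_mx 0 i) = col' i A.
    apply/rowP => j; rewrite !mxE eqxx/= (_ : lift i j == i = false) ?mulr0 ?addr0//.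
    by rewrite eq_sym (negbTE (neq_lift i j)).
  by rewrite opprD addrA.
(* The chart is a Euclidean ball; [r1] is the radius of a sup norm ball contained in it. *)
pose r1 := r0 / (n%:R + 1).
have n10 : 0 < n%:R + 1 :> R by rewrite ltr_wpDl.
have r10 : 0 < r1 by exact: divr_gt0.
have HO' x : `|x - x0| < r1 -> (Omega x <-> g x < 0).
  move=> xr; rewrite /g subr_lt0; apply: HO.
  apply: (le_lt_trans (enorm_le_norm _)).
  apply: (@le_lt_trans _ _ ((n%:R + 1) * `|x - x0|)); first by rewrite ler_wpM2r// lerDl.
  by rewrite -ltr_pdivlMl// mulrC.
exists (r1 / 2); first exact: divr_gt0.
move=> e e0; pose m := Num.min e (r1 / 2).
have m0 : 0 < m by rewrite lt_min e0 divr_gt0.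
have me : m <= e by rewrite ge_min lexx.
have mr : m <= r1 / 2 by rewrite ge_min lexx orbT.
(* With this choice t |d| and t are at most m / 2, while eta below satisfies eta < t and K eta < t.
   The first facts keep |h| below m, the last one makes the gain t in [g] prevail. *)
pose t := m / 2 / (`|d| + 1).
have d10 : 0 < `|d| + 1 by rewrite ltr_wpDl.
have t0 : 0 < t by rewrite divr_gt0// divr_gt0.
have td : t * `|d| <= m / 2.
  have -> : m / 2 = t * (`|d| + 1) by rewrite /t divfK// gt_eqF.
  by rewrite ler_wpM2l ?(ltW t0)// lerDl.
have tm : t <= m / 2.
  by rewrite ler_pdivrMr// ler_peMr ?lerDr// divr_ge0// ltW.
pose eta := t / (2 * K).
have eta0 : 0 < eta by rewrite divr_gt0// mulr_gt0.
have etaK : K * eta < t.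
  by rewrite (_ : K * eta = t / 2); [lra|rewrite /eta; field; rewrite gt_eqF].
have etat : eta < t.
  by apply: le_lt_trans etaK; rewrite ler_peMl// ltW.
have etat2 : eta <= t / 2.
  rewrite (_ : t / 2 = K * eta); last by rewrite /eta; field; rewrite gt_eqF.
  by rewrite ler_peMl// ltW.
have cE : `|- (t *: d)| = t * `|d| by rewrite normrN normrZ gtr0_norm.
exists (- (t *: d)), eta; split => //; first by rewrite cE; lra.
move=> y cly yx h hc.
have hn : `|h| < m.
  rewrite -(subrK (- (t *: d)) h) (le_lt_trans (ler_normD _ _))// cE; lra.
(* If g y were positive, [g] would still be positive at nearby points of [Omega]; the radius [rr]
   also keeps these inside the chart, where [HO'] gives the contradiction. *)
have gy : g y <= 0.
  rewrite leNgt; apply/negP => gy0.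
  pose rr := Num.min (g y / K) (r1 / 2).
  have rr0 : 0 < rr by rewrite lt_min !divr_gt0.
  have nb : nbhs y [set z | `|z - y| < rr] by apply/nbhs_rV; exists rr.
  have [z [Oz zy]] := cly _ nb.
  move: zy => /=; rewrite lt_min => /andP[zy1 zy2].
  have zx : `|z - x0| < r1.
    by rewrite -(subrK y z) -addrA (le_lt_trans (ler_normD _ _))//; lra.
  have gz := (HO' z zx).1 Oz.
  have := gK y z; rewrite distrC -(distrC z) => /(le_trans (ler_norm _)).
  rewrite ltr_pdivlMr// mulrC in zy1.
  have := ler_norm (g z - g y); have := gK z y.
  have := ler_norm (- (g z - g y)); rewrite normrN; lra.
have yh : y - h = y + t *: d - (h + t *: d) by rewrite opprD addrACA subrr addr0.
apply: ((HO' (y - h) _).2).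
  rewrite (_ : y - h - x0 = y - x0 - h); last by rewrite addrAC.
  by rewrite (le_lt_trans (ler_normB _ _))//; lra.
have := gK (y - h) (y + t *: d); rewrite gd.
rewrite (_ : y - h - (y + t *: d) = - (h + t *: d)); last first.
  by rewrite !opprD addrACA subrr add0r.
rewrite normrN; rewrite opprK in hc.
have : K * `|h + t *: d| <= K * eta by rewrite ler_wpM2l// ltW.
have := ler_norm (g (y - h) - (g y - t)); lra.
Qed.

End inward_translation.

Section density.
Context {R : realType} {n : nat} (p s : R).
Hypotheses (p1 : 1 < p) (s01 : 0 < s < 1).
Local Notation E := 'rV[R]_n.
Local Notation mu := (@lebesgue_rV R n).
Local Notation mu2 := (@lebesgue_rV2 R n).
Local Notation D := (@nonlocal_gradient R n p s).
Variable Omega : set E.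
Hypotheses (bOmega : bounded_set Omega) (oOmega : open Omega) (lOmega : lipschitz_boundary Omega).

Let p0 : 0 < p. Proof. exact: lt_trans ltr01 p1. Qed.

Lemma bounded_cube : exists2 M : R, 0 < M & forall x, Omega x -> half_open_cube M x /\ `|x| <= M.
Proof.
have [M [_ HM]] := bOmega; exists (`|M| + 2) => [|x Ox]; first by rewrite ltr_wpDl.
have xM : `|x| <= `|M| + 1.
  by apply: HM Ox; rewrite (le_lt_trans (ler_norm _))// ltrDl.
split=> [i|]; last by lra.
have := le_trans (rV_norm_coord x i) xM.
by rewrite ler_norml => /andP[h1 h2]; apply/andP; split; lra.
Qed.

Lemma W0sp_L1 w : W0sp p s Omega w -> mu.-integrable setT (EFin \o w).
Proof.
move=> [/(WspP s p1)[mw lw _] w0]; have [M M0 HM] := bounded_cube.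
apply: (@le_L1_ae _ _ _ _ _ (fun x => `|w x| `^ p + \1_(half_open_cube M) x)) => //.
  apply: filterS w0 => x wx; have [Ox|nOx] := pselect (Omega x).
    rewrite indicE mem_set; last by have [] := HM x Ox.
    have := le_addr_powR p1 ltr01 (normr_ge0 (w x)).
    by rewrite powR1 mul1r addrC.
  by rewrite wx// normr0 addr_ge0 ?powR_ge0.
by apply: L1D => //; exact: L1_half_open_cube.
Qed.

Lemma energy_ae0 (w : E -> R) : measurable_fun setT w -> {ae mu, forall x, w x = 0} -> energy p s w = 0.
Proof.
move=> mw w0; rewrite /energy.
have h : {ae mu2, forall z, `|D w z| `^ p = 0}.
  apply: filterS (ae_rV2 w0) => z [z1 z2].
  by rewrite /nonlocal_gradient z1 z2 subrr mul0r normr0 powR0// gt_eqF.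
have mD : measurable_fun setT (fun z => `|D w z| `^ p).
  apply: measurableT_comp (measurable_powR _) _; apply: measurableT_comp => //.
  exact: measurable_gradient.
rewrite (@Rintegral_ae _ _ _ _ _ (fun=> 0)) ?Rintegral0//; last exact: L1_0.
apply: (@le_L1_ae _ _ _ _ _ (fun=> 0)) => //; last exact: L1_0.
by apply: filterS h => z ->; rewrite normr0.
Qed.

Variables (F : (E -> R) -> R) (C : R).
Hypothesis Flin : forall (c : R) u v, W0sp p s Omega u -> W0sp p s Omega v ->
  F (fun x => c * u x + v x) = c * F u + F v.
Hypothesis FC : forall u, W0sp p s Omega u -> `|F u| `^ p <= C * energy p s u.
Hypothesis F0 : forall v, W0sp p s Omega v -> test_function Omega v -> F v = 0.

(* Mollifying with a kernel supported near the translation provided by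
   [inward_translation] keeps the support inside [Omega]. *)
Lemma local_vanishing x0 : closure Omega x0 -> exists2 r : R, 0 < r &
  forall w, W0sp p s Omega w -> (forall x, r <= `|x - x0| -> w x = 0) -> F w = 0.
Proof.
move=> cx0; have [r r0 Hr] := inward_translation oOmega lOmega cx0.
exists r => // w W0w wr; have [Ww w0] := W0w.
have /(WspP s p1)[mw lwp lDw] := Ww; have lw := W0sp_L1 W0w.
apply/eqP/negPn/negP => Fw.
have Fwp : 0 < `|F w| `^ p by rewrite powR_gt0// normr_gt0.
have C1 : 0 < `|C| + 1 by rewrite ltr_wpDl.
(* Since F (v - w) = - F w for the mollification v, an energy of v - w at most [e] would bound the
   p-th power of the modulus of F w by half of itself. *)
pose e := `|F w| `^ p / 2 / (`|C| + 1).
have e0 : 0 < e by rewrite !divr_gt0.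
have [delta d0 Hd] := shift_Lp_small p1 (measurable_gradient p s mw) lDw e0.
have [c [eta [eta0 ce Hy]]] := Hr _ d0.
have eta20 : 0 < eta / 2 by rewrite divr_gt0.
have [rho [B [[mrho rhoB] lrho irho srho smrho]]] := exists_mollifier c eta20.
have rd h : rho h != 0 -> `|h| < delta.
  move=> /srho hc; rewrite -(subrK c h) (le_lt_trans (ler_normD _ _))//; lra.
pose v x := \int[mu]_y (rho (y - x) * w y).
have [mv bv lDv ev] : [/\ measurable_fun setT v, forall x, `|v x| <= B * \int[mu]_y `|w y|,
     mu2.-integrable setT (EFin \o (fun z => `|D (fun x => v x - w x) z| `^ p)) &
     energy p s (fun x => v x - w x) <= e] := mollification_energy p1 mw lw mrho rhoB lrho irho (fun h hh => Hd h (rd h hh)).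
set B' := B * _ in bv.
have vsupp x : v x != 0 -> exists y, [/\ closure Omega y, `|y - x0| <= r & `|y - x - c| < eta / 2].
  move=> vx; apply: contrapT => /forallNP ny; move/eqP: vx; apply.
  have ae0 : {ae mu, forall y, rho (y - x) * w y = 0}.
    apply: filterS w0 => y wy; have [->|rh] := eqVneq (rho (y - x)) 0; first by rewrite mul0r.
    have [Oy|/wy->] := pselect (Omega y); last by rewrite mulr0.
    have [yr|/wr ->] := ltP `|y - x0| r; last by rewrite mulr0.
    by case: (ny y); split; [exact: subset_closure|exact: ltW|exact: srho].
  rewrite /v (@Rintegral_ae _ _ _ _ _ (fun=> 0)) ?Rintegral0//; last exact: L1_0.
  apply: (@le_L1_ae _ _ _ _ _ (fun=> 0)); last exact: L1_0.
    apply: measurable_funM => //.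
    exact: (measurableT_comp mrho (measurable_rV_shift (- x))).
  by apply: filterS ae0 => y ->; rewrite normr0.
(* One half of eta is the radius of the kernel and the other is spent on passing to the closure: x =
   y - (y - x) with y - x within eta of c, so [inward_translation] applies. *)
have clv x : closure [set x | v x != 0] x -> Omega x.
  move=> clx; have nb : nbhs x [set x' | `|x' - x| < eta / 2] by apply/nbhs_rV; exists (eta / 2).
  have [x' [/= /vsupp[y [cy yr yc]] x'x]] := clx _ nb.
  have := Hy y cy yr (y - x); rewrite opprB addrCA subrr addr0; apply.
  rewrite (_ : y - x - c = (y - x' - c) + (x' - x)); last by rewrite [RHS]addrAC addrA subrK.
  by rewrite (le_trans (ler_normD _ _))// (splitr eta) lerD// ltW.
have [M M0 HM] := bounded_cube.
have tv : test_function Omega v.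
  split; [exact: smrho| |exact: clv].
  apply: bounded_closed_compact; last exact: closed_closure.
  exists M; split; first exact: num_real.
  by move=> t Mt x /clv /HM [_ /le_trans]; apply; exact: ltW.
have vO x : ~ Omega x -> v x = 0.
  by move=> nO; apply/eqP/negPn/negP => vx; apply: nO; apply: clv; apply: subset_closure.
have B'0 : 0 <= B' by apply: le_trans (bv 0).
have lvp : mu.-integrable setT (EFin \o (fun x => `|v x| `^ p)).
  apply: (@le_L1 _ _ _ _ _ (fun x => B' `^ p * \1_(half_open_cube M) x)).
  - by apply: measurableT_comp (measurable_powR _) _; exact: measurableT_comp.
  - move=> x; rewrite (ger0_norm (powR_ge0 _ _)); have [Ox|/vO->] := pselect (Omega x).
      rewrite indicE mem_set ?mulr1; last by have [] := HM x Ox.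
      by rewrite ge0_ler_powR ?nnegrE ?(ltW p0).
    by rewrite normr0 powR0 ?gt_eqF// mulr_ge0// powR_ge0.
  - by apply: L1Z; exact: L1_half_open_cube.
have Wvw : Wsp p s (fun x => v x - w x).
  apply/(WspP s p1); split => //; first exact: measurable_funB.
  have := L1_powR_lin p1 (-1) mw mv lwp lvp.
  congr (integrable _ _ (EFin \o _)); apply/funext => x.
  by rewrite mulN1r addrC.
have Wv : W0sp p s Omega v.
  split; last by apply: aeW => x; exact: vO.
  have := Wsp_lin p1 1 Wvw Ww; congr (Wsp p s _); apply/funext => x.
  by rewrite mul1r subrK.
have Fvw : F (fun x => v x - w x) = - F w.
  have := Flin (-1) W0w Wv; rewrite (F0 Wv tv) addr0 mulN1r => <-; congr F.
  by apply/funext => x; rewrite mulN1r addrC.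
have := FC (W0spB p1 Wv W0w); rewrite Fvw normrN => Fle.
have : `|F w| `^ p <= `|F w| `^ p / 2.
  apply: (le_trans Fle); apply: (@le_trans _ _ ((`|C| + 1) * e)).
    apply: (@le_trans _ _ (`|C| * energy p s (fun x => v x - w x))).
      by rewrite ler_wpM2r ?energy_ge0// ler_norm.
    by rewrite ler_pM ?energy_ge0// lerDl.
  by rewrite /e mulrC divfK// gt_eqF.
by rewrite leNgt ltr_pdivrMr// ltr_pMr// ltr1n.
Qed.

(** This is the density of test functions in dual form, which localises well: the linear functional
    is evaluated on the pieces of w separately. The pieces come from a finite cover of the compact
    closure of [Omega] by balls on which [local_vanishing] applies after a cutoff. *)
Lemma vanishing_of_test_functions w : W0sp p s Omega w -> F w = 0.
Proof.
have /choice[rr Hrr] : forall x0, exists r : R, 0 < r /\ (closure Omega x0 ->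
    forall w, W0sp p s Omega w -> (forall x, r <= `|x - x0| -> w x = 0) -> F w = 0).
  move=> x0; have [cx0|ncx0] := pselect (closure Omega x0).
    by have [r r0 H] := local_vanishing cx0; exists r.
  by exists 1.
pose B x0 := [set x : E | `|x - x0| < rr x0 / 2].
have rr2 x0 : 0 < rr x0 / 2 by have [r0 _] := Hrr x0; exact: divr_gt0.
have [M M0 HM] := bounded_cube.
have cO : compact (closure Omega).
  apply: bounded_closed_compact; last exact: closed_closure.
  exists M; split; first exact: num_real.
  move=> t Mt x clx; rewrite /= leNgt; apply/negP => tx.
  have nb : nbhs x [set x' | `|x' - x| < `|x| - t].
    by apply/nbhs_rV; exists (`|x| - t) => //; rewrite subr_gt0.
  have [x' [/HM [_ x'M] /= x'x]] := clx _ nb.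
  have := ler_normD x' (x - x'); rewrite addrC subrK (distrC x); lra.
rewrite compact_cover in cO.
have [|x clx|fs fsO cov] := cO E (closure Omega) B.
- move=> x0 _; rewrite openE => x; rewrite /B /= => xx0; apply/nbhs_rV; exists (rr x0 / 2 - `|x - x0|); first by rewrite subr_gt0.
  by move=> y yx /=; have := ler_normD (y - x) (x - x0); rewrite addrA subrK; lra.
- by exists x => //; rewrite /B /= subrr normr0.
(* The induction hypothesis is that w vanishes off the listed balls. Subtracting [chi] times w kills
   w on the first ball, which can then leave the list; for the empty list the energy is zero. *)
suff H (l : seq E) : (forall x0, x0 \in l -> closure Omega x0) -> forall w, W0sp p s Omega w ->
    {ae mu, forall x, (forall x0, x0 \in l -> ~ B x0 x) -> w x = 0} -> F w = 0.
  move=> W0w; apply: (H (finmap.enum_fset fs)) => //.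
    by move=> x0 x0fs; have := fsO x0 x0fs; rewrite inE.
  have [_ w0] := W0w; apply: filterS w0 => x wx nB; apply: wx => Ox.
  by have [x0 /= x0fs Bx] := cov x (subset_closure Ox); exact: nB x0 x0fs Bx.
elim: l => [|x0 l IH] lO {}w W0w wl.
  have [/(WspP s p1)[mw _ _] _] := W0w.
  have e0 : energy p s w = 0.
    by apply: energy_ae0 => //; apply: filterS wl => x; apply.
  have := FC W0w; rewrite e0 mulr0 => Fle.
  apply/eqP/negPn/negP => Fw; move: Fle.
  by rewrite leNgt powR_gt0// normr_gt0.
have [r0 Hr] := Hrr x0; have cx0 : closure Omega x0 by apply: lO; rewrite mem_head.
pose chi := clamp x0 (rr x0).
have L0 : 0 <= 2 / rr x0 by rewrite divr_ge0// ltW.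
have Wc : W0sp p s Omega (fun x => chi x * w x).
  apply: (@W0sp_cutoff R n p s p1 s01 Omega bOmega w chi (2 / rr x0)) => //.
  - exact: measurable_clamp.
  - by move=> x; exact: clamp_ge0_le1.
  - by move=> x y; exact: clamp_lipschitz.
have Fc : F (fun x => chi x * w x) = 0.
  by apply: (Hr cx0) => // x xr; rewrite /chi clamp0// mul0r.
have Wwc := W0spB p1 W0w Wc.
have Fwc : F (fun x => w x - chi x * w x) = 0.
  apply: IH => //; first by move=> y yl; apply: lO; rewrite inE yl orbT.
  apply: filterS wl => x wx nB.
  have [xr|xr] := leP `|x - x0| (rr x0 / 2).
    by rewrite /chi clamp1// mul1r subrr.
  rewrite wx ?mulr0 ?subrr// => y; rewrite inE => /orP[/eqP ->|]; last exact: nB.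
  by rewrite /B /= => xr'; move: xr; rewrite ltNge (ltW xr').
have := Flin 1 Wwc Wc; rewrite Fwc Fc mulr0 addr0 => <-; congr F.
by apply/funext => x; rewrite mul1r subrK.
Qed.

End density.

(** * Convergence of solutions and fluxes *)

Section weak_identity.
Context {R : realType} {n : nat} (p s : R).
Hypotheses (p1 : 1 < p) (s01 : 0 < s < 1) (n1 : (1 <= n)%N).
Local Notation E := 'rV[R]_n.
Local Notation mu2 := (@lebesgue_rV2 R n).
Local Notation D := (@nonlocal_gradient R n p s).
Local Notation "'L1 f" := (mu2.-integrable [set: (E * E)%type] (EFin \o f)) (at level 10, f at next level).
Local Notation p' := (p / (p - 1)).

Let p0 : 0 < p. Proof. exact: lt_trans ltr01 p1. Qed.

Lemma gradientZ t v : D (fun x => t * v x) = (fun z => t * D v z).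
Proof. by apply/funext => z; rewrite /nonlocal_gradient -mulrBr mulrA. Qed.

Lemma energyZ t (v : E -> R) : Wsp p s v -> energy p s (fun x : E => t * v x) = `|t| `^ p * energy p s v.
Proof.
move=> /(WspP s p1)[_ _ lv]; rewrite /energy gradientZ -RintegralZl//.
by apply: eq_Rintegral => z _; rewrite normrM powRM.
Qed.

(** The affine bound is used at the multiple of v whose energy is 1, where its right-hand side is 2
    A; undoing the scaling yields the homogeneous bound. *)
Lemma homogeneous_energy_bound (g A : R) (v : E -> R) : Wsp p s v -> 0 <= A ->
  (forall t, `|t * g| <= A * (1 + energy p s (fun x => t * v x))) ->
  `|g| `^ p <= (2 * A) `^ p * energy p s v.
Proof.
move=> Wv A0 Hg; have e0 : 0 <= energy p s v by exact: energy_ge0.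
have [e1|eN] := eqVneq (energy p s v) 0.
  have -> : g = 0.
    (* With zero energy the bound is the constant [A] for all t, and this t would give A + 1 <=
       A. *)
    apply/eqP/negPn/negP => gN; have := Hg ((A + 1) / g).
    by rewrite energyZ// e1 mulr0 addr0 mulr1 divfK// ger0_norm ?addr_ge0//; lra.
  by rewrite normr0 powR0 ?gt_eqF// mulr_ge0// powR_ge0.
have ep : 0 < energy p s v by rewrite lt_neqAle eq_sym eN.
pose t := energy p s v `^ (- p^-1).
have t0 : 0 < t by exact: powR_gt0.
have tp : `|t| `^ p * energy p s v = 1.
  rewrite gtr0_norm// -powRrM mulNr mulVf ?gt_eqF// -{2}(powRr1 e0) -powRD ?addNr ?powRr0//.
  by rewrite eN implybT.
have := Hg t; rewrite energyZ// tp normrM (gtr0_norm t0) => gt.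
have -> : energy p s v = (energy p s v `^ p^-1) `^ p by rewrite -powRrM mulVf ?gt_eqF// powRr1.
rewrite -powRM ?powR_ge0 ?mulr_ge0//.
rewrite ge0_ler_powR ?nnegrE ?(ltW p0) ?mulr_ge0 ?powR_ge0//.
have -> : energy p s v `^ p^-1 = t^-1 by rewrite -powRN opprK.
by rewrite ler_pdivlMr// mulrC; lra.
Qed.

Variables (lam Lam : R) (Omega : set E).
Hypotheses (lam0 : 0 <= lam) (Lam0 : 0 <= Lam).
Hypotheses (oOmega : open Omega) (bOmega : bounded_set Omega) (lOmega : lipschitz_boundary Omega).

Lemma admissible_norm (a : E * E -> R) : admissible lam Lam a -> {ae mu2, forall z, `|a z| <= Lam}.
Proof.
by move=> [_]; apply: filterS => z [_ /andP[l1 l2]]; rewrite ger0_norm// (le_trans lam0).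
Qed.

Lemma measurable_Jp d (T : measurableType d) q (f : T -> R) : measurable_fun setT f ->
  measurable_fun setT (fun x => Jp q (f x)).
Proof.
move=> mf; apply: measurable_funM => //; apply: measurableT_comp (measurable_powR _) _.
exact: measurableT_comp.
Qed.

Lemma L1_Jp_gradient (u : E -> R) : Wsp p s u -> measurable_fun setT (fun z => Jp p (D u z)) /\
  'L1 (fun z => `|Jp p (D u z)| `^ p').
Proof.
move=> /(WspP s p1)[mu_ _ lu]; split.
  by apply: measurable_Jp; exact: measurable_gradient.
by under eq_fun do rewrite norm_Jp_conj//.
Qed.

Lemma L1_ae_bounded (a h : E * E -> R) : measurable_fun setT a -> {ae mu2, forall z, `|a z| <= Lam} ->
  'L1 h -> 'L1 (fun z => a z * h z).
Proof.
move=> ma aL lh; apply: (@le_L1_ae _ _ _ _ _ (fun z => Lam * `|h z|)); last exact/L1Z/L1_norm.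
  by apply: measurable_funM => //; exact: L1_measurable lh.
by apply: filterS aL => z bz; rewrite normrM ler_wpM2r.
Qed.

Lemma L1_pairing (u v : E -> R) : Wsp p s u -> Wsp p s v -> 'L1 (fun z => Jp p (D u z) * D v z).
Proof.
move=> Wu Wv; have [mJ lJ] := L1_Jp_gradient Wu; have /(WspP s p1)[mv _ lv] := Wv.
by apply: (L1_young p1) => //; exact: measurable_gradient.
Qed.

(** The difference [F] of the two sides is linear, zero on test functions by the weak equation, and
    bounded by the energy: Young's inequality gives an affine bound for the pairing [G], made
    homogeneous by scaling. *)
Lemma weak_solution_W0sp (a : E * E -> R) f u : admissible lam Lam a -> dual_W0sp p s Omega f ->
  weak_solution p s Omega a f u -> forall v, W0sp p s Omega v ->
  2^-1 * (\int[mu2]_z (a z * (Jp p (D u z) * D v z))) = f v.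
Proof.
move=> ad df [Wu Hu] v Wv; have ma := admissible_measurable ad; have aL := admissible_norm ad.
have Wu' := Wu.1.
have lav x : W0sp p s Omega x -> 'L1 (fun z => a z * (Jp p (D u z) * D x z)).
  by move=> [Wx _]; apply: L1_ae_bounded => //; exact: L1_pairing.
pose G v := \int[mu2]_z (a z * (Jp p (D u z) * D v z)).
pose F v := 2^-1 * G v - f v.
have [C C0 HC] := dual_energy_bound p1 s01 n1 bOmega df.
have [C1 C10 HC1] := young p1 ltr01.
have Glin c x y : W0sp p s Omega x -> W0sp p s Omega y ->
    G (fun t => c * x t + y t) = c * G x + G y.
  move=> Wx Wy; rewrite /G gradient_lin -RintegralZl//; last exact: lav.
  rewrite -RintegralD//; [|exact/L1Z/lav|exact: lav].
  by apply: eq_Rintegral => z _; move: (a z) (Jp _ _) (D x z) (D y z) => *; ring.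
pose A := Lam * (1 + C1 * energy p s u).
have A0 : 0 <= A by rewrite mulr_ge0// addr_ge0// mulr_ge0// energy_ge0.
have GA x : W0sp p s Omega x -> `|G x| <= A * (1 + energy p s x).
  move=> Wx; have /(WspP s p1)[_ _ lx] := Wx.1; have /(WspP s p1)[_ _ lu] := Wu'.
  apply: (@le_trans _ _ (\int[mu2]_z (Lam * (1 * `|D x z| `^ p + C1 * `|D u z| `^ p)))).
    apply: Rintegral_norm_le_ae; [exact: lav|by apply: L1Z; apply: L1D; exact: L1Z|].
    apply: filterS aL => z az; rewrite normrM ler_pM// -(norm_Jp_conj (D u z) p1).
    exact: HC1.
  rewrite RintegralZl//; last by apply: L1D; exact: L1Z.
  rewrite RintegralD//; [|exact: L1Z|exact: L1Z].
  rewrite RintegralZl// RintegralZl// mul1r /A -mulrA ler_wpM2l//.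
  have := energy_ge0 p s x; have := energy_ge0 p s u; rewrite -/(energy p s x) -/(energy p s u).
  by move: (energy p s x) (energy p s u) => X Y Y0 X0; have := mulr_ge0 C10 (mulr_ge0 Y0 X0); lra.
have W0Z t x : W0sp p s Omega x -> W0sp p s Omega (fun y => t * x y).
  move=> Wx; have W0 := W0spB p1 Wx Wx; have := W0sp_lin p1 t Wx W0.
  by congr (W0sp p s Omega); apply/funext => y; rewrite subrr addr0.
have GB x : W0sp p s Omega x -> `|G x| `^ p <= (2 * A) `^ p * energy p s x.
  move=> Wx; apply: homogeneous_energy_bound => //; first by case: Wx.
  move=> t; have <- : G (fun y => t * x y) = t * G x; last exact/GA/W0Z.
  rewrite /G gradientZ -RintegralZl//; last exact: lav.
  by apply: eq_Rintegral => z _; rewrite [RHS]mulrCA; congr (_ * _); rewrite mulrCA.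
suff Fv : F v = 0 by apply/eqP; rewrite -subr_eq0 -/(G v) -/(F v) Fv.
apply: (@vanishing_of_test_functions R n p s p1 s01 Omega bOmega oOmega lOmega F
   (2 `^ p * ((2 * A) `^ p + C))) => //.
- move=> c x y Wx Wy; rewrite /F Glin// (df.1 c x y Wx Wy).
  by move: (G x) (G y) (f x) (f y) => *; ring.
- move=> x Wx; rewrite /F; apply: (le_trans (powR_normD _ _ p0)); rewrite -mulrA ler_wpM2l ?powR_ge0//.
  rewrite mulrDl lerD//; last by rewrite normrN; exact: HC.
  apply: le_trans (GB x Wx); rewrite ge0_ler_powR ?nnegrE ?(ltW p0)//.
  by rewrite normrM ler_piMl// ger0_norm ?invr_ge0// invf_le1// ler1n.
- move=> x Wx tx; apply/eqP; rewrite subr_eq0; apply/eqP; rewrite -(Hu x tx) /G.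
  by congr (_ * _); apply: eq_Rintegral => z _; rewrite gradient_pairing.
Qed.

End weak_identity.

(** * Strong convergence of the solutions *)

Section strong_convergence.
Context {R : realType} {n : nat} (p s : R).
Hypotheses (p1 : 1 < p) (s01 : 0 < s < 1) (n1 : (1 <= n)%N).
Local Notation E := 'rV[R]_n.
Local Notation mu := (@lebesgue_rV R n).
Local Notation mu2 := (@lebesgue_rV2 R n).
Local Notation D := (@nonlocal_gradient R n p s).
Local Notation "'L1 f" := (mu2.-integrable [set: (E * E)%type] (EFin \o f)) (at level 10, f at next level).
Local Notation p' := (p / (p - 1)).
Local Notation J := (Jp p).

Let p0 : 0 < p. Proof. exact: lt_trans ltr01 p1. Qed.

Variables (lam Lam : R) (Omega : set E).
Hypotheses (lam0 : 0 < lam) (lamLam : lam <= Lam).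
Hypotheses (oOmega : open Omega) (bOmega : bounded_set Omega) (lOmega : lipschitz_boundary Omega).
Variable f : (E -> R) -> R.
Hypothesis df : dual_W0sp p s Omega f.

Let Lam0 : 0 <= Lam. Proof. exact: le_trans (ltW lam0) lamLam. Qed.

(** Testing with u itself and writing e for its energy, coercivity gives lam e <= 2 f u; as the p-th
    power of |f u| is at most C e, it follows that e^(p - 1) <= [K]. The bound involves [f], [lam]
    and [p] but not the coefficient, hence it is uniform along the sequence. *)
Lemma weak_solution_energy_bound : exists2 M, 0 <= M & forall a u, admissible lam Lam a ->
  weak_solution p s Omega a f u -> energy p s u <= M.
Proof.
have [C C0 HC] := dual_energy_bound p1 s01 n1 bOmega df.
pose K := (2 / lam) `^ p * C.
have K0 : 0 <= K by rewrite mulr_ge0// powR_ge0.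
exists (K `^ (p - 1)^-1); first exact: powR_ge0.
move=> a u ad wu; have [Wu _] := wu.
have ma := admissible_measurable ad; have aL := admissible_norm (ltW lam0) ad.
have idu := weak_solution_W0sp p1 s01 n1 (ltW lam0) Lam0 oOmega bOmega lOmega ad df wu Wu.
have luu := L1_pairing p1 Wu.1 Wu.1.
have /(WspP s p1)[_ _ lDu] := Wu.1.
have e0 : 0 <= energy p s u by exact: energy_ge0.
have le1 : lam * energy p s u <= \int[mu2]_z (a z * (J (D u z) * D u z)).
  rewrite /energy -RintegralZl//; apply: Rintegral_le_ae; [exact: L1Z|exact: (L1_ae_bounded ma aL luu)|].
  case: ad => _; apply: filterS => z [_ /andP[az _]].
  by rewrite Jp_mulr// ler_wpM2r// powR_ge0.
have le2 : energy p s u <= 2 / lam * `|f u|.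
  apply: (@le_trans _ _ (2 / lam * f u)); last by rewrite ler_wpM2l ?ler_norm// divr_ge0// ltW.
  rewrite -idu; move: le1; move: (\int[mu2]_z _) => I le1.
  rewrite (_ : 2 / lam * (2^-1 * I) = I / lam); last by field; rewrite gt_eqF.
  by rewrite ler_pdivlMr// mulrC.
have le3 : energy p s u `^ p <= K * energy p s u.
  apply: (@le_trans _ _ ((2 / lam * `|f u|) `^ p)).
    by rewrite ge0_ler_powR ?nnegrE ?(ltW p0) ?mulr_ge0 ?invr_ge0 ?(ltW lam0).
  by rewrite powRM ?divr_ge0 ?(ltW lam0)// /K -mulrA ler_wpM2l ?powR_ge0//; exact: HC.
have [->|eN] := eqVneq (energy p s u) 0; first exact: powR_ge0.
have ep : 0 < energy p s u by rewrite lt_neqAle eq_sym eN.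
have p10 : 0 < p - 1 by rewrite subr_gt0.
have le4 : energy p s u `^ (p - 1) <= K.
  rewrite -(ler_pM2r ep) -{2}(powRr1 e0) -powRD ?subrK//.
  by rewrite eN implybT.
rewrite [leLHS](_ : _ = (energy p s u `^ (p - 1)) `^ (p - 1)^-1); last first.
  by rewrite -powRrM mulfV ?powRr1// gt_eqF.
by rewrite ge0_ler_powR ?nnegrE ?powR_ge0// invr_ge0 ltW.
Qed.

Variables (b : nat -> E * E -> R) (a : E * E -> R).
Hypotheses (adb : forall k, admissible lam Lam (b k)) (ada : admissible lam Lam a).
Hypothesis ba : forall h, 'L1 h -> \int[mu2]_z ((b k z - a z) * h z) @[k --> \oo] --> 0.
Variables (u_ : nat -> E -> R) (u : E -> R).
Hypotheses (solk : forall k, weak_solution p s Omega (b k) f (u_ k))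
  (sol : weak_solution p s Omega a f u).

Let w k x := u_ k x - u x.
Let Wk k : W0sp p s Omega (u_ k). Proof. by have [] := solk k. Qed.
Let Wu : W0sp p s Omega u. Proof. by have [] := sol. Qed.
Let Ww k : W0sp p s Omega (w k). Proof. exact: W0spB. Qed.

Let T k : R := \int[mu2]_z ((J (D (u_ k) z) - J (D u z)) * (D (u_ k) z - D u z)).

Let L1T k : 'L1 (fun z => (J (D (u_ k) z) - J (D u z)) * (D (u_ k) z - D u z)).
Proof.
have := L1B (L1_pairing p1 (Wk k).1 (Ww k).1) (L1_pairing p1 Wu.1 (Ww k).1).
by congr (integrable _ _ (EFin \o _)); apply/funext => z; rewrite /w gradientB mulrBl.
Qed.

Lemma monotone_pairing_cvg : T k @[k --> \oo] --> 0.
Proof.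
have [M M0 HM] := weak_solution_energy_bound.
have [P P0 HP] := poincare p1 s01 n1 bOmega.
have ma := admissible_measurable ada.
have mb k := admissible_measurable (adb k).
have aL := admissible_norm (ltW lam0) ada.
have bL k := admissible_norm (ltW lam0) (adb k).
pose M' := 2 `^ p * (M + M).
have M'0 : 0 <= M' by rewrite mulr_ge0 ?powR_ge0// addr_ge0.
have ew k : energy p s (w k) <= M'.
  have /(WspP s p1)[_ _ l1] := (Wk k).1; have /(WspP s p1)[_ _ l2] := Wu.1.
  have /(WspP s p1)[_ _ l3] := (Ww k).1.
  apply: (@le_trans _ _ (2 `^ p * (energy p s (u_ k) + energy p s u))); last first.
    rewrite ler_wpM2l ?powR_ge0// lerD//; [exact: HM (adb k) (solk k)|exact: HM ada sol].
  rewrite /energy -RintegralD// -RintegralZl//; last exact: L1D.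
  apply: Rintegral_le => //; first by apply: L1Z; exact: L1D.
  move=> z; rewrite gradientB; have := powR_normD (D (u_ k) z) (- D u z) p0.
  by rewrite normrN.
pose K := Lam + Lam.
have K0 : 0 <= K by rewrite addr_ge0.
have bK k : {ae mu2, forall z, `|b k z - a z| <= K}.
  apply: filterS2 (bL k) aL => z h1 h2.
  by rewrite (le_trans (ler_normB _ _))// lerD.
have [mJ lJ] := L1_Jp_gradient p1 Wu.1.
pose Mm := P * M' + M'.
have Mm0 : 0 <= Mm by rewrite addr_ge0// mulr_ge0.
have wM k : \int[mu]_x `|w k x| `^ p <= Mm.
  apply: (le_trans (HP _ (Ww k))); rewrite /Mm ler_wpDr//.
  by rewrite ler_wpM2l.
have wM' k : energy p s (w k) <= Mm by rewrite (le_trans (ew k))// lerDr mulr_ge0.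
have mba k : measurable_fun setT (fun z => b k z - a z) by exact: measurable_funB.
have fp := @flux_pairing R n p s p1 s01 (fun k z => b k z - a z) K w Mm mba K0 bK ba Mm0 (fun k => (Ww k).1) wM wM' _ mJ lJ.
(* Tested with [w k], both equations have right-hand side f (w k). So the integral of b J(D u_k) D w
   equals that of a J(D u) D w, and only the difference b - a remains. *)
have leT k : lam * T k <= - \int[mu2]_z ((b k z - a z) * (J (D u z) * D (w k) z)).
  have l1 := L1_pairing p1 (Wk k).1 (Ww k).1; have l2 := L1_pairing p1 Wu.1 (Ww k).1.
  have i1 := weak_solution_W0sp p1 s01 n1 (ltW lam0) Lam0 oOmega bOmega lOmega (adb k) df (solk k) (Ww k).
  have i2 := weak_solution_W0sp p1 s01 n1 (ltW lam0) Lam0 oOmega bOmega lOmega ada df sol (Ww k).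
  have B1 := L1_ae_bounded (mb k) (bL k) l1.
  have B2 := L1_ae_bounded (mb k) (bL k) l2.
  have B3 := L1_ae_bounded ma aL l2.
  have LT := L1_ae_bounded (mb k) (bL k) (L1T k).
  apply: (@le_trans _ _ (\int[mu2]_z (b k z * ((J (D (u_ k) z) - J (D u z)) * (D (u_ k) z - D u z))))).
    rewrite /T -RintegralZl//; apply: Rintegral_le_ae => //; first exact: L1Z.
    by case: (adb k) => _; apply: filterS => z [_ /andP[bz _]]; rewrite ler_wpM2r// Jp_monotone.
  rewrite (@eq_Rintegral _ _ _ _ _ (fun z => b k z * (J (D (u_ k) z) * D (w k) z) - b k z * (J (D u z) * D (w k) z))); last first.
    move=> z _; have -> : D (w k) z = D (u_ k) z - D u z by rewrite /w gradientB.
    by rewrite -[RHS]mulrBr -[in RHS]mulrBl.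
  rewrite RintegralB//.
  have -> : \int[mu2]_z ((b k z - a z) * (J (D u z) * D (w k) z)) =
      \int[mu2]_z (b k z * (J (D u z) * D (w k) z)) - \int[mu2]_z (a z * (J (D u z) * D (w k) z)).
    by rewrite -RintegralB//; apply: eq_Rintegral => z _; rewrite mulrBl.
  rewrite opprB lerD2r.
  have h20 : 2^-1 != 0 :> R by rewrite invr_eq0.
  by move: i1; rewrite -i2 => /(mulfI h20) ->.
have fpN : (fun k => lam^-1 * - (\int[mu2]_z ((b k z - a z) * (J (D u z) * D (w k) z)))) @ \oo --> (0 : R).
  apply/cvgr0Pnorm_le => e e0; have le0 : 0 < lam * e by rewrite mulr_gt0.
  have /cvgr0_norm_le /(_ _ le0) := fp; apply: filterS => k.
  by rewrite normrM normrN normfV (gtr0_norm lam0) ler_pdivrMl.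
apply: (squeeze_cvgr _ (cvg_cst 0) fpN).
apply: nearW => k; rewrite Rintegral_ge0/=; last by move=> z _; exact: Jp_monotone.
by rewrite ler_pdivlMl.
Qed.

(** The energies are bounded, so [d] is fixed first to make the first term small for all k; then [C]
    is fixed and [T k] tends to 0. *)
Let coercive_cvg (S : nat -> R) :
  (forall k, 0 <= S k) ->
  (forall d, 0 < d -> exists2 C, 0 <= C &
    forall k, S k <= d * (energy p s (u_ k) + energy p s u) + C * T k) ->
  S k @[k --> \oo] --> 0.
Proof.
move=> S0 HS; have [M M0 HM] := weak_solution_energy_bound.
apply/cvgr0Pnorm_le => e e0.
have M10 : 0 < M + M + 1 by rewrite ltr_wpDl// addr_ge0.
have d0 : 0 < e / 2 / (M + M + 1) by rewrite !divr_gt0.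
have [C C0 HC] := HS _ d0.
have C10 : 0 < C + 1 by rewrite ltr_wpDl.
have c0 : 0 < e / 2 / (C + 1) by rewrite !divr_gt0.
have /cvgr0_norm_le /(_ _ c0) := monotone_pairing_cvg.
apply: filterS => k Tk; rewrite ger0_norm//; apply: (le_trans (HC k)).
rewrite [leRHS](splitr e) lerD//.
  apply: (@le_trans _ _ (e / 2 / (M + M + 1) * (M + M + 1))); last by rewrite divfK// gt_eqF.
  rewrite ler_wpM2l ?(ltW d0)// ler_wpDr// lerD//; [exact: HM (adb k) (solk k)|exact: HM ada sol].
apply: (@le_trans _ _ ((C + 1) * (e / 2 / (C + 1)))); last by rewrite mulrC divfK// gt_eqF.
apply: (@le_trans _ _ (C * `|T k|)); first by rewrite ler_wpM2l// ler_norm.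
by rewrite ler_pM// lerDl.
Qed.

Lemma energy_diff_cvg : energy p s (fun x => u_ k x - u x) @[k --> \oo] --> 0.
Proof.
apply: coercive_cvg => [k|d d0]; first exact: energy_ge0.
have [C C0 HC] := Jp_coercive p1 d0; exists C => // k.
have /(WspP s p1)[_ _ l1] := (Wk k).1; have /(WspP s p1)[_ _ l2] := Wu.1.
have /(WspP s p1)[_ _ l3] := (Ww k).1; have lT := L1T k.
have l12 := L1D l1 l2.
rewrite /T /energy -RintegralD// -!RintegralZl// -RintegralD//; [|exact: L1Z|exact: L1Z].
apply: Rintegral_le => //; first by apply: L1D; exact: L1Z.
by move=> z; rewrite gradientB.
Qed.

Lemma L1_Jp_diff k : 'L1 (fun z => `|J (D (u_ k) z) - J (D u z)| `^ p').
Proof.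
have [C C0 HC] := Jp_coercive_dual p1 (@ltr01 R).
have /(WspP s p1)[_ _ l1] := (Wk k).1; have /(WspP s p1)[_ _ l2] := Wu.1.
have lT := L1T k; have l12 := L1D l1 l2.
have [m1 _] := L1_Jp_gradient p1 (Wk k).1; have [m2 _] := L1_Jp_gradient p1 Wu.1.
apply: (@le_L1 _ _ _ _ _ (fun z => 1 * (`|D (u_ k) z| `^ p + `|D u z| `^ p) +
  C * ((J (D (u_ k) z) - J (D u z)) * (D (u_ k) z - D u z)))).
- apply: measurableT_comp (measurable_powR _) _; apply: measurableT_comp => //.
  exact: measurable_funB.
- by move=> z; rewrite (ger0_norm (powR_ge0 _ _)).
- by apply: L1D; exact: L1Z.
Qed.

Lemma Jp_diff_cvg : \int[mu2]_z (`|J (D (u_ k) z) - J (D u z)| `^ p') @[k --> \oo] --> 0.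
Proof.
apply: coercive_cvg => [k|d d0]; first by apply: Rintegral_ge0 => z _; exact: powR_ge0.
have [C C0 HC] := Jp_coercive_dual p1 d0; exists C => // k.
have /(WspP s p1)[_ _ l1] := (Wk k).1; have /(WspP s p1)[_ _ l2] := Wu.1.
have lT := L1T k; have l12 := L1D l1 l2; have lJ := L1_Jp_diff k.
rewrite /T /energy -RintegralD// -!RintegralZl// -RintegralD//; [|exact: L1Z|exact: L1Z].
by apply: Rintegral_le => //; apply: L1D; exact: L1Z.
Qed.

End strong_convergence.

Section measurability_of_open_sets.
Context {R : realType} {n : nat}.
Local Notation E := 'rV[R]_n.

(** Every point of an open set lies in a rational box contained in it. This links the topology to
    the sigma-algebra generated by the coordinates, and makes [Omega] and its square measurable. *)
Lemma open_measurable_rV (A : set E) : open A -> measurable A.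
Proof.
move=> oA; pose f (i : 'I_n) (x : E) : R := x 0 i.
rewrite (_ : A = \bigcup_(k in [set k | rat_box_seq f k `<=` A]) rat_box_seq f k).
  apply: bigcup_measurable => k _; apply: measurable_rat_box => i.
  exact: measurable_rV_coord.
apply/seteqP; split=> [x Ax|x [k /= kA]]; last exact: kA.
move: oA; rewrite openE => /(_ x Ax) /nbhs_rV[r r0 Hr].
have /choice[a Ha] : forall i : 'I_n, exists q : rat, x 0 i - r < ratr q < x 0 i.
  move=> i; have [|q] := @rat_in_itvoo R (x 0 i - r) (x 0 i); first by rewrite gtrBl.
  by rewrite in_itv; exists q.
have /choice[b Hb] : forall i : 'I_n, exists q : rat, x 0 i < ratr q < x 0 i + r.
  move=> i; have [|q] := @rat_in_itvoo R (x 0 i) (x 0 i + r); first by rewrite ltrDl.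
  by rewrite in_itv; exists q.
have [k kE] := rat_box_seqE f ([ffun i => a i], [ffun i => b i]).
exists k => /=; rewrite kE.
  move=> y yx; apply: Hr; apply: rV_norm_lt => // i; have := yx i.
  rewrite !mxE !ffunE /f /= => /andP[h1 h2].
  have /andP[a1 a2] := Ha i; have /andP[b1 b2] := Hb i.
  by rewrite ltr_norml; apply/andP; split; lra.
move=> i; rewrite !ffunE /=.
by have /andP[_ ->] := Ha i; have /andP[-> _] := Hb i.
Qed.

End measurability_of_open_sets.

Lemma cvg_of_powR (R : realType) (x y : nat -> R) (l r : R) : 0 < r ->
  (forall k, `|x k - l| `^ r <= y k) -> y k @[k --> \oo] --> 0 -> x k @[k --> \oo] --> l.
Proof.
move=> r0 xy y0; apply/cvgrPdist_le => e e0.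
have er : 0 < e `^ r by exact: powR_gt0.
have /cvgr0_norm_le /(_ _ er) := y0; apply: filterS => k yk; rewrite distrC leNgt.
apply/negP => xe; have : e `^ r < `|x k - l| `^ r.
  by apply: gt0_ltr_powR; rewrite ?nnegrE// ltW.
by rewrite ltNge (le_trans (xy k))// (le_trans (ler_norm _)).
Qed.

(** * Weak convergence of the fluxes *)

Section flux_convergence.
Context {R : realType} {n : nat} (p s : R).
Hypothesis p1 : 1 < p.
Local Notation E := 'rV[R]_n.
Local Notation mu2 := (@lebesgue_rV2 R n).
Local Notation D := (@nonlocal_gradient R n p s).
Local Notation "'L1 f" := (mu2.-integrable [set: (E * E)%type] (EFin \o f)) (at level 10, f at next level).
Local Notation p' := (p / (p - 1)).
Local Notation J := (Jp p).

Let p'1 : 1 < p'. Proof. exact: conj_exp. Qed.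
Let p'0 : 0 < p'. Proof. exact: lt_trans ltr01 p'1. Qed.

Lemma fluxE (a : E * E -> R) u : flux p s a u = (fun z => a z * J (D u z)).
Proof. by apply/funext => z; rewrite /flux /Jp mulrA. Qed.

Lemma LpD_restrict (A : set (E * E)) r (w : E * E -> R) : 0 < r -> measurable A ->
  measurable_fun setT w -> 'L1 (fun z => `|w z| `^ r) ->
  [/\ LpD A r w, 'L1 (fun z => `|(w \_ A) z| `^ r) &
    \int[mu2]_z `|(w \_ A) z| `^ r <= \int[mu2]_z `|w z| `^ r].
Proof.
move=> r0 mA mw lw; have mwA : measurable_fun setT (w \_ A).
  by apply/(measurable_restrictT _ mA); exact: measurable_funTS.
have le z : `|(w \_ A) z| `^ r <= `|w z| `^ r.
  rewrite patchE; case: ifP => // _; rewrite normr0 powR0 ?gt_eqF//; exact: powR_ge0.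
have lwA : 'L1 (fun z => `|(w \_ A) z| `^ r).
  apply: (le_L1 _ _ lw) => [|z]; last by rewrite (ger0_norm (powR_ge0 _ _)).
  by apply: measurableT_comp (measurable_powR _) _; exact: measurableT_comp.
split => //; last exact: Rintegral_le.
by apply/LfunP.
Qed.

Lemma dual_LpD_bound (A : set (E * E)) r F : 0 < r ->
  dual (LpD A r) (LpD_norm A r) F -> exists2 C : R, 0 <= C &
  forall w, LpD A r w -> `|F w| `^ r <= C * \int[mu2]_z `|(w \_ A) z| `^ r.
Proof.
move=> r0 [_ [C HC]]; exists (`|C| `^ r); first exact: powR_ge0.
move=> w Aw; have := HC w Aw; rewrite /LpD_norm => Fw.
have /(LfunP _ _ r0)[_ lw] := Aw.
have N : (('N[mu2]_r%:E[EFin \o (w \_ A)] `^ r)%E = (\int[mu2]_z `|(w \_ A) z| `^ r)%:E).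
  by rewrite poweR_Lnorm ?lt0r_neq0// Rintegral_EFin.
have N0 : (0 <= 'N[mu2]_r%:E[EFin \o (w \_ A)])%E by exact: Lnorm_ge0.
move: N N0 Fw; case: ('N[_]__[_])%E => [y|//|//].
  rewrite poweR_EFin => -[<-]; rewrite lee_fin => y0; rewrite -EFinM lee_fin => Fw.
  rewrite -powRM// ge0_ler_powR ?nnegrE ?(ltW r0) ?mulr_ge0//.
  by rewrite (le_trans Fw)// ler_wpM2r// ler_norm.
by rewrite poweRyr ?gt_eqF.
Qed.

Variables (lam Lam : R) (Omega : set E).
Hypotheses (lam0 : 0 < lam) (lamLam : lam <= Lam) (oOmega : open Omega).
Let Lam0 : 0 <= Lam. Proof. exact: le_trans (ltW lam0) lamLam. Qed.
Variables (b : nat -> E * E -> R) (a : E * E -> R).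
Hypotheses (adb : forall k, admissible lam Lam (b k)) (ada : admissible lam Lam a).
Hypothesis ba : forall h, 'L1 h -> \int[mu2]_z ((b k z - a z) * h z) @[k --> \oo] --> 0.
Variables (u_ : nat -> E -> R) (u : E -> R).
Hypotheses (Wk : forall k, Wsp p s (u_ k)) (Wu : Wsp p s u).
Hypothesis LJ : forall k, 'L1 (fun z => `|J (D (u_ k) z) - J (D u z)| `^ p').
Hypothesis cJ : \int[mu2]_z (`|J (D (u_ k) z) - J (D u z)| `^ p') @[k --> \oo] --> 0.

Let A := Omega `*` Omega.
Let mA : measurable A. Proof. by apply: measurableX; exact: open_measurable_rV. Qed.

Lemma L1_powRM_ae_bounded (c h : E * E -> R) M : 0 <= M -> measurable_fun setT c -> measurable_fun setT h ->
  {ae mu2, forall z, `|c z| <= M} -> 'L1 (fun z => `|h z| `^ p') ->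
  'L1 (fun z => `|c z * h z| `^ p') /\
  \int[mu2]_z (`|c z * h z| `^ p') <= M `^ p' * \int[mu2]_z (`|h z| `^ p').
Proof.
move=> M0 mc mh cM lh.
have le : {ae mu2, forall z, `|c z * h z| `^ p' <= M `^ p' * `|h z| `^ p'}.
  apply: filterS cM => z cz; rewrite -powRM// ge0_ler_powR ?nnegrE ?(ltW p'0) ?mulr_ge0//.
  by rewrite normrM ler_wpM2r.
have lch : 'L1 (fun z => `|c z * h z| `^ p').
  apply: (@le_L1_ae _ _ _ _ _ (fun z => M `^ p' * `|h z| `^ p')); last exact: L1Z.
    apply: measurableT_comp (measurable_powR _) _; apply: measurableT_comp => //.
    exact: measurable_funM.
  by apply: filterS le => z; rewrite (ger0_norm (powR_ge0 _ _)).
split => //; rewrite -RintegralZl//; apply: Rintegral_le_ae => //; exact: L1Z.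
Qed.

(** In the term with b - a the factor J(D u) is fixed, so a functional on fluxes induces on bounded
    functions phi the functional F (phi J(D u)). It is represented by an integrable density h, and
    the weak-* convergence is applied to h. *)
Lemma flux_weak_cvg :
  weak_cvg (LpD A p') (LpD_norm A p') (fun k => flux p s (b k) (u_ k)) (flux p s a u).
Proof.
have ma := admissible_measurable ada; have aL := admissible_norm (ltW lam0) ada.
have mb k := admissible_measurable (adb k); have bL k := admissible_norm (ltW lam0) (adb k).
have [mJ lJ] := L1_Jp_gradient p1 Wu.
have mJk k := (L1_Jp_gradient p1 (Wk k)).1; have lJk k := (L1_Jp_gradient p1 (Wk k)).2.
have Lq (c h : E * E -> R) M : 0 <= M -> measurable_fun setT c -> measurable_fun setT h ->
    {ae mu2, forall z, `|c z| <= M} -> 'L1 (fun z => `|h z| `^ p') ->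
    [/\ LpD A p' (fun z => c z * h z) &
     \int[mu2]_z `|((fun z => c z * h z) \_ A) z| `^ p' <= M `^ p' * \int[mu2]_z (`|h z| `^ p')].
  move=> M0 mc mh cM lh; have [l1 l2] := L1_powRM_ae_bounded M0 mc mh cM lh.
  have [l3 l4 l5] := LpD_restrict p'0 mA (measurable_funM mc mh) l1.
  by split; [exact: l3|exact: le_trans l5 l2].
split=> [k||F dF].
- by rewrite fluxE; have [] := Lq _ _ _ Lam0 (mb k) (mJk k) (bL k) (lJk k).
- by rewrite fluxE; have [] := Lq _ _ _ Lam0 ma mJ aL lJ.
have [C C0 HC] := dual_LpD_bound p'0 dF; have [Flin _] := dF.
(* [functional_representation] is about functions bounded at every point, hence the truncation of b
   - a. It changes nothing almost everywhere: two values between [lam] > 0 and [Lam] differ by less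
   than [Lam]. *)
pose c k z := Num.max (- Lam) (Num.min Lam (b k z - a z)).
have mc k : measurable_fun setT (c k).
  by apply: measurable_maxr => //; apply: measurable_minr => //; exact: measurable_funB.
have cL k z : `|c k z| <= Lam.
  rewrite ler_norml /c le_max lexx/= ge_max ge_min lexx/= andbT.
  by rewrite (le_trans _ Lam0)// oppr_le0.
have cba k : {ae mu2, forall z, c k z = b k z - a z}.
  case: (adb k) => _; case: ada => _; apply: filterS2 => z [_ /andP[a1 a2]] [_ /andP[b1 b2]].
  have l0 := lam0; have -> : c k z = Num.max (- Lam) (b k z - a z).
    by rewrite /c (_ : Num.min Lam _ = b k z - a z)//; apply/min_idPr; lra.
  by apply/max_idPr; lra.
have cLae k : {ae mu2, forall z, `|c k z| <= Lam} by apply: aeW.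
have mdJ k : measurable_fun setT (fun z => J (D (u_ k) z) - J (D u z)) by exact: measurable_funB.
pose g1 k z := b k z * (J (D (u_ k) z) - J (D u z)).
pose g2 k z := (b k z - a z) * J (D u z).
pose g3 k z := c k z * J (D u z).
have [Wg1 ig1] : (forall k, LpD A p' (g1 k)) /\ (forall k, \int[mu2]_z `|(g1 k \_ A) z| `^ p' <=
    Lam `^ p' * \int[mu2]_z (`|J (D (u_ k) z) - J (D u z)| `^ p')).
  by split=> k; have [] := Lq _ _ _ Lam0 (mb k) (mdJ k) (bL k) (LJ k).
have LL0 : 0 <= Lam + Lam by rewrite addr_ge0.
have baL k : {ae mu2, forall z, `|b k z - a z| <= Lam + Lam}.
  apply: filterS2 (bL k) aL => z h1 h2.
  by rewrite (le_trans (ler_normB _ _))// lerD.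
have mba k : measurable_fun setT (fun z => b k z - a z) by exact: measurable_funB.
have Wg2 k : LpD A p' (g2 k) by have [] := Lq _ _ _ LL0 (mba k) mJ (baL k) lJ.
have Wg3 k : LpD A p' (g3 k) by have [] := Lq _ _ _ Lam0 (mc k) mJ (cLae k) lJ.
have Wq : LpD A p' (flux p s a u) by rewrite fluxE; have [] := Lq _ _ _ Lam0 ma mJ aL lJ.
(* [F] acts on functions rather than on classes; its bound by the norm makes it blind to changes on
   a null set. *)
have Fg23 k : F (g2 k) = F (g3 k).
  have cba0 : {ae mu2, forall z, `|b k z - a z - c k z| <= 0}.
    by apply: filterS (cba k) => z ->; rewrite subrr normr0.
  have mbac : measurable_fun setT (fun z => b k z - a z - c k z) by exact: measurable_funB.
  have [W23 i23] := Lq _ _ _ (lexx 0) mbac mJ cba0 lJ.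
  have := HC _ W23 => /le_trans/(_ (ler_wpM2l C0 i23)).
  rewrite powR0 ?gt_eqF// mul0r mulr0 => F0.
  have e : F (fun z => (b k z - a z - c k z) * J (D u z)) = 0.
    by apply/eqP/negPn/negP => FN; move: F0; rewrite leNgt powR_gt0// normr_gt0.
  have := Flin 1 _ _ W23 (Wg3 k); rewrite e mulr0 add0r => <-; congr F.
  by apply/funext => z; rewrite mul1r /g2 /g3 -mulrDl subrK.
have Fq k : F (flux p s (b k) (u_ k)) = F (g1 k) + F (g3 k) + F (flux p s a u).
  have Wbk : LpD A p' (fun z => b k z * J (D u z)) by have [] := Lq _ _ _ Lam0 (mb k) mJ (bL k) lJ.
  have e1 := Flin 1 _ _ (Wg1 k) Wbk; have e2 := Flin 1 _ _ (Wg2 k) Wq.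
  rewrite -addrA -Fg23 -[F (g2 k)]mul1r -e2 -[F (g1 k)]mul1r.
  rewrite (_ : (fun z => 1 * g2 k z + _) = (fun z => b k z * J (D u z))) -?e1; last first.
    apply/funext => z; rewrite fluxE /g2.
    by move: (b k z) (a z) (J (D u z)) => B X Y; ring.
  congr F; apply/funext => z; rewrite fluxE /g1.
  by move: (b k z) (J (D (u_ k) z)) (J (D u z)) => B X Y; ring.
have cg1 : F (g1 k) @[k --> \oo] --> 0.
  apply: (@cvg_of_powR _ _ (fun k => C * Lam `^ p' * \int[mu2]_z (`|J (D (u_ k) z) - J (D u z)| `^ p')) _ p') => //.
    by move=> k; rewrite subr0 (le_trans (HC _ (Wg1 k)))// -mulrA ler_wpM2l.
  have := cvgM (cvg_cst (C * Lam `^ p')) cJ; rewrite mulr0; exact.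
have cg3 : F (g3 k) @[k --> \oo] --> 0.
  pose Phi phi := F (fun z => phi z * J (D u z)).
  have WPhi phi : bounded_mfun phi -> LpD A p' (fun z => phi z * J (D u z)) /\
     `|Phi phi| `^ p' <= \int[mu2]_z (`|phi z| `^ p' * (C * `|J (D u z)| `^ p')).
    move=> [mphi [M phiM]]; have M0 : 0 <= M by apply: le_trans (phiM 0).
    have phiMae : {ae mu2, forall z, `|phi z| <= M} by apply: aeW.
    have [W _] := Lq _ _ _ M0 mphi mJ phiMae lJ; split => //.
    have [l1 _] := L1_powRM_ae_bounded M0 mphi mJ phiMae lJ.
    have [_ _ l5] := LpD_restrict p'0 mA (measurable_funM mphi mJ) l1.
    apply: (le_trans (HC _ W)); apply: (le_trans (ler_wpM2l C0 l5)).
    rewrite -RintegralZl//; rewrite le_eqVlt; apply/orP; left; apply/eqP.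
    by apply: eq_Rintegral => z _; rewrite normrM powRM// mulrCA.
  have Philin x phi psi : bounded_mfun phi -> bounded_mfun psi ->
      Phi (fun z => x * phi z + psi z) = x * Phi phi + Phi psi.
    move=> bphi bpsi; have [W1 _] := WPhi _ bphi; have [W2 _] := WPhi _ bpsi.
    rewrite -Flin//; congr F; apply/funext => z; rewrite mulrDl mulrA//.
  have lk : 'L1 (fun z => C * `|J (D u z)| `^ p') by exact: L1Z.
  have k0 z : 0 <= C * `|J (D u z)| `^ p' by rewrite mulr_ge0// powR_ge0.
  have [h lh Hh] := @functional_representation _ _ R (@sigma_finite_rV2 R n) Phi p' _ (ltW p'1) Philin lk k0 (fun phi bphi => (WPhi phi bphi).2).
  have FE : (fun k => F (g3 k)) = (fun k => \int[mu2]_z ((b k z - a z) * h z)).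
    apply/funext => k; have bc : bounded_mfun (c k) by split => //; exists Lam.
    rewrite -[F _]/(Phi (c k)) Hh//; apply: Rintegral_ae.
    - exact: L1_ae_bounded (mc k) (cLae k) lh.
    - exact: L1_ae_bounded (mba k) (baL k) lh.
    - by apply: filterS (cba k) => z ->.
  by rewrite FE; exact: ba.
rewrite (_ : (fun k => _) = (fun k => F (g1 k) + F (g3 k) + F (flux p s a u))); last by apply/funext => k; exact: Fq.
rewrite -[X in _ --> X]add0r -[X in _ --> X + _]addr0.
by apply: cvgD; [exact: cvgD|exact: cvg_cst].
Qed.

End flux_convergence.

Theorem theorem2p3 (R : realType) (n : nat) (p s lam Lam : R)
    (Omega : set 'rV[R]_n) :
  (1 <= n)%N -> 1 < p -> 0 < s < 1 -> 0 < lam -> lam <= Lam ->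
  bounded_lipschitz_domain Omega ->
  forall a_ : nat -> 'rV[R]_n * 'rV[R]_n -> R,
    (forall k, admissible lam Lam (a_ k)) ->
  exists (sigma : nat -> nat) (a : 'rV[R]_n * 'rV[R]_n -> R),
    [/\ forall i j, (i < j)%N -> (sigma i < sigma j)%N,
        admissible lam Lam a &
        H_converges p s Omega (fun k => a_ (sigma k)) a].
Proof.
move=> n1 p1 s01 lam0 lamLam [_ oO _ bO lO] a_ ad.
have [sigma [a [sinc ada wa]]] := admissible_weak_star (ltW lam0) lamLam ad.
exists sigma, a; split => // f df u_ q_ u q solk sol.
have adb k : admissible lam Lam (a_ (sigma k)) by exact: ad.
have wk k : weak_solution p s Omega (a_ (sigma k)) f (u_ k) by have [] := solk k.
have wu : weak_solution p s Omega a f u by have [] := sol.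
have qk : q_ = (fun k => flux p s (a_ (sigma k)) (u_ k)) by apply/funext => k; have [] := solk k.
have -> : q = flux p s a u by have [] := sol.
have Wk k : W0sp p s Omega (u_ k) by have [] := wk k.
have Wu : W0sp p s Omega u by have [] := wu.
have ed := energy_diff_cvg p1 s01 n1 lam0 lamLam oO bO lO df adb ada wa wk wu.
have lJ := L1_Jp_diff p1 wk wu.
have cJ := Jp_diff_cvg p1 s01 n1 lam0 lamLam oO bO lO df adb ada wa wk wu.
split; last first.
  rewrite qk; exact: (flux_weak_cvg p1 lam0 lamLam oO adb ada wa (fun k => (Wk k).1) Wu.1 lJ cJ).
(* Functionals bounded by the full norm are bounded by the energy, so the strong convergence in
   energy implies the weak one. *)
split => // F dF; have [C C0 HC] := dual_energy_bound p1 s01 n1 bO dF; have [Flin _] := dF.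
have p0 : 0 < p := lt_trans ltr01 p1.
apply: (cvg_of_powR p0 (y := fun k => C * energy p s (fun x => u_ k x - u x))).
  move=> k; have Ww := W0spB p1 (Wk k) Wu.
  suff <- : F (fun x => u_ k x - u x) = F (u_ k) - F u by exact: HC.
  have := Flin 1 _ _ Ww Wu; rewrite mul1r.
  rewrite (_ : (fun x => 1 * _ + _) = u_ k); first by move->; rewrite addrK.
  by apply/funext => x; rewrite mul1r subrK.
have := cvgM (cvg_cst C) ed; rewrite mulr0; exact.
Qed.
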